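(* Let $G$ be the simple algebraic group of type $G_2$ over $\Bbbk$, let $T$ be a maximal torus of $G$, $W=N_G(T)/T$ its Weyl group, and $c\in W$ a Coxeter element (of order $6$). Then the periodic connected components of $N_G(T)$ are exactly those corresponding to $c,c^2,c^3,c^4,c^5$, and the orders of the elements in these components are equal to $6,3,2,3,6$, respectively.
   Context: $\Bbbk$ is an algebraically closed field of characteristic zero. A connected component of an affine algebraic group is called periodic if all its elements have finite order. The connected components of $N_G(T)$ are the cosets $gT$, i.e. the elements of $W$. A Coxeter element of $W$ is a product of the reflections associated with the simple roots of a system of simple roots, taken in some order. *)

(* Defs.v *)
From HB Require Import structures.
From mathcomp Require Import all_boot all_order all_algebra.
From mathcomp Require Import mpoly.
Set Implicit Arguments. Unset Strict Implicit. Unset Printing Implicit Defensive.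
Import Order.TTheory GRing.Theory Num.Theory.
Local Open Scope ring_scope.

(* Affine algebraic groups over k are realised as Zariski closed subgroups    *)
(* of GL_n(k), with n arbitrary; subsets of 'M[k]_n are Prop-valued           *)
(* predicates.                                                                *)

Definition same_set (k : fieldType) (n : nat) (A B : 'M[k]_n -> Prop) : Prop :=
  forall g, A g <-> B g.

(* The value at A of a polynomial in the n ^ 2 matrix entries.                *)
Definition mxeval (k : fieldType) (n : nat) (p : {mpoly k[n * n]})
  (A : 'M[k]_n) : k := p.@[fun i => mxvec A 0 i].

(* Closed subsets of GL_n(k); polynomials in the entries suffice, since       *)
(* powers of det^-1 can be cleared from any equation.                         *)
Definition zclosed (k : fieldType) (n : nat) (X : 'M[k]_n -> Prop) : Prop :=
  exists S : {mpoly k[n * n]} -> Prop,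
    forall A, X A <-> A \in unitmx /\ (forall p, S p -> mxeval p A = 0).

Definition zconnected (k : fieldType) (n : nat) (X : 'M[k]_n -> Prop) : Prop :=
  (exists A, X A) /\
  forall Y Z : 'M[k]_n -> Prop, zclosed Y -> zclosed Z ->
    (forall A, X A -> Y A \/ Z A) ->
    (exists A, X A /\ Y A) -> (exists A, X A /\ Z A) ->
    exists A, [/\ X A, Y A & Z A].

Definition alg_group (k : fieldType) (n : nat) (G : 'M[k]_n -> Prop) : Prop :=
  [/\ zclosed G, G 1%:M,
      forall g h, G g -> G h -> G (g *m h)
    & forall g, G g -> G (invmx g)].

Definition normal_subgroup (k : fieldType) (n : nat) (H G : 'M[k]_n -> Prop) :
    Prop :=
  [/\ alg_group H, forall h, H h -> G h
    & forall g h, G g -> H h -> H (g *m h *m invmx g)].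

(* Simple as an algebraic group: finite normal subgroups are not excluded.    *)
Definition simple_alg_group (k : fieldType) (n : nat) (G : 'M[k]_n -> Prop) :
    Prop :=
  [/\ alg_group G, zconnected G,
      exists g h, [/\ G g, G h & g *m h <> h *m g]
    & forall H, normal_subgroup H G -> zconnected H ->
        same_set H G \/ (forall h, H h -> h = 1%:M)].

(* A torus is a connected diagonalizable algebraic group.                     *)
Definition torus (k : fieldType) (n : nat) (T : 'M[k]_n -> Prop) : Prop :=
  [/\ alg_group T, zconnected T
    & exists2 P : 'M[k]_n, P \in unitmx &
        forall t, T t -> is_diag_mx (P *m t *m invmx P)].

Definition maximal_torus (k : fieldType) (n : nat) (G T : 'M[k]_n -> Prop) :
    Prop :=
  [/\ torus T, forall t, T t -> G t
    & forall S, torus S -> (forall s, S s -> G s) ->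
        (forall t, T t -> S t) -> same_set S T].

(* The tangent space at 1: matrices X along which the derivative at 1 of      *)
(* every polynomial vanishing on G is zero.                                   *)
Definition Lie (k : fieldType) (n : nat) (G : 'M[k]_n -> Prop) (X : 'M[k]_n) :
    Prop :=
  forall p : {mpoly k[n * n]}, (forall g, G g -> mxeval p g = 0) ->
    \sum_(i < n * n) mxvec X 0 i * mxeval (p^`M(i)) 1%:M = 0.

(* A character of T is a function on matrices of which only the restriction   *)
(* to T matters; it is regular on T and multiplicative. The group X(T) is     *)
(* written multiplicatively below.                                            *)
Definition is_character (k : fieldType) (n : nat) (T : 'M[k]_n -> Prop)
    (chi : 'M[k]_n -> k) : Prop :=
  [/\ exists (p : {mpoly k[n * n]}) (m : nat),
        forall t, T t -> chi t = mxeval p t / (\det t) ^+ m,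
      forall t, T t -> chi t != 0
    & forall s t, T s -> T t -> chi (s *m t) = chi s * chi t].

(* Roots: the nontrivial weights of T in the adjoint representation.          *)
Definition is_root (k : fieldType) (n : nat) (G T : 'M[k]_n -> Prop)
    (alpha : 'M[k]_n -> k) : Prop :=
  [/\ is_character T alpha,
      exists2 t, T t & alpha t != 1
    & exists X : 'M[k]_n, [/\ X != 0, Lie G X
        & forall t, T t -> t *m X *m invmx t = alpha t *: X]].

Definition lin_indep (k : fieldType) (n r : nat) (T : 'M[k]_n -> Prop)
    (D : 'I_r -> 'M[k]_n -> k) : Prop :=
  forall m : 'I_r -> int,
    (forall t, T t -> \prod_i D i t ^ m i = 1) -> forall i, m i = 0.

(* The root system G_2, in coordinates with respect to a short simple root    *)
(* and a long simple root.                                                    *)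
Definition G2_positive_roots : seq (int * int) :=
  [:: (1, 0); (0, 1); (1, 1); (2, 1); (3, 1); (3, 2)].

Definition G2_roots : seq (int * int) :=
  G2_positive_roots ++ [seq (- x.1, - x.2) | x <- G2_positive_roots].

(* The root system of G relative to T is isomorphic to G_2: some linear       *)
(* embedding of Z^2 into X(T) carries G_2 onto the set of roots.              *)
Definition type_G2 (k : fieldType) (n : nat) (G T : 'M[k]_n -> Prop) : Prop :=
  exists alpha beta : 'M[k]_n -> k,
    [/\ is_character T alpha, is_character T beta,
        forall a b : int, (forall t, T t -> alpha t ^ a * beta t ^ b = 1) ->
          a = 0 /\ b = 0
      & forall chi, is_character T chi ->
          (is_root G T chi <->
           exists2 x, x \in G2_roots &
             forall t, T t -> chi t = alpha t ^ x.1 * beta t ^ x.2)].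

Definition normalizer (k : fieldType) (n : nat) (G T : 'M[k]_n -> Prop)
    (g : 'M[k]_n) : Prop :=
  G g /\ forall t, T t <-> T (g *m t *m invmx g).

Definition coset (k : fieldType) (n : nat) (T : 'M[k]_n -> Prop) (g : 'M[k]_n) :
    'M[k]_n -> Prop :=
  fun h => exists2 t, T t & h = g *m t.

(* Elements of W = N_G(T) / T, which are also the connected components of     *)
(* N_G(T).                                                                    *)
Definition weyl_elt (k : fieldType) (n : nat) (G T w : 'M[k]_n -> Prop) : Prop :=
  exists2 g, normalizer G T g & same_set w (coset T g).

(* The group law of W is the product of cosets, with neutral element T.       *)
Definition weyl_mul (k : fieldType) (n : nat) (v w : 'M[k]_n -> Prop) :
    'M[k]_n -> Prop :=
  fun h => exists a b, [/\ v a, w b & h = a *m b].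

Definition weyl_pow (k : fieldType) (n : nat) (T w : 'M[k]_n -> Prop) (i : nat) :
    'M[k]_n -> Prop :=
  iter i (weyl_mul w) T.

Definition weyl_prod (k : fieldType) (n r : nat) (T : 'M[k]_n -> Prop)
    (s : 'I_r -> 'M[k]_n -> Prop) : 'M[k]_n -> Prop :=
  foldr (fun i w => weyl_mul (s i) w) T (enum 'I_r).

Definition weyl_order (k : fieldType) (n : nat) (T w : 'M[k]_n -> Prop)
    (m : nat) : Prop :=
  [/\ (0 < m)%N, same_set (weyl_pow T w m) T
    & forall j, (0 < j < m)%N -> ~ same_set (weyl_pow T w j) T].

(* s acts on X(T), by (s chi)(t) = chi (g^-1 t g) for g in s, as the          *)
(* reflection chi |-> chi - <chi, alpha^vee> alpha; m below is the integer    *)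
(* <chi, alpha^vee>.                                                          *)
Definition is_reflection (k : fieldType) (n : nat) (G T : 'M[k]_n -> Prop)
    (alpha : 'M[k]_n -> k) (s : 'M[k]_n -> Prop) : Prop :=
  weyl_elt G T s /\
  forall g, s g ->
    (forall t, T t -> alpha (invmx g *m t *m g) = (alpha t)^-1) /\
    (forall chi, is_character T chi ->
       exists m : int, forall t, T t ->
         chi (invmx g *m t *m g) = chi t * alpha t ^ (- m)).

Definition simple_roots (k : fieldType) (n r : nat) (G T : 'M[k]_n -> Prop)
    (D : 'I_r -> 'M[k]_n -> k) : Prop :=
  [/\ forall i, is_root G T (D i), lin_indep T D
    & forall alpha, is_root G T alpha ->
        exists m : 'I_r -> int,
          ((forall i, 0 <= m i) \/ (forall i, m i <= 0)) /\
          forall t, T t -> alpha t = \prod_i D i t ^ m i].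

(* The order of the factors is arbitrary because the enumeration D of the     *)
(* simple roots is.                                                           *)
Definition coxeter_elt (k : fieldType) (n : nat) (G T c : 'M[k]_n -> Prop) :
    Prop :=
  exists (r : nat) (D : 'I_r -> 'M[k]_n -> k) (s : 'I_r -> 'M[k]_n -> Prop),
    [/\ simple_roots G T D, forall i, is_reflection G T (D i) (s i)
      & same_set c (weyl_prod T s)].

Definition elt_order (k : fieldType) (n : nat) (g : 'M[k]_n) (m : nat) : Prop :=
  [/\ (0 < m)%N, g ^+ m = 1%:M & forall j, (0 < j < m)%N -> g ^+ j <> 1%:M].

Definition periodic (k : fieldType) (n : nat) (C : 'M[k]_n -> Prop) : Prop :=
  forall g, C g -> exists m, elt_order g m.

(* Main.v *)
(** Everything is deduced from infinitesimal criteria: a space of polynomials on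
the connected group G that vanishes at 1 and is stable under differentiation
along Lie G vanishes on G (Krull's intersection theorem and the openness of
subgroups containing a neighbourhood of 1).

The radical of the trace form of Lie G consists of nilpotent matrices, since a
non-nilpotent element gives rise to rational semisimple elements; by Engel's
theorem it generates a connected unipotent normal subgroup of G, so it is zero.
Hence Lie(G)^T = Lie(T): the nilpotent part of an element of Lie(G)^T is
orthogonal to Lie G.  The block Gauss decomposition with respect to a generic
cocharacter of T then turns the equations of T into polynomials vanishing on G,
and C_G(T) = T follows, because elements of C_G(T) are block diagonal.

An element of the coset of g acting on the root lattice as M satisfies
(g t)^m = g^m N_m(t), and N_m(t) lies in the kernel of all roots, i.e. in the
center of G, as soon as 1 + M + ... + M^(m-1) = 0.  As t varies in the connected
group T, these central elements form a connected normal subgroup, so that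
N_m(t) = 1.  A Coxeter element acts with M^2 = M - 1; since it changes every
weight by an element of the root lattice, the center is trivial.  This gives
g^6 = 1 and all the orders.  An element of W that is not one of c, ..., c^5
fixes a root v, and then v(N_m(t)) = v(t)^m rules out finite order for suitable
t.  The facts about the action of W on the root lattice are finite checks. *)

Require Import Defs.
From HB Require Import structures.
From Stdlib Require Import Classical ClassicalEpsilon.
From mathcomp Require Import all_boot all_order all_algebra.
From mathcomp Require Import mpoly ring zify.
Set Implicit Arguments. Unset Strict Implicit. Unset Printing Implicit Defensive.
Import Order.TTheory GRing.Theory Num.Theory.
Local Open Scope ring_scope.


(** * Noetherian rings and Krull's intersection theorem *)

(** G is given only by its points and its roots relative to T: its center and the order of W are
    unknown at the start, and the weights of T on k^n might lie outside the root lattice. So an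
    element of W is handled through the integer matrix by which it acts on the root lattice. This
    matrix determines it because an element of G centralizing T lies in T, and because an element of
    T on which all roots are trivial is 1. The latter rests on the formula
    [chi (g^-1 t g) = chi t * u t] for all characters chi, with u in the root lattice; it is
    inherited from the reflections, which act on all of X(T) by adding multiples of roots.

    Simplicity tolerates finite normal subgroups, so it says something only about connected ones;
    hence the repeated proofs of connectedness.

    The passage from Lie algebra to group uses characteristic zero: a function of order N at 1 is
    recovered from its derivatives after division by N. Eigenvalues of elements of Lie G are
    arbitrary elements of k; cocharacters are extracted from their integer coordinates in a basis of
    the group that they generate. *)

Definition ideal (A : comNzRingType) (I : A -> Prop) : Prop :=
  [/\ I 0, forall x y, I x -> I y -> I (x + y) & forall a x, I x -> I (a * x)].

Fixpoint span_of (A : comNzRingType) (s : seq A) (x : A) : Prop :=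
  if s is a :: s' then exists2 c : A, span_of s' (x - c * a) & True else x = 0.

Definition noetherian (A : comNzRingType) : Prop :=
  forall I : A -> Prop, ideal I ->
    exists2 s : seq A, forall x, x \in s -> I x & forall x, I x -> span_of s x.

Section Span.
Variable A : comNzRingType.
Implicit Types (s : seq A) (I : A -> Prop).

Lemma span_of_ideal s : ideal (span_of s).
Proof.
elim: s => [|a s [IH0 IHD IHM]] /=.
  by split=> [|x y -> ->|b x ->]; rewrite ?addr0 ?mulr0.
split=> [|x y [c Hc _] [d Hd _]|b x [c Hc _]].
- by exists 0; rewrite ?mul0r ?subr0.
- by exists (c + d) => //; rewrite mulrDl opprD addrACA; apply: IHD.
- by exists (b * c) => //; rewrite -mulrA -mulrBr; apply: IHM.
Qed.

Lemma idealB I x y : ideal I -> I x -> I y -> I (x - y).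
Proof. by case=> _ D M Ix Iy; rewrite -mulN1r; apply/D/M. Qed.

Lemma ideal_sum I (T : Type) (r : seq T) (P : pred T) (F : T -> A) :
  ideal I -> (forall i, P i -> I (F i)) -> I (\sum_(i <- r | P i) F i).
Proof. by case=> I0 ID _ IF; elim/big_ind: _. Qed.

Lemma mem_span_of s x : x \in s -> span_of s x.
Proof.
elim: s => //= a s IH; rewrite inE => /predU1P[->|/IH xs].
  by exists 1; rewrite // mul1r subrr; case: (span_of_ideal s).
by exists 0; rewrite ?mul0r ?subr0.
Qed.

Lemma span_of_min s I x :
  ideal I -> (forall y, y \in s -> I y) -> span_of s x -> I x.
Proof.
move=> idI; have [I0 ID IM] := idI.
elim: s x => [|a s IH] x sI /=; first by move->.
case=> c xs _; rewrite -(subrK (c * a) x); apply: ID.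
  by apply: IH xs => y ys; apply: sI; rewrite inE ys orbT.
by apply/IM/sI; rewrite mem_head.
Qed.

Lemma span_of_sub s1 s2 x :
  {subset s1 <= s2} -> span_of s1 x -> span_of s2 x.
Proof.
move=> sub; apply: span_of_min (span_of_ideal s2) _ => y /sub.
exact: mem_span_of.
Qed.

Lemma span_of_iota (P : nat -> A) N x :
  span_of [seq P i | i <- iota 0 N] x ->
  exists c : nat -> A, x = \sum_(i < N) c i * P i.
Proof.
pose I x := exists c : nat -> A, x = \sum_(i < N) c i * P i.
apply: (@span_of_min _ I); last first.
  move=> y /mapP[i]; rewrite mem_iota /= add0n => lti ->.
  exists (fun j => (j == i)%:R); rewrite (bigD1 (Ordinal lti)) //= eqxx mul1r.
  by rewrite big1 ?addr0 // => j; rewrite -val_eqE /= => /negPf->; rewrite mul0r.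
split.
- by exists (fun=> 0); rewrite big1 // => i _; rewrite mul0r.
- move=> u v [c ->] [d ->]; exists (fun i => c i + d i).
  by rewrite -big_split /=; apply: eq_bigr => i _; rewrite mulrDl.
- move=> a u [c ->]; exists (fun i => a * c i).
  by rewrite mulr_sumr; apply: eq_bigr => i _; rewrite mulrA.
Qed.

(** The union of the ideals spanned by the initial segments of P is finitely generated, and its
    generators already lie in the span of a single segment. *)
Lemma noetherian_chain (P : nat -> A) : noetherian A ->
  exists N, span_of [seq P i | i <- iota 0 N] (P N).
Proof.
move=> nA; pose st N := [seq P i | i <- iota 0 N].
have st_le M N x : (M <= N)%N -> span_of (st M) x -> span_of (st N) x.
  move=> leMN; apply: span_of_sub => y /mapP[i]; rewrite mem_iota /= => lti ->.
  by apply: map_f; rewrite mem_iota /=; lia.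
pose J x := exists N, span_of (st N) x.
have idJ : ideal J.
  split=> [|x y [M xM] [N yN]|a x [N xN]].
  - by exists 0%N.
  - exists (maxn M N); case: (span_of_ideal (st (maxn M N))) => _ D _.
    by apply: D; [apply: st_le xM|apply: st_le yN]; rewrite ?leq_maxl ?leq_maxr.
  - by exists N; case: (span_of_ideal (st N)) => _ _ M; apply: M.
have [s sJ Js] := nA J idJ.
have [N sN] : exists N, forall x, x \in s -> span_of (st N) x.
  elim: s sJ {Js} => [|a s IH] sJ; first by exists 0%N.
  have [|N HN] := IH; first by move=> x xs; apply: sJ; rewrite inE xs orbT.
  have [M HM] := sJ a (mem_head _ _).
  exists (maxn M N) => x; rewrite inE => /predU1P[->|/HN].
    by apply: st_le HM; rewrite leq_maxl.
  by apply: st_le; rewrite leq_maxr.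
exists N; apply: (span_of_min (span_of_ideal _) sN); apply: Js.
by exists N.+1; apply: mem_span_of; apply: map_f; rewrite mem_iota /= add0n ltnS.
Qed.

End Span.

Lemma noetherian_field (F : fieldType) : noetherian F.
Proof.
move=> I [I0 ID IM]; have [[x [Ix nx]]|no] := classic (exists x, I x /\ x != 0).
  exists [:: x] => [y|y _]; first by rewrite inE => /eqP->.
  by exists (y / x); rewrite //= divfK ?subrr.
exists [::] => // x Ix /=; apply: NNPP => nx; apply: no; exists x; split=> //.
exact/eqP.
Qed.

Lemma noetherian_surj (A B : comNzRingType) (f : {rmorphism A -> B}) :
  (forall y, exists x, f x = y) -> noetherian A -> noetherian B.
Proof.
move=> surj nA I [I0 ID IM].
have [|s sI Is] := nA (fun x => I (f x)).
  split=> [|x y|a x]; rewrite ?rmorph0 // ?rmorphD ?rmorphM; [exact: ID|exact: IM].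
exists (map f s) => [y /mapP[x xs ->]|y Iy]; first exact: sI.
have [x fx] := surj y; move: Iy; rewrite -fx => /Is.
apply: (@span_of_min _ _ (fun x => span_of (map f s) (f x))) => [|z zs]; last by apply: mem_span_of; apply: map_f.
have [S0 SD SM] := span_of_ideal (map f s).
by split=> [|u v|a u]; rewrite ?rmorph0 ?rmorphD ?rmorphM //; [exact: SD|exact: SM].
Qed.

(** * Hilbert's basis theorem *)

Section Hilbert.
Variables (A : comNzRingType) (nA : noetherian A) (I : {poly A} -> Prop).
Hypothesis idI : ideal I.

(** Bounding the size, instead of prescribing the degree, admits 0 as a leading coefficient; this
    makes [leads d] an ideal, increasing in d. *)
Let leads d a := exists f, [/\ I f, (size f <= d.+1)%N & f`_d = a].

Lemma leads_ideal d : ideal (leads d).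
Proof.
have [I0 ID IM] := idI; split.
- by exists 0; rewrite size_poly0 coef0.
- move=> a b [f [If sf fa]] [g [Ig sg gb]]; exists (f + g).
  split; rewrite ?coefD ?fa ?gb //; first exact: ID.
  by rewrite (leq_trans (size_polyD _ _)) // geq_max sf.
- move=> a b [f [If sf fa]]; exists (a%:P * f).
  split; rewrite ?coefCM ?fa //; first exact: IM.
  by rewrite mul_polyC (leq_trans (size_scale_leq _ _)).
Qed.

Lemma leads_shift d a e : leads d a -> leads (d + e) a.
Proof.
have [I0 ID IM] := idI; case=> f [If sf fa]; exists ('X^e * f); split.
- exact: IM.
- rewrite (leq_trans (size_polyMleq _ _)) // size_polyXn; lia.
- by rewrite coefXnM ltnNge leq_addl /= addnK.
Qed.

Lemma leads_lift d : exists2 s : seq {poly A}, forall f, f \in s -> I f &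
  forall a, leads d a ->
    exists f, [/\ span_of s f, (size f <= d.+1)%N & f`_d = a].
Proof.
have [t tL Lt] := nA (leads_ideal d).
have [s [sI ts]] : exists s : seq {poly A}, (forall f, f \in s -> I f) /\
    forall a, a \in t -> exists f, [/\ f \in s, (size f <= d.+1)%N & f`_d = a].
  elim: t tL {Lt} => [|a t IH] tL; first by exists [::].
  have [|s [sI ts]] := IH; first by move=> x xt; apply: tL; rewrite inE xt orbT.
  have [f [If sf fa]] := tL a (mem_head _ _); exists (f :: s); split.
    by move=> g; rewrite inE => /predU1P[->|/sI].
  move=> b; rewrite inE => /predU1P[->|/ts[g [gs sg gb]]].
    by exists f; rewrite mem_head.
  by exists g; rewrite inE gs orbT.
exists s => // a /Lt.
apply: (@span_of_min _ _ (fun a => exists f : {poly A},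
  [/\ span_of s f, (size f <= d.+1)%N & f`_d = a])); last first.
  by move=> b /ts[f [fs sf fb]]; exists f; split=> //; apply: mem_span_of.
have [S0 SD SM] := span_of_ideal s; split.
- by exists 0; rewrite size_poly0 coef0.
- move=> b c [f [If sf fa]] [g [Ig sg gb]]; exists (f + g).
  split; rewrite ?coefD ?fa ?gb //; first exact: SD.
  by rewrite (leq_trans (size_polyD _ _)) // geq_max sf.
- move=> b c [f [If sf fa]]; exists (b%:P * f).
  split; rewrite ?coefCM ?fa //; first exact: SM.
  by rewrite mul_polyC (leq_trans (size_scale_leq _ _)).
Qed.

Lemma size_leq_lead (f : {poly A}) d :
  (size f <= d.+1)%N -> f`_d = 0 -> (size f <= d)%N.
Proof.
move=> sf fd; apply/leq_sizeP => j; rewrite leq_eqVlt => /predU1P[<- //|lt].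
by apply: (leq_sizeP _ _ sf).
Qed.

(** The ideal of all leading coefficients is finitely generated, hence realized in a single degree
    D. Above D the leading term of f is cancelled by a shifted lift of degree D; below D the ideals
    [leads d] are treated one degree at a time. *)
Lemma noetherian_poly_aux : exists2 s : seq {poly A},
  forall f, f \in s -> I f & forall f, I f -> span_of s f.
Proof.
have [I0 ID IM] := idI.
pose L a := exists d, leads d a.
have idL : ideal L.
  split=> [|a b [d da] [e eb]|a b [d db]].
  - by exists 0%N; case: (leads_ideal 0).
  - exists (d + e)%N; case: (leads_ideal (d + e)) => _ D _; apply: D.
      exact: leads_shift.
    by rewrite addnC; apply: leads_shift.
  - by exists d; case: (leads_ideal d) => _ _; apply.
have [t tL Lt] := nA idL.
have [D tD] : exists D, forall a, a \in t -> leads D a.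
  elim: t tL {Lt} => [|a t IH] tL; first by exists 0%N.
  have [|D HD] := IH; first by move=> x xt; apply: tL; rewrite inE xt orbT.
  have [e ea] := tL a (mem_head _ _); exists (D + e)%N => b.
  rewrite inE => /predU1P[->|/HD]; last exact: leads_shift.
  by rewrite addnC; apply: leads_shift.
have LD a : L a -> leads D a.
  by move/Lt; apply: span_of_min => //; apply: leads_ideal.
have low d : exists2 s : seq {poly A}, forall f, f \in s -> I f &
    forall f, I f -> (size f <= d)%N -> span_of s f.
  elim: d => [|d [s sI Is]].
    exists [::] => // f _; rewrite leqn0 size_poly_eq0 => /eqP-> //.
  have [u uI Lu] := leads_lift d.
  exists (u ++ s) => [f|f If sf].
    by rewrite mem_cat => /orP[/uI|/sI].
  have [|g [ug sg gd]] := Lu f`_d; first by exists f.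
  have [S0 SD SM] := span_of_ideal (u ++ s); rewrite -(subrK g f).
  apply: (SD); last by apply: span_of_sub ug => x xu; rewrite mem_cat xu.
  apply: (@span_of_sub _ s) => [x xs|]; first by rewrite mem_cat xs orbT.
  apply: Is; first by apply: idealB => //; apply: span_of_min ug.
  apply: size_leq_lead; last by rewrite coefB gd subrr.
  by rewrite (leq_trans (size_polyD _ _)) // geq_max sf size_polyN.
have [s sI Is] := low D; have [u uI Lu] := leads_lift D.
exists (u ++ s) => [f|f If].
  by rewrite mem_cat => /orP[/uI|/sI].
have [S0 SD SM] := span_of_ideal (u ++ s).
have [N] := ubnP (size f); elim: N f If => // N IH f If; rewrite ltnS => sfN.
have [sfD|ltD] := leqP (size f) D.
  by apply: (@span_of_sub _ s) (Is _ If sfD) => x xs; rewrite mem_cat xs orbT.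
case def_d: (size f) => [|d]; first by rewrite def_d in ltD.
have [|g [ug sg gD]] := Lu f`_d.
  by apply: LD; exists d, f; rewrite def_d.
have leDd: (D <= d)%N by rewrite -ltnS -def_d.
pose h := 'X^(d - D) * g.
have Sh : span_of (u ++ s) h.
  by apply: SM; apply: span_of_sub ug => x xu; rewrite mem_cat xu.
rewrite -(subrK h f); apply: (SD) => //; apply: IH.
  by apply: idealB => //; apply: IM; apply: span_of_min ug.
suff : (size (f - h)%R <= d)%N by move=> le; rewrite (leq_trans _ sfN) // def_d ltnS.
apply: size_leq_lead; last first.
  by rewrite coefB /h coefXnM ltnNge leq_subr /= subKn // gD subrr.
rewrite (leq_trans (size_polyD _ _)) // geq_max def_d leqnn size_polyN.
rewrite (leq_trans (size_polyMleq _ _)) // size_polyXn addSn /=.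
by rewrite (leq_trans (leq_add (leqnn _) sg)) // addnS subnK.
Qed.

End Hilbert.

Lemma noetherian_poly (A : comNzRingType) : noetherian A -> noetherian {poly A}.
Proof. by move=> nA I; apply: noetherian_poly_aux. Qed.

Section MpolyInd.
Variables (n : nat) (A : comNzRingType).

(** Reduces identities between morphisms or derivations of polynomial rings to constants and
    variables. *)
Lemma mpoly_closed_ind (P : {mpoly A[n]} -> Prop) :
  (forall c, P c%:MP) -> (forall i, P 'X_i) ->
  (forall p q, P p -> P q -> P (p + q)) ->
  (forall p q, P p -> P q -> P (p * q)) -> forall p, P p.
Proof.
move=> PC PX PD PM p; rewrite (mpolyE p).
elim/big_ind: _ => // [|m _]; first by rewrite -mpolyC0.
rewrite -mul_mpolyC; apply: (PM) => //; rewrite mpolyXE_id.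
elim/big_ind: _ => // [|i _]; first by rewrite -mpolyC1.
elim: (m i) => [|j IH]; first by rewrite expr0 -mpolyC1.
by rewrite exprS; apply: PM.
Qed.

End MpolyInd.

(** Adding a variable gives a quotient of a univariate polynomial ring, and noetherianity passes to
    quotients. *)
Lemma noetherian_mpoly n (A : comNzRingType) :
  noetherian A -> noetherian {mpoly A[n]}.
Proof.
move=> nA; elim: n => [|n /noetherian_poly IH].
  apply: (noetherian_surj (f := @mpolyC 0 A)) nA => y.
  elim/mpoly_closed_ind: y => [c|[]//|_ _ [x <-] [y <-]|_ _ [x <-] [y <-]].
  - by exists c.
  - by exists (x + y); rewrite rmorphD.
  - by exists (x * y); rewrite rmorphM.
pose f : {rmorphism {poly {mpoly A[n]}} -> {mpoly A[n.+1]}} :=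
  @horner_morph _ _ (@mwiden n A) 'X_ord_max (fun=> mulrC _ _).
apply: (noetherian_surj (f := f)) IH => y.
elim/mpoly_closed_ind: y => [c|i|_ _ [x <-] [y <-]|_ _ [x <-] [y <-]].
- by exists (c%:MP)%:P; rewrite /= horner_morphC /= mwidenC.
- have [j ->|->] := unliftP ord_max i; last by exists 'X; rewrite /= horner_morphX.
  exists ('X_j)%:P; rewrite /= horner_morphC /= mwidenX mnmwiden1; congr 'X_[U_(_)].
  by apply: val_inj; rewrite [RHS]lift_max.
- by exists (x + y); rewrite rmorphD.
- by exists (x * y); rewrite rmorphM.
Qed.

(** * Powers of an ideal and Krull's intersection theorem *)

Section PowerIdeal.
Variables (A : comNzRingType) (r : nat) (y : 'I_r -> A).

(** The N-th power of the ideal generated by the [y i]. Splitting off one generator at a time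
    matches the representation of its elements as values at y of homogeneous polynomials of degree
    N. *)
Fixpoint mpow (N : nat) (p : A) : Prop :=
  if N is N'.+1 then
    exists2 q : 'I_r -> A, forall i, mpow N' (q i) & p = \sum_i y i * q i
  else True.

Lemma mpow_ideal N : ideal (mpow N).
Proof.
elim: N => [|N [IH0 IHD IHM]] //; split=> /=.
- by exists (fun=> 0) => //; rewrite big1 // => i _; rewrite mulr0.
- move=> u v [q Hq ->] [q' Hq' ->]; exists (fun i => q i + q' i).
    by move=> i; apply: IHD.
  by rewrite -big_split; apply: eq_bigr => i _; rewrite mulrDr.
- move=> a u [q Hq ->]; exists (fun i => a * q i) => [i|]; first exact: IHM.
  by rewrite mulr_sumr; apply: eq_bigr => i _; rewrite mulrCA.
Qed.

Lemma mpow0 N : mpow N 0. Proof. by case: (mpow_ideal N). Qed.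

Lemma mpowD N u v : mpow N u -> mpow N v -> mpow N (u + v).
Proof. by case: (mpow_ideal N) => _ D _; apply: D. Qed.

Lemma mpowM N a u : mpow N u -> mpow N (a * u).
Proof. by case: (mpow_ideal N) => _ _ M; apply: M. Qed.

Lemma mpow_mulgen N i u : mpow N u -> mpow N.+1 (y i * u).
Proof.
move=> Hu; exists (fun j => if j == i then u else 0).
  by move=> j; case: ifP => // _; apply: mpow0.
rewrite (bigD1 i) //= eqxx big1 ?addr0 // => j /negPf->.
by rewrite mulr0.
Qed.

Lemma mpow_mul M N u v : mpow M u -> mpow N v -> mpow (M + N) (u * v).
Proof.
elim: M u => [|M IH] u; first by move=> _; rewrite add0n; apply: mpowM.
case=> q Hq -> Hv; rewrite mulr_suml addSn.
apply: (ideal_sum _ (mpow_ideal _)) => i _.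
rewrite -mulrA; apply: mpow_mulgen; exact: IH (Hq i) Hv.
Qed.

Lemma mpow_leq M N u : (M <= N)%N -> mpow N u -> mpow M u.
Proof.
elim: M N u => [|M IH] [|N] u //=; rewrite ltnS => leMN [q Hq ->].
by exists q => // i; apply: IH (Hq i).
Qed.

Local Arguments mpow : simpl never.

Lemma mpow_homog N u : mpow N u ->
  exists2 P : {mpoly A[r]}, P \is N.-homog & P.@[y] = u.
Proof.
elim: N u => [|N IH] u.
  by exists (u *: 1); rewrite ?rpredZ ?dhomog1 // mevalZ meval1 mulr1.
case=> q Hq ->.
have cP i : exists P : {mpoly A[r]}, P \is N.-homog /\ P.@[y] = q i.
  by have [P HP Pq] := IH _ (Hq i); exists P.
pose P i := proj1_sig (constructive_indefinite_description _ (cP i)).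
have HP i : P i \is N.-homog /\ (P i).@[y] = q i.
  exact: (proj2_sig (constructive_indefinite_description _ (cP i))).
exists (\sum_i 'X_i * P i).
  apply: rpred_sum => i _; rewrite -add1n; apply: dhomogM; last by case: (HP i).
  by rewrite dhomogX /= mdeg1.
by rewrite rmorph_sum; apply: eq_bigr => i _; rewrite rmorphM /= mevalXU (HP i).2.
Qed.

Lemma mpow_meval N (P : {mpoly A[r]}) : P \is N.+1.-homog -> mpow 1 P.@[y].
Proof.
move=> /dhomogP HP; rewrite (mpolyE P) rmorph_sum big_seq /=.
apply: (ideal_sum _ (mpow_ideal _)) => m /HP dm.
rewrite mevalZ mevalX; apply: mpowM.
have [i mi] : exists i, (0 < m i)%N.
  apply: NNPP => no; have : mdeg m = 0%N.
    rewrite mdegE big1 // => i _; apply/eqP; rewrite -leqn0 leqNgt.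
    by apply/negP => mi; apply: no; exists i.
  by rewrite dm.
rewrite (bigD1 i) //= -(prednK mi) exprS -mulrA.
exact: (@mpow_mulgen 0).
Qed.

Lemma pihomog_mul d i (c P : {mpoly A[r]}) : (i <= d)%N -> P \is i.-homog ->
  pihomog mdeg d (c * P) = pihomog mdeg (d - i) c * P.
Proof.
move=> leid HP; rewrite {1}(mpolyE c) mulr_suml raddf_sum /=.
rewrite (pihomogE mdeg (d - i) c) mulr_suml [RHS]big_mkcond /=.
apply: eq_bigr => m _; rewrite -!scalerAl linearZ /=.
have HmP : 'X_[m] * P \is (mdeg m + i).-homog.
  by apply: dhomogM => //; rewrite dhomogX.
case: eqP => [dm|/eqP dm].
  by rewrite pihomog_dE // -(subnK leid) -dm.
rewrite (pihomog_ne0 _ HmP) ?scaler0 //.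
by apply: contra dm => /eqP <-; rewrite addnK.
Qed.

(* Krull's intersection theorem. If [P_N] is homogeneous of degree [N] with [P_N(y) = f] *)
(* modulo [I], noetherianity of the polynomial ring writes some [P_N] as a combination   *)
(* [sum_(i < N) Q_i P_i] with [Q_i] homogeneous of degree [N - i > 0].                   *)
Theorem krull_intersection (I : A -> Prop) (f : A) : noetherian A -> ideal I ->
  (forall N, exists2 g, I g & mpow N (f - g)) ->
  exists2 a, mpow 1 a & I ((1 - a) * f).
Proof.
move=> nA idI HN.
have cP N : exists P : {mpoly A[r]}, P \is N.-homog /\ I (f - P.@[y]).
  have [g Ig /mpow_homog[P HP Py]] := HN N; exists P; split=> //.
  by rewrite Py subKr.
pose P N := proj1_sig (constructive_indefinite_description _ (cP N)).
have HP N : P N \is N.-homog /\ I (f - (P N).@[y]).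
  exact: (proj2_sig (constructive_indefinite_description _ (cP N))).
have [M /span_of_iota[c def_PM]] := noetherian_chain P (noetherian_mpoly nA).
have {}def_PM : P M = \sum_(i < M) pihomog mdeg (M - i) (c i) * P i.
  rewrite -{1}(pihomog_dE (HP M).1) def_PM raddf_sum /=.
  by apply: eq_bigr => i _; rewrite (pihomog_mul _ _ (HP i).1) // ltnW.
pose Q (i : 'I_M) := (pihomog mdeg (M - i) (c i)).@[y].
exists (\sum_i Q i).
  apply: (ideal_sum _ (mpow_ideal _)) => i _.
  apply: (@mpow_meval (M - i).-1); rewrite prednK ?subn_gt0 //.
  exact: pihomogP.
have -> : (1 - \sum_i Q i) * f =
    (f - (P M).@[y]) - \sum_i Q i * (f - (P i).@[y]).
  have -> : (P M).@[y] = \sum_i Q i * (P i).@[y].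
    by rewrite {1}def_PM rmorph_sum; apply: eq_bigr => i _; rewrite rmorphM.
  under [X in _ = _ - X]eq_bigr do rewrite mulrBr.
  by rewrite mulrBl mul1r mulr_suml sumrB opprB addrA subrK.
apply: idealB => //; first exact: (HP M).2.
by apply: ideal_sum => // i _; case: idI => _ _; apply; exact: (HP i).2.
Qed.

End PowerIdeal.

(** * Polynomial functions on matrices *)

Lemma invmx_mul (k : comUnitRingType) (n : nat) (A B : 'M[k]_n) :
  A \in unitmx -> B \in unitmx -> invmx (A *m B) = invmx B *m invmx A.
Proof.
move=> uA uB; have uAB : A *m B \in unitmx by rewrite unitmx_mul uA.
by rewrite -[RHS](mulmxK uAB) mulmxA mulmxKV // mulVmx // mul1mx.
Qed.

Section CharZero.
Variables (k : fieldType) (k_char0 : [pchar k] =i pred0).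

Lemma natr_neq0 m : (m.+1)%:R != 0 :> k.
Proof. by move/pcharf0P: k_char0 => ->. Qed.

Lemma natr_char0_inj : injective (fun m => m%:R : k).
Proof.
move=> i j; wlog leij : i j / (i <= j)%N => [H|].
  by have [/H|/ltnW/H H' /esym/H'] := leqP i j.
move=> /= eqij; apply/eqP; rewrite eqn_leq leij -subn_eq0.
by move/pcharf0P: k_char0 => H; rewrite -H natrB // eqij subrr /=.
Qed.

(** The positive integers are infinitely many distinct points in characteristic zero. The point is a
    successor so that it is nonzero, as parameters of cocharacters must be. *)
Lemma poly_nonroot (p : {poly k}) : p != 0 -> exists m : nat, p.[m.+1%:R] != 0.
Proof.
move=> np; pose s := [seq (i.+1)%:R : k | i <- iota 0 (size p)].
have us : uniq s.
  by rewrite map_inj_uniq ?iota_uniq // => i j /natr_char0_inj [].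
have : ~~ all (root p) s.
  apply/negP => /(max_poly_roots np)/(_ us).
  by rewrite size_map size_iota ltnn.
by case/allPn => x /mapP[i _ ->] nr; exists i.
Qed.

Lemma poly_eq0_evals (w p : {poly k}) : w != 0 ->
  (forall t, w.[t] != 0 -> p.[t] = 0) -> p = 0.
Proof.
move=> nw H; apply/eqP; apply/negPn/negP => np.
have [|m] := @poly_nonroot (w * p); first by rewrite mulf_neq0.
by rewrite hornerM mulf_eq0 negb_or => /andP[/H-> ]; rewrite eqxx.
Qed.

Lemma poly_eq_evals (w p q : {poly k}) : w != 0 ->
  (forall t, w.[t] != 0 -> p.[t] = q.[t]) -> p = q.
Proof.
move=> nw H; apply/eqP; rewrite -subr_eq0; apply/eqP.
apply: (poly_eq0_evals nw) => t /H pq.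
by rewrite hornerD hornerN pq subrr.
Qed.

End CharZero.

HB.lock Definition ev (k : fieldType) (n : nat) (A : 'M[k]_n)
  (p : {mpoly k[n * n]}) : k := meval (fun i => mxvec A 0 i) p.

HB.lock Definition psub (k : fieldType) (n : nat) (M : 'M[{mpoly k[n * n]}]_n)
  (p : {mpoly k[n * n]}) : {mpoly k[n * n]} :=
  p \mPo [tuple mxvec M 0 i | i < n * n].

Section Polynomials.
Variables (k : fieldType) (n : nat).
Local Notation R := {mpoly k[n * n]}.
Implicit Types (p q : R) (A B X : 'M[k]_n).

Lemma mxevalE p A : mxeval p A = ev A p. Proof. by rewrite unlock. Qed.

Lemma ev_is_zmod_morphism A : zmod_morphism (@ev k n A).
Proof. by move=> p q; rewrite unlock rmorphB. Qed.

Lemma ev_is_monoid_morphism A : monoid_morphism (@ev k n A).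
Proof. by rewrite unlock; split=> [|p q]; rewrite ?rmorph1 ?rmorphM. Qed.

HB.instance Definition _ A := GRing.isZmodMorphism.Build _ _ (@ev k n A)
  (ev_is_zmod_morphism A).

HB.instance Definition _ A := GRing.isMonoidMorphism.Build _ _ (@ev k n A)
  (ev_is_monoid_morphism A).

Lemma evC A c : ev A c%:MP = c. Proof. by rewrite unlock mevalC. Qed.

Lemma evX A i : ev A 'X_i = mxvec A 0 i. Proof. by rewrite unlock mevalXU. Qed.

Lemma ev0 A : ev A 0 = 0. Proof. exact: rmorph0. Qed.
Lemma ev1 A : ev A 1 = 1. Proof. exact: rmorph1. Qed.
Lemma evD A p q : ev A (p + q) = ev A p + ev A q. Proof. exact: rmorphD. Qed.
Lemma evB A p q : ev A (p - q) = ev A p - ev A q. Proof. exact: rmorphB. Qed.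
Lemma evM A p q : ev A (p * q) = ev A p * ev A q. Proof. exact: rmorphM. Qed.
Lemma evZ A c p : ev A (c *: p) = c * ev A p.
Proof. by rewrite -mul_mpolyC evM evC. Qed.
Lemma evXn A p m : ev A (p ^+ m) = ev A p ^+ m. Proof. exact: rmorphXn. Qed.
Lemma ev_sum A (T : Type) (r : seq T) (P : pred T) (F : T -> R) :
  ev A (\sum_(i <- r | P i) F i) = \sum_(i <- r | P i) ev A (F i).
Proof. exact: rmorph_sum. Qed.

(** The generic matrix: its entries are the coordinate functions. *)
Definition gmx : 'M[R]_n := vec_mx (\row_i 'X_i).

Lemma ev_gmx A : map_mx (ev A) gmx = A.
Proof. by apply/matrixP => i j; rewrite !mxE evX mxvecE. Qed.

Lemma ev_constmx A (B : 'M[k]_n) : map_mx (ev A) (map_mx (@mpolyC _ _) B) = B.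
Proof. by apply/matrixP => i j; rewrite !mxE evC. Qed.

Lemma ev_psub M p A : ev A (psub M p) = ev (map_mx (ev A) M) p.
Proof.
rewrite !unlock comp_mpoly_meval; apply: meval_eq => i.
by rewrite tnth_mktuple -map_mxvec mxE.
Qed.

(** The derivative of p at A in the direction B. *)
Definition dd p A B : k := \sum_i mxvec B 0 i * ev A p^`M(i).

Lemma dd_is_linear p A : linear_for *%R (dd p A).
Proof.
move=> c B C; rewrite /dd mulr_sumr -big_split /=; apply: eq_bigr => i _.
by rewrite linearP !mxE mulrDl -mulrA.
Qed.

HB.instance Definition _ p A :=
  GRing.isLinear.Build k 'M[k]_n k *%R (dd p A) (dd_is_linear p A).

Lemma ddD p q A B : dd (p + q) A B = dd p A B + dd q A B.
Proof.
rewrite /dd -big_split /=; apply: eq_bigr => i _.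
by rewrite mderivD rmorphD mulrDr.
Qed.

Lemma ddZ c p A B : dd (c *: p) A B = c * dd p A B.
Proof.
rewrite /dd mulr_sumr; apply: eq_bigr => i _.
by rewrite mderivZ evZ mulrCA.
Qed.

Lemma ddN p A B : dd (- p) A B = - dd p A B.
Proof. by rewrite -scaleN1r ddZ mulN1r. Qed.

Lemma ddM p q A B : dd (p * q) A B = dd p A B * ev A q + ev A p * dd q A B.
Proof.
rewrite /dd mulr_suml mulr_sumr -big_split /=; apply: eq_bigr => i _.
by rewrite mderivM rmorphD !rmorphM mulrDr !mulrA [ev A p * _]mulrC.
Qed.

Lemma ddC c A B : dd c%:MP A B = 0.
Proof. by rewrite /dd big1 // => i _; rewrite mderivC rmorph0 mulr0. Qed.

Lemma ddX i A B : dd 'X_i A B = mxvec B 0 i.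
Proof.
rewrite /dd (bigD1 i) //= big1 => [|j ji]; rewrite mderivX mnm1E.
  have -> : (U_(i) - U_(i) = 0 :> 'X_{1..n * n})%MM by apply/mnmP => j; rewrite mnmBE mnm0E subnn.
  by rewrite eqxx scale1r mpolyX0 rmorph1 mulr1 addr0.
by rewrite eq_sym (negPf ji) scale0r rmorph0 mulr0.
Qed.

(** The restriction of p to a polynomial curve of matrices. Identities for [dd] are obtained by
    differentiating such univariate polynomials, which are determined by their values. *)
Definition pcurve p (M : 'M[{poly k}]_n) : {poly k} :=
  mmap (@polyC k) (fun i => mxvec M 0 i) p.

Lemma horner_pcurve p M t : (pcurve p M).[t] = ev (map_mx (horner_eval t) M) p.
Proof.
elim/mpoly_closed_ind: p => [c|i|p q Hp Hq|p q Hp Hq]; rewrite /pcurve.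
- by rewrite mmapC hornerC evC.
- by rewrite mmapX mmap1U evX -map_mxvec mxE.
- by rewrite mmapD hornerD [LHS]/= -/(pcurve p M) -/(pcurve q M) Hp Hq rmorphD.
- by rewrite rmorphM hornerM [LHS]/= -/(pcurve p M) -/(pcurve q M) Hp Hq rmorphM.
Qed.

Lemma deriv_pcurve p M t :
  (pcurve p M)^`().[t] =
  dd p (map_mx (horner_eval t) M) (map_mx (fun u : {poly k} => u^`().[t]) M).
Proof.
elim/mpoly_closed_ind: p => [c|i|p q Hp Hq|p q Hp Hq].
- by rewrite ddC /pcurve mmapC derivC horner0.
- by rewrite ddX /pcurve mmapX mmap1U -map_mxvec mxE.
- by rewrite ddD -Hp -Hq {1}/pcurve mmapD derivD hornerD.
- rewrite ddM -Hp -Hq -!horner_pcurve {1}/pcurve rmorphM derivM.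
  by rewrite hornerD !hornerM.
Qed.

Definition line A B : 'M[{poly k}]_n :=
  map_mx polyC A + 'X *: map_mx polyC B.

Lemma horner_line A B t : map_mx (horner_eval t) (line A B) = A + t *: B.
Proof.
by apply/matrixP => i j; rewrite !mxE /horner_eval hornerD hornerM !hornerC hornerX.
Qed.

Lemma deriv_line A B t : map_mx (fun u : {poly k} => u^`().[t]) (line A B) = B.
Proof.
apply/matrixP => i j; rewrite !mxE derivD derivC add0r derivM derivX derivC.
by rewrite mulr0 addr0 mul1r hornerC.
Qed.

Lemma dd_line p A B : dd p A B = (pcurve p (line A B))^`().[0].
Proof. by rewrite deriv_pcurve horner_line deriv_line scale0r addr0. Qed.

Lemma horner_pline p A B t : (pcurve p (line A B)).[t] = ev (A + t *: B) p.
Proof. by rewrite horner_pcurve horner_line. Qed.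

(** The derivation of the coordinate ring given by the polynomial vector field M. *)
Definition vf (M : 'M[R]_n) p : R := \sum_i mxvec M 0 i * p^`M(i).

Lemma ev_vf M p A : ev A (vf M p) = dd p A (map_mx (ev A) M).
Proof.
rewrite /vf rmorph_sum; apply: eq_bigr => i _.
by rewrite rmorphM /= -map_mxvec mxE.
Qed.

End Polynomials.

(** * Vanishing ideals, Lie algebras and the infinitesimal criterion *)

HB.lock Definition ltrans (k : fieldType) (n : nat) (a : 'M[k]_n)
  (p : {mpoly k[n * n]}) : {mpoly k[n * n]} :=
  psub (map_mx (@mpolyC (n * n) k) a *m gmx k n) p.

HB.lock Definition rtrans (k : fieldType) (n : nat) (a : 'M[k]_n)
  (p : {mpoly k[n * n]}) : {mpoly k[n * n]} :=
  psub (gmx k n *m map_mx (@mpolyC (n * n) k) a) p.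

Section Vanishing.
Variables (k : fieldType) (n : nat).
Local Notation R := {mpoly k[n * n]}.
Implicit Types (p q f r : R) (A B g x : 'M[k]_n) (G H : 'M[k]_n -> Prop).

Definition vanish G p : Prop := forall g, G g -> ev g p = 0.

Lemma vanish_ideal G : ideal (vanish G).
Proof.
split=> [g _|p q Hp Hq g Gg|a p Hp g Gg]; first by rewrite ev0.
  by rewrite evD Hp ?Hq ?addr0.
by rewrite evM Hp ?mulr0.
Qed.

Lemma ev_ltrans a p A : ev A (ltrans a p) = ev (a *m A) p.
Proof. by rewrite ltrans.unlock ev_psub map_mxM ev_constmx ev_gmx. Qed.

Lemma ev_rtrans a p A : ev A (rtrans a p) = ev (A *m a) p.
Proof. by rewrite rtrans.unlock ev_psub map_mxM ev_constmx ev_gmx. Qed.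

(** Cramer's rule: the adjugate makes the entries of the inverse polynomial after multiplication by
    the determinant; products of entries call for higher powers. *)
Lemma ev_inv p : exists q m, forall x, x \in unitmx ->
  ev x q = (\det x) ^+ m * ev (invmx x) p.
Proof.
elim/mpoly_closed_ind: p => [c|i|p p' [q [m Hq]] [q' [m' Hq']]|
                             p p' [q [m Hq]] [q' [m' Hq']]].
- by exists c%:MP, 0%N => x _; rewrite !evC mul1r.
- exists (mxvec (\adj (gmx k n)) 0 i), 1%N => x ux; rewrite evX /invmx ux.
  rewrite linearZ /= mxE mulrA mulfV ?mul1r -?unitfE -?unitmxE //.
  have -> : ev x (mxvec (\adj (gmx k n)) 0 i) =
            map_mx (ev x) (mxvec (\adj (gmx k n))) 0 i by rewrite mxE.
  by rewrite map_mxvec map_mx_adj ev_gmx.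
- pose d : R := \det (gmx k n).
  have ed x : ev x d = \det x by rewrite /d -det_map_mx ev_gmx.
  exists (d ^+ m' * q + d ^+ m * q'), (m + m')%N => x ux.
  rewrite !evD !evM !evXn /= !ed Hq // Hq' // exprD mulrDr.
  by congr (_ + _); rewrite mulrA // [_ ^+ m' * _]mulrC.
- exists (q * q'), (m + m')%N => x ux.
  by rewrite !evM Hq // Hq' // exprD mulrACA.
Qed.

Section Group.
Variables (G : 'M[k]_n -> Prop) (algG : alg_group G).

Lemma alg_group_unit g : G g -> g \in unitmx.
Proof. by case: algG => -[S HS] _ _ _ /HS[]. Qed.

Lemma alg_group1 : G 1%:M. Proof. by case: algG. Qed.

Lemma alg_groupM g h : G g -> G h -> G (g *m h).
Proof. by case: algG => _ _ HM _; apply: HM. Qed.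

Lemma alg_groupV g : G g -> G (invmx g).
Proof. by case: algG => _ _ _; apply. Qed.

Lemma vanish_closed g :
  g \in unitmx -> (forall p, vanish G p -> ev g p = 0) -> G g.
Proof.
case: algG => -[S HS] _ _ _ ug Hg; apply/HS; split=> // p Sp.
by rewrite mxevalE; apply: Hg => h /HS[_ Sh]; rewrite -mxevalE; apply: Sh.
Qed.

Lemma zclosed_sub (P : R -> Prop) :
  zclosed (fun g => G g /\ forall p, P p -> ev g p = 0).
Proof.
case: algG => -[S HS] _ _ _; exists (fun p => S p \/ P p) => A; split.
  by case=> /HS[uA SA] PA; split=> // p [/SA|/PA]; rewrite -?mxevalE.
case=> uA H; split; last by move=> p Pp; rewrite -mxevalE; apply: H; right.
by apply/HS; split=> // p Sp; apply: H; left.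
Qed.

Lemma vanish_ltrans g p : G g -> vanish G p -> vanish G (ltrans g p).
Proof. by move=> Gg Ip h Gh; rewrite ev_ltrans Ip //; apply: alg_groupM. Qed.

Lemma vanish_rtrans g p : G g -> vanish G p -> vanish G (rtrans g p).
Proof. by move=> Gg Ip h Gh; rewrite ev_rtrans Ip //; apply: alg_groupM. Qed.

Hypothesis connG : zconnected G.

(* A subgroup containing a neighbourhood of 1 is open, and so is its complement. *)
Lemma open_subgroup H r : (forall g, H g -> G g) -> H 1%:M ->
  (forall g h, H g -> H h -> H (g *m h)) -> (forall g, H g -> H (invmx g)) ->
  ev 1%:M r != 0 -> (forall g, G g -> ev g r != 0 -> H g) ->
  forall g, G g -> H g.
Proof.
move=> HG H1 HM HV r1 rH g0 Gg0; apply: NNPP => nH0.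
pose P1 p := exists2 x, H x & p = ltrans (invmx x) r.
pose P2 p := exists2 y, G y /\ ~ H y & p = ltrans (invmx y) r.
case: connG => _ conn.
have Gu := alg_group_unit.
have [g Gg|||A [GA [_ Y] [_ Z]]] := conn _ _ (zclosed_sub P1) (zclosed_sub P2).
- have [Hg|nHg] := classic (H g); [right|left]; split=> // p.
    case=> y [Gy nHy] ->; rewrite ev_ltrans; apply/eqP/negPn/negP => /rH Hyg.
    apply: nHy; have -> : y = g *m invmx (invmx y *m g).
      by rewrite invmx_mul ?unitmx_inv ?Gu // invmxK mulKVmx ?Gu.
    by apply: (HM) => //; apply: HV; apply: Hyg; apply: alg_groupM=> //; apply: alg_groupV.
  case=> x Hx ->; rewrite ev_ltrans; apply/eqP/negPn/negP => /rH Hxg.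
  apply: nHg; rewrite -(mulKVmx (Gu _ (HG _ Hx)) g); apply: (HM) => //.
  by apply: Hxg; apply: alg_groupM => //; apply: alg_groupV; apply: HG.
- exists g0; split=> //; split=> // p [x Hx ->]; rewrite ev_ltrans.
  apply/eqP/negPn/negP => /rH Hxg; apply: nH0.
  rewrite -(mulKVmx (Gu _ (HG _ Hx)) g0); apply: (HM) => //.
  by apply: Hxg; apply: alg_groupM => //; apply: alg_groupV; apply: HG.
- exists 1%:M; split; first exact: alg_group1.
  split; first exact: alg_group1.
  move=> p [y [Gy nHy] ->]; rewrite ev_ltrans mulmx1.
  apply/eqP/negPn/negP => /rH Hy; apply: nHy.
  by rewrite -(invmxK y); apply/HV/Hy/alg_groupV.
have [HA|nHA] := classic (H A).
  move: (Y (ltrans (invmx A) r)); rewrite ev_ltrans mulVmx ?Gu // => H0.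
  by case/eqP: r1; apply: H0; exists A.
move: (Z (ltrans (invmx A) r)); rewrite ev_ltrans mulVmx ?Gu // => H0.
by case/eqP: r1; apply: H0; exists A.
Qed.

(** Stands in for the irreducibility of a connected group. The functions killed on G by some r with
    r(1) != 0 form an ideal P, and noetherianity provides a common multiplier [r0]. Left translation
    by x preserves P when [r0] is nonzero at x and at its inverse; so the stabilizer of P is an open
    subgroup, which is G. Translating f by g moves its value at g to the identity, where elements of
    P vanish. *)
Lemma identity_theorem f r :
  ev 1%:M r != 0 -> vanish G (r * f) -> vanish G f.
Proof.
pose P f := exists2 r, ev 1%:M r != 0 & vanish G (r * f).
have [I0 ID IM] := vanish_ideal G; have G1 := alg_group1.
have idP : ideal P.
  split=> [|f1 f2 [r1 n1 H1] [r2 n2 H2]|a f1 [r1 n1 H1]].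
  - by exists 1; rewrite ?ev1 ?oner_neq0 // mulr0.
  - exists (r1 * r2); first by rewrite evM mulf_neq0.
    rewrite mulrDr {1}[r1 * _]mulrC -!mulrA.
    by apply: ID; apply: IM.
  - by exists r1 => //; rewrite mulrCA; apply: IM.
have [r0 n0 Hr0] : exists2 r0, ev 1%:M r0 != 0 & forall f, P f -> vanish G (r0 * f).
  have [s sP Ps] := noetherian_mpoly (@noetherian_field k) idP.
  suff [r0 n0 H0] : exists2 r0, ev 1%:M r0 != 0 &
      forall f, f \in s -> vanish G (r0 * f).
    exists r0 => // f1 /Ps.
    apply: (@span_of_min _ _ (fun f => vanish G (r0 * f))) H0.
    split=> [|u v|a u]; rewrite ?mulr0 ?mulrDr //; first exact: ID.
    by rewrite mulrCA; apply: IM.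
  elim: s sP {Ps} => [|a s IH] sP; first by exists 1; rewrite ?ev1 ?oner_neq0.
  have [|r2 n2 H2] := IH; first by move=> y ys; apply: sP; rewrite inE ys orbT.
  have [r1 n1 H1] := sP a (mem_head _ _).
  exists (r1 * r2); first by rewrite evM mulf_neq0.
  move=> f1; rewrite inE => /predU1P[->|/H2 Hf]; last by rewrite -mulrA; apply: IM.
  by rewrite [r1 * _]mulrC -mulrA; apply: IM.
have Pext f1 f2 : (forall g, G g -> ev g f1 = ev g f2) -> P f1 -> P f2.
  by move=> ef [r1 n1 H1]; exists r1 => // g Gg; rewrite evM -ef -?evM ?H1.
pose H x := G x /\ forall f, P f <-> P (ltrans x f).
have Ptr x f1 : G x -> ev x r0 != 0 -> P f1 -> P (ltrans x f1).
  move=> Gx nx /Hr0 H1; exists (ltrans x r0); first by rewrite ev_ltrans mulmx1.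
  move=> g Gg; rewrite evM !ev_ltrans -evM H1 //; exact: alg_groupM.
have Gu := alg_group_unit.
have Pl x y f1 : P (ltrans x (ltrans y f1)) <-> P (ltrans (y *m x) f1).
  by split; apply: Pext => g _; rewrite !ev_ltrans mulmxA.
have Pl1 f1 : P (ltrans 1%:M f1) <-> P f1.
  by split; [apply: (Pext (ltrans _ f1))|apply: (Pext f1)] => g _; rewrite ev_ltrans mul1mx.
have [ri [m Hri]] := ev_inv r0.
have HG : forall g, G g -> H g.
  apply: (@open_subgroup H (r0 * ri)).
  - by move=> g [].
  - by split=> // f1; rewrite Pl1.
  - move=> g h [Gg Hg] [Gh Hh]; split; first exact: alg_groupM.
    by move=> f1; rewrite Hg Hh Pl.
  - move=> g [Gg Hg]; split; first exact: alg_groupV.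
    move=> f1; have [H1 H2] := Hg (ltrans (invmx g) f1).
    have [E1 E2] := Pl g (invmx g) f1; have [F1 F2] := Pl1 f1.
    move: E1 E2; rewrite (mulVmx (Gu _ Gg)) => E1 E2.
    by split=> Hf; [apply: (H2 (E2 (F2 Hf)))|apply: (F1 (E1 (H1 Hf)))].
  - rewrite evM Hri ?unitmx1 // invmx1 det1 expr1n mul1r.
    by rewrite mulf_neq0.
  - move=> g Gg; rewrite evM Hri ?Gu // !mulf_eq0 !negb_or.
    case/and3P=> n1 _ n2; split=> // f1; split; first exact: Ptr.
    move/(Ptr (invmx g) _ (alg_groupV Gg) n2).
    by move=> Hf; apply: (Pl1 f1).1; have := (Pl _ _ _).1 Hf; rewrite (mulmxV (Gu _ Gg)).
move=> nr Hr g Gg; have : P f by exists r.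
case: (HG g Gg) => _ HP /HP[r1 n1 /(_ 1%:M G1)].
rewrite evM ev_ltrans mulmx1 => /eqP; rewrite mulf_eq0 (negPf n1) /=.
by move/eqP.
Qed.

End Group.
End Vanishing.

(** A row space contained in V is enlarged by a vector of V outside it until the rank can no longer
    grow; excluded middle supplies the vector. *)
Lemma prop_subspace (F : fieldType) m (V : 'rV[F]_m -> Prop) : V 0 ->
  (forall a u v, V u -> V v -> V (a *: u + v)) ->
  exists C : 'M[F]_m, forall z, V z <-> (z <= C)%MS.
Proof.
move=> V0 VL.
suff H d (C : 'M[F]_m) : (m - \rank C <= d)%N -> (forall z, (z <= C)%MS -> V z) ->
    exists C : 'M[F]_m, forall z, V z <-> (z <= C)%MS.
  apply: (H m 0); first by rewrite leq_subr.
  by move=> z; rewrite submx0 => /eqP->.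
elim: d C => [|d IH] C Cd CV; have [all_in|no] := classic (forall z, V z -> (z <= C)%MS).
- by exists C => z; split=> [/all_in|/CV].
- have : row_full C by rewrite /row_full eqn_leq rank_leq_col -subn_eq0 -leqn0.
  by move=> fC; case: no => z _; rewrite submx_full.
- by exists C => z; split=> [/all_in|/CV].
have [z nz] := not_all_ex_not _ _ no.
have [Vz zC] : V z /\ ~~ (z <= C)%MS.
  by split; [apply: NNPP => nVz; case: nz|apply/negP => zC; apply: nz].
apply: (IH (C + z)%MS).
  have ltr : (\rank C < \rank (C + z))%N.
    rewrite ltnNge; apply: contra zC => le.
    apply: submx_trans (addsmxSr C z) _.
    by rewrite (geq_leqif (mxrank_leqif_sup (addsmxSl C z))) // in le.
  have := rank_leq_col C; lia.
move=> v /sub_addsmxP[[A D]] /= ->; rewrite addrC.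
have -> : D *m z = D 0 0 *: z by rewrite {1}[D]mx11_scalar mul_scalar_mx.
by apply: VL => //; apply/CV/submxMl.
Qed.

(** * Order of vanishing at the identity and the Lie algebra *)

Section Infinitesimal.
Variables (k : fieldType) (k_char0 : [pchar k] =i pred0) (n : nat).
Local Notation R := {mpoly k[n * n]}.
Implicit Types (p q f : R) (X A B g : 'M[k]_n).

(** Coordinates centred at the identity; they generate the ideal of 1, so [mpow coord N] consists of
    the polynomials of order at least N at 1. *)
Definition coord (i : 'I_(n * n)) : R := 'X_i - (mxvec (1%:M : 'M[k]_n) 0 i)%:MP.

Local Arguments mpow : simpl never.

Lemma mpow_ev1 p : ev 1%:M p = 0 -> mpow coord 1 p.
Proof.
suff H : mpow coord 1 (p - (ev 1%:M p)%:MP) by move=> p0; rewrite p0 mpolyC0 subr0 in H.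
elim/mpoly_closed_ind: p => [c|i|p q Hp Hq|p q Hp Hq].
- by rewrite evC subrr; apply: mpow0.
- by rewrite evX -[_ - _]mulr1; apply: (@mpow_mulgen _ _ _ 0).
- by rewrite evD mpolyCD opprD addrACA; apply: mpowD.
- rewrite evM mpolyCM; set a := _%:MP; set b := _%:MP.
  have -> : p * q - a * b = q * (p - a) + a * (q - b).
    by rewrite !mulrBr addrA [q * a]mulrC subrK [q * p]mulrC.
  by apply: mpowD; apply: mpowM.
Qed.

Lemma mderiv_sum_ord i m (F : 'I_m -> R) :
  (\sum_j F j)^`M(i) = \sum_j (F j)^`M(i).
Proof. exact: raddf_sum. Qed.

Lemma mderiv_coord i j : (coord j)^`M(i) = if i == j then 1 else 0.
Proof.
rewrite /coord mderivB mderivC subr0 mderivX mnm1E eq_sym; case: eqP => [->|_].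
  have -> : (U_(j) - U_(j) = 0 :> 'X_{1..n * n})%MM.
    by apply/mnmP => l; rewrite mnmBE mnm0E subnn.
  by rewrite scale1r mpolyX0.
by rewrite scale0r.
Qed.

Lemma mpow_mderiv N i p : mpow coord N.+1 p -> mpow coord N p^`M(i).
Proof.
elim: N p => [|N IH] p // [q Hq ->].
rewrite raddf_sum /=; apply: (ideal_sum _ (mpow_ideal coord _)) => j _.
rewrite mderivM; apply: mpowD; first by apply: mpowM.
apply: mpow_mulgen; exact: IH (Hq j).
Qed.

(** Euler's identity: the Euler field multiplies the homogeneous part of degree N by N, up to terms
    of higher order. *)
Lemma mpow_euler N p : mpow coord N p ->
  mpow coord N.+1 (\sum_i coord i * p^`M(i) - N%:R * p).
Proof.
elim: N p => [|N IH] p.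
  move=> _; rewrite mul0r subr0; apply: (ideal_sum _ (mpow_ideal coord _)) => j _.
  exact: mpow_mulgen.
case=> q Hq ->; have -> : \sum_i coord i * (\sum_j coord j * q j)^`M(i) -
    N.+1%:R * \sum_i coord i * q i =
    \sum_j coord j * (\sum_i coord i * (q j)^`M(i) - N%:R * q j).
  under eq_bigr => i _ do rewrite raddf_sum mulr_sumr.
  rewrite exchange_big mulr_sumr -sumrB; apply: eq_bigr => j _ /=.
  have E i : coord i * (coord j * q j)^`M(i) =
      (if i == j then coord j * q j else 0) + coord j * (coord i * (q j)^`M(i)).
    by rewrite mderivM mderiv_coord; case: eqP => [->|_]; ring.
  under eq_bigr => i _ do rewrite E.
  rewrite big_split /= -big_mkcond big_pred1_eq -mulr_sumr -natr1.
  by ring.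
apply: (ideal_sum _ (mpow_ideal coord _)) => j _.
apply: mpow_mulgen; exact: IH (Hq j).
Qed.

Variables (G : 'M[k]_n -> Prop) (algG : alg_group G).

Lemma LieP X : Lie G X <-> (forall p, vanish G p -> dd p 1%:M X = 0).
Proof.
have E p : \sum_i mxvec X 0 i * mxeval p^`M(i) 1%:M = dd p 1%:M X.
  by apply: eq_bigr => i _; rewrite mxevalE.
split=> H p Hp; first by rewrite -E; apply: H => g /Hp; rewrite mxevalE.
by rewrite E; apply: H => g /Hp; rewrite mxevalE.
Qed.

Lemma Lie_linear c X Y : Lie G X -> Lie G Y -> Lie G (c *: X + Y).
Proof.
by move=> /LieP HX /LieP HY; apply/LieP => p Ip; rewrite linearP /= HX ?HY ?mulr0 ?addr0.
Qed.

Lemma Lie0 : Lie G 0.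
Proof. by apply/LieP => p _; rewrite linear0. Qed.

Lemma dd_comp_affine (q p : R) (phi psi : 'M[k]_n -> 'M[k]_n) A B :
  (forall t : k, phi (A + t *: B) = phi A + t *: psi B) ->
  (forall C, ev C q = ev (phi C) p) -> dd q A B = dd p (phi A) (psi B).
Proof.
move=> Hphi Hq; rewrite !dd_line; congr (_^`().[0]).
apply: (poly_eq_evals k_char0 (oner_neq0 _)) => t _.
by rewrite !horner_pline Hq Hphi.
Qed.

Lemma dd_Lie_l p g X : Lie G X -> G g -> vanish G p -> dd p g (g *m X) = 0.
Proof.
move=> /LieP LX Gg Ip; have <- : dd (ltrans g p) 1%:M X = dd p g (g *m X).
  rewrite (@dd_comp_affine _ p (mulmx g) (mulmx g)) ?mulmx1 // => C.
    by rewrite mulmxDr -scalemxAr ?mulmx1.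
  by rewrite ev_ltrans.
exact/LX/vanish_ltrans.
Qed.

Lemma dd_Lie_r p g X : Lie G X -> G g -> vanish G p -> dd p g (X *m g) = 0.
Proof.
move=> /LieP LX Gg Ip; have <- : dd (rtrans g p) 1%:M X = dd p g (X *m g).
  rewrite (@dd_comp_affine _ p (mulmx^~ g) (mulmx^~ g)) ?mul1mx // => C.
    by rewrite mulmxDl -scalemxAl ?mul1mx.
  by rewrite ev_rtrans.
exact/LX/vanish_rtrans.
Qed.

(* The linear forms in [coord] vanishing on the Lie algebra are the linear parts of [I(G)]. *)
Lemma Lie_projection : exists Pi : 'M[k]_(n * n),
  (forall i, Lie G (vec_mx (row i Pi))) /\
  (forall j, exists2 p, vanish G p &
     mpow coord 2 (\sum_i (1%:M - Pi) i j *: coord i - p)).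
Proof.
pose V (z : 'rV[k]_(n * n)) := exists2 p, vanish G p & forall i, z 0 i = ev 1%:M p^`M(i).
have [I0 ID IM] := vanish_ideal G.
have [||C HC] := @prop_subspace _ _ V.
- by exists 0 => // i; rewrite mxE mderiv0 ev0.
- move=> a u v [p Ip Hp] [q Iq Hq]; exists (a *: p + q).
    by apply: ID => //; rewrite -mul_mpolyC; apply: IM.
  by move=> i; rewrite mderivD mderivZ evD evZ !mxE Hp Hq.
pose K := kermx C^T.
have LieK v : (v <= K)%MS -> Lie G (vec_mx v).
  move/sub_kermxP => vC; apply/LieP => p Ip.
  have /HC/submxP[D HD] : V (\row_i ev 1%:M p^`M(i)) by exists p => // i; rewrite mxE.
  transitivity ((v *m (\row_i ev 1%:M p^`M(i))^T) 0 0).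
    by rewrite mxE; apply: eq_bigr => i _; rewrite vec_mxK !mxE.
  by rewrite HD trmx_mul mulmxA vC mul0mx mxE.
exists (proj_mx K K^C%MS); split=> [i|j].
  by apply: LieK; rewrite -[X in row i X]mul1mx row_mul proj_mx_sub.
set Z := 1%:M - _.
have KZ : K *m Z = 0.
  rewrite /Z mulmxBr mulmx1 proj_mx_id ?subrr ?capmx_compl //.
have /HC[p Ip Hp] : ((col j Z)^T <= C)%MS.
  rewrite submxE; apply/eqP; apply: trmx_inj.
  rewrite trmx_mul trmxK trmx0.
  have /submxP[D ->] : ((cokermx C)^T <= K)%MS.
    by apply/sub_kermxP; rewrite -trmx_mul mulmx_coker trmx0.
  by rewrite -mulmxA colE [K *m _]mulmxA KZ mul0mx mulmx0.
exists p => //.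
have [q Hq def_p] : mpow coord 1 p.
  by apply: mpow_ev1; apply: Ip; apply: alg_group1.
have -> : \sum_i Z i j *: coord i - p = \sum_i coord i * ((Z i j)%:MP - q i).
  rewrite def_p -sumrB; apply: eq_bigr => i _.
  by rewrite mulrBr -mul_mpolyC [_%:MP * _]mulrC.
apply: (ideal_sum _ (mpow_ideal coord _)) => i _.
apply: mpow_mulgen; apply: mpow_ev1; rewrite evB evC.
have := Hp i; rewrite mxE [X in X = _]mxE => ->; rewrite def_p.
rewrite mderiv_sum_ord ev_sum (bigD1 i) //= big1 => [|l nl]; rewrite mderivM mderiv_coord.
  by rewrite eqxx /= mul1r addr0 evD evM evB evX evC subrr mul0r addr0 subrr.
by rewrite eq_sym (negPf nl) mul0r add0r evM evB evX evC subrr mul0r.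
Qed.

End Infinitesimal.

Section InfinitesimalVanishing.
Variables (k : fieldType) (k_char0 : [pchar k] =i pred0) (n : nat).
Local Notation R := {mpoly k[n * n]}.
Implicit Types (p q f : R) (X A B g : 'M[k]_n).
Variables (G : 'M[k]_n -> Prop) (algG : alg_group G).
Local Notation coord := (@coord k n).
(** Polynomials whose restriction to G has order at least N at the identity. *)
Definition Im N (f : R) : Prop := exists2 g, vanish G g & mpow coord N (f - g).

Lemma vanishDmpow_ideal N : ideal (Im N).
Proof.
have [I0 ID IM] := vanish_ideal G; split=> [|p q [u Iu Hu] [v Iv Hv]|a p [u Iu Hu]].
- by exists 0; rewrite ?subrr //; apply: mpow0.
- by exists (u + v); [apply: ID|rewrite opprD addrACA; apply: mpowD].
- by exists (a * u); [apply: IM|rewrite -mulrBr; apply: mpowM].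
Qed.

Lemma mpow_Im N p : mpow coord N p -> Im N p.
Proof. by move=> Hp; exists 0; rewrite ?subr0 //; case: (vanish_ideal G). Qed.

Lemma vanish_Im N p : vanish G p -> Im N p.
Proof. by move=> Hp; exists p => //; rewrite subrr; apply: mpow0. Qed.

Lemma Im_mul M N p q : Im M p -> mpow coord N q -> Im (M + N) (p * q).
Proof.
move=> [u Iu Hu] Hq; exists (q * u).
  by case: (vanish_ideal G) => _ _; apply.
rewrite [q * u]mulrC -mulrBl; exact: mpow_mul.
Qed.

(* An Euler-type argument: if [f - g] has order [N] at 1, then [N * (f - g)] is recovered *)
(* modulo order [N + 1] from its derivatives along the Lie algebra, the linear forms that *)
(* vanish on the Lie algebra being in [I(G)] up to order 2.                               *)
Lemma vanish_mod_mpow (F : R -> Prop) : (forall f, F f -> ev 1%:M f = 0) ->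
  (forall X, Lie G X -> exists X1 X2, [/\ Lie G X1, Lie G X2, X = X1 + X2 &
     forall f, F f -> exists2 f', F f' &
       forall g, G g -> dd f g (g *m X1) + dd f g (X2 *m g) = ev g f']) ->
  forall N f, F f -> Im N f.
Proof.
move=> F1 FL N f Ff; have Im_le : Im N.+1 f -> Im N f.
  by case=> g Ig Hg; exists g => //; apply: mpow_leq Hg.
apply: Im_le; elim: N f Ff => [|N IH] f Ff.
  by apply: mpow_Im; apply: mpow_ev1; apply: F1.
have [Pi [LPi ZPi]] := Lie_projection algG.
have [I0 ID IM] := vanish_ideal G.
have [g Ig Hp] := IH f Ff; set p := f - g in Hp.
have idN := vanishDmpow_ideal N.+2; have [N0 ND NM] := idN.
suff HNp : Im N.+2 ((N.+1)%:R * p).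
  have -> : f = (N.+1%:R^-1)%:MP * (N.+1%:R * p) + g.
    rewrite mulrA -(rmorph_nat (@mpolyC (n * n) k)) -mpolyCM.
    by rewrite mulVf ?natr_neq0 // mul1r subrK.
  by apply: ND; [apply: NM|apply: vanish_Im].
set e := \sum_i coord i * p^`M(i).
suff He : Im N.+2 e.
  have -> : (N.+1)%:R * p = e - (e - (N.+1)%:R * p) by rewrite subKr.
  by apply: (idealB idN) => //; apply/mpow_Im/mpow_euler.
(* The Euler field is split by the projection [Pi] onto Lie G. In the second sum a linear form of
   order 2 modulo I(G) multiplies a derivative of order N; in the first, the derivatives are along
   Lie G and the induction hypothesis gives them order N + 1 modulo I(G). *)
have -> : e = \sum_i coord i * (\sum_j Pi i j *: p^`M(j)) +
    \sum_j (\sum_i (1%:M - Pi) i j *: coord i) * p^`M(j).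
  have E i : coord i * p^`M(i) = coord i * (\sum_j Pi i j *: p^`M(j)) +
      \sum_j ((1%:M - Pi) i j *: coord i) * p^`M(j).
    transitivity (\sum_j (coord i * (Pi i j *: p^`M(j)) +
        ((1%:M - Pi) i j *: coord i) * p^`M(j))); last by rewrite big_split mulr_sumr.
    rewrite (bigD1 i) //= big1 ?addr0 => [|j nij].
      by rewrite !mxE eqxx -scalerAr -scalerAl -scalerDl addrCA subrr addr0 scale1r.
    rewrite !mxE eq_sym (negPf nij) sub0r -scalerAr scaleNr mulNr -scalerAl.
    by rewrite subrr.
  rewrite /e (eq_bigr _ (fun i _ => E i)) big_split /=; congr (_ + _).
  by rewrite exchange_big; apply: eq_bigr => j _; rewrite mulr_suml.
apply: (ND); last first.
  apply: (ideal_sum _ idN) => j _; have [q Iq Hq] := ZPi j.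
  rewrite -addn2 addnC; apply: Im_mul; last exact: mpow_mderiv.
  by exists q.
apply: (ideal_sum _ idN) => i _.
rewrite mulrC -addn1; apply: Im_mul; last by apply: mpow_ev1; rewrite evB evX evC subrr.
have [X1 [X2 [LX1 LX2 defX HX]]] := FL _ (LPi i).
have [f' Ff' Hf'] := HX f Ff.
pose M1 := gmx k n *m map_mx (@mpolyC _ _) X1.
pose M2 := map_mx (@mpolyC _ _) X2 *m gmx k n.
have evV h A : ev A (vf (M1 + M2) h) = dd h A (A *m X1) + dd h A (X2 *m A).
  by rewrite ev_vf map_mxD /M1 /M2 !map_mxM ev_gmx !ev_constmx linearD.
have vfD h h' : vf (M1 + M2) (h - h') = vf (M1 + M2) h - vf (M1 + M2) h'.
  by rewrite /vf -sumrB; apply: eq_bigr => j _; rewrite mderivB mulrBr.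
have idN1 := vanishDmpow_ideal N.+1; have [N10 N1D N1M] := idN1.
have HV : Im N.+1 (vf (M1 + M2) p).
  have -> : vf (M1 + M2) p = f' + (vf (M1 + M2) f - f' - vf (M1 + M2) g).
    by rewrite vfD; set a := vf _ f; set b := vf _ g; ring.
  apply: (N1D); first exact: IH.
  apply: vanish_Im => h Gh; rewrite !evB !evV Hf' // subrr sub0r.
  by rewrite (dd_Lie_l k_char0 algG) // (dd_Lie_r k_char0 algG) // addr0 oppr0.
have -> : \sum_j Pi i j *: p^`M(j) = vf (M1 + M2) p -
    \sum_j (mxvec (M1 + M2) 0 j - (Pi i j)%:MP) * p^`M(j).
  rewrite /vf -sumrB; apply: eq_bigr => j _.
  by rewrite mulrBl subKr mul_mpolyC.
apply: (idealB idN1) => //; apply: mpow_Im.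
apply: (ideal_sum _ (mpow_ideal coord _)) => j _; rewrite -add1n.
apply: mpow_mul; last exact: mpow_mderiv.
apply: mpow_ev1; rewrite evB evC.
have -> : ev 1%:M (mxvec (M1 + M2) 0 j) = map_mx (ev 1%:M) (mxvec (M1 + M2)) 0 j.
  by rewrite [RHS]mxE.
rewrite map_mxvec map_mxD !map_mxM ev_gmx !ev_constmx mul1mx mulmx1 -defX.
by rewrite vec_mxK mxE subrr.
Qed.

Hypothesis connG : zconnected G.

(** Elements of F vanish to infinite order at 1 modulo I(G), so by Krull's theorem f is moved into
    I(G) by a factor equal to 1 at the identity, which the identity theorem removes. The direction X
    may be split between right multiplication (X1) and left multiplication (X2), because the block
    Gauss decomposition behaves differently on the two sides. *)
Theorem infinitesimal_vanishing (F : R -> Prop) : (forall f, F f -> ev 1%:M f = 0) ->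
  (forall X, Lie G X -> exists X1 X2, [/\ Lie G X1, Lie G X2, X = X1 + X2 &
     forall f, F f -> exists2 f', F f' &
       forall g, G g -> dd f g (g *m X1) + dd f g (X2 *m g) = ev g f']) ->
  forall f, F f -> vanish G f.
Proof.
move=> F1 FL f Ff.
have [a Ha HI] := krull_intersection (noetherian_mpoly (@noetherian_field k))
  (vanish_ideal G) (fun N => vanish_mod_mpow F1 FL N Ff).
apply: (identity_theorem algG connG) HI.
suff a0 : ev 1%:M a = 0 by rewrite evB ev1 a0 subr0 oner_neq0.
case: Ha => q _ ->; rewrite ev_sum big1 // => i _.
by rewrite evM evB evX evC subrr mul0r.
Qed.

Corollary Lie_vanishing (F : R -> Prop) : (forall f, F f -> ev 1%:M f = 0) ->
  (forall X f, Lie G X -> F f -> exists2 f', F f' &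
       forall g, G g -> dd f g (g *m X) = ev g f') ->
  forall f, F f -> vanish G f.
Proof.
move=> F1 FL; apply: infinitesimal_vanishing => // X LX.
exists X, 0; split=> //; rewrite ?addr0 //; first exact: Lie0.
move=> f /(FL X f LX)[f' Ff' Hf']; exists f' => // g /Hf' <-.
by rewrite mul0mx linear0 addr0.
Qed.

End InfinitesimalVanishing.

(** * Cocharacters *)

Section Splitting.
Variables (k : fieldType) (V : lmodType k) (D : {linear V -> V}).
Implicit Types (u v : V) (a e : k).

Definition shift_by a v := D v - a *: v.

Lemma shift_by_is_linear a : linear (shift_by a).
Proof.
move=> c u v; rewrite /shift_by linearP scalerDr scalerBr !scalerA [a * c]mulrC.
by rewrite opprD addrACA.
Qed.

HB.instance Definition _ a :=
  GRing.isLinear.Build k V V _ (shift_by a) (shift_by_is_linear a).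

Lemma iter_linear (f : {linear V -> V}) M : linear (iter M f).
Proof. by elim: M => [|M IH] c u v //; rewrite !iterS IH linearP. Qed.

HB.instance Definition _ a M :=
  GRing.isLinear.Build k V V _ (iter M (shift_by a)) (iter_linear _ M).

Lemma shift_byC a e v : shift_by a (shift_by e v) = shift_by e (shift_by a v).
Proof.
rewrite /shift_by !linearB !linearZ /= !scalerN !opprK !scalerA [e * a]mulrC.
by rewrite !addrA; congr (_ + _); rewrite addrAC.
Qed.

Lemma iter_shift_byC M N a e v :
  iter M (shift_by a) (iter N (shift_by e) v) =
  iter N (shift_by e) (iter M (shift_by a) v).
Proof.
elim: M v => //= M IH v; rewrite {}IH; elim: N => //= N IHN.
by rewrite shift_byC IHN.
Qed.

Variable W : V -> Prop.
Hypotheses (W0 : W 0) (WL : forall a u v, W u -> W v -> W (a *: u + v)).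
Hypothesis WD : forall v, W v -> W (D v).

Lemma subspaceB u v : W u -> W v -> W (u - v).
Proof. by move=> Wu Wv; rewrite addrC -scaleN1r; apply: WL. Qed.

Lemma subspaceZ a u : W u -> W (a *: u).
Proof. by move=> Wu; rewrite -[_ *: _]addr0; apply: WL. Qed.

(** [(e - a) v] is the difference of [(D - a) v], which is in W, and [(D - e) v], which is in W by
    induction on M. *)
Lemma shift_by_cancel M a e v : a != e ->
  iter M (shift_by e) v = 0 -> W (shift_by a v) -> W v.
Proof.
move=> nae; elim: M v => [|M IH] v; first by move=> /= ->.
rewrite iterSr => /IH{}IH Wv.
have WD' : W (shift_by e v).
  apply: IH; rewrite shift_byC; apply: subspaceB; first exact: WD.
  exact: subspaceZ.
have -> : v = (e - a)^-1 *: (- shift_by e v + shift_by a v).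
  rewrite /shift_by opprB addrA subrK -scalerBl.
  by rewrite scalerA mulVf ?scale1r // subr_eq0 eq_sym.
by apply: subspaceZ; rewrite addrC; apply: subspaceB.
Qed.

(** A power of [D - c x] kills the summand of x and leaves a sum with fewer terms; on the other
    summands this power can be undone inside W by [shift_by_cancel]. The space V is arbitrary
    because it will be a polynomial ring. *)
Lemma split_stable (T : eqType) (S : seq T) (c : T -> k) (F : T -> V) :
  uniq S -> {in S &, injective c} ->
  (forall m, m \in S -> exists M, iter M (shift_by (c m)) (F m) = 0) ->
  W (\sum_(m <- S) F m) -> forall m, m \in S -> W (F m).
Proof.
elim: S F => //= x S IH F /andP[xS uS] cI HF.
rewrite big_cons => WF.
have [M HM] := HF x (mem_head _ _).
have WS m : m \in S -> W (F m).
  move=> mS; have xm : c x != c m.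
    apply/eqP => /cI exm; case/negP: xS.
    by rewrite exm ?mem_head ?inE ?mS ?orbT.
  have [N HN] : exists N, iter N (shift_by (c m)) (F m) = 0.
    by apply: HF; rewrite inE mS orbT.
  suff : W (iter M (shift_by (c x)) (F m)).
    elim: (M) => //= M' IHM' /(@shift_by_cancel N _ (c m)) H.
    by apply/IHM'/H => //; rewrite iter_shift_byC HN linear0.
  apply: (IH (fun m => iter M (shift_by (c x)) (F m))) mS => //.
  - by move=> m1 m2 m1S m2S; apply: cI; rewrite inE ?m1S ?m2S orbT.
  - move=> m1 m1S; have [|N1 HN1] := HF m1; first by rewrite inE m1S orbT.
    by exists N1; rewrite iter_shift_byC HN1 linear0.
  have -> : \sum_(m <- S) iter M (shift_by (c x)) (F m) =
      iter M (shift_by (c x)) (F x + \sum_(m <- S) F m).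
    by rewrite linearD /= HM add0r linear_sum.
  elim: (M) => //= M' IHM'; apply: subspaceB; first exact: WD.
  exact: subspaceZ.
move=> m; rewrite inE => /predU1P[->|/WS //].
have -> : F x = F x + \sum_(j <- S) F j - \sum_(j <- S) F j by rewrite addrK.
apply: subspaceB => //.
rewrite big_seq; elim/big_ind: _ => // u v Wu Wv.
by rewrite -[u]scale1r; apply: WL.
Qed.

End Splitting.

(** The left invariant derivation attached to X, given by the field A |-> A X. *)
HB.lock Definition Dr (k : fieldType) (n : nat) (X : 'M[k]_n)
  (p : {mpoly k[n * n]}) : {mpoly k[n * n]} :=
  vf (gmx k n *m map_mx (@mpolyC (n * n) k) X) p.

Section RightFields.
Variables (k : fieldType) (n : nat).
Local Notation R := {mpoly k[n * n]}.
Implicit Types (p q f : R) (X A B C : 'M[k]_n).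

Local Notation cmx C := (map_mx (@mpolyC (n * n) k) C).

Lemma Dr_is_linear X : linear (Dr X).
Proof.
move=> c p q; rewrite Dr.unlock /vf scaler_sumr -big_split /=; apply: eq_bigr => i _.
by rewrite mderivD mderivZ mulrDr scalerAr.
Qed.

HB.instance Definition _ X := GRing.isLinear.Build k R R _ (@Dr k n X) (Dr_is_linear X).

Lemma ev_Dr X p A : ev A (Dr X p) = dd p A (A *m X).
Proof. by rewrite Dr.unlock ev_vf map_mxM ev_gmx ev_constmx. Qed.

Lemma DrM X p q : Dr X (p * q) = Dr X p * q + p * Dr X q.
Proof.
rewrite Dr.unlock /vf mulr_suml mulr_sumr -big_split /=; apply: eq_bigr => i _.
by rewrite mderivM mulrDr !mulrA [p * _]mulrC.
Qed.

Lemma DrC X c : Dr X c%:MP = 0.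
Proof. by rewrite Dr.unlock /vf big1 // => i _; rewrite mderivC mulr0. Qed.

Lemma DrXi X i : Dr X 'X_i = mxvec (gmx k n *m cmx X) 0 i.
Proof.
rewrite Dr.unlock /vf (bigD1 i) //= big1 => [|j ji]; rewrite mderivX mnm1E.
  have -> : (U_(i) - U_(i) = 0 :> 'X_{1..n * n})%MM.
    by apply/mnmP => j; rewrite mnmBE mnm0E subnn.
  by rewrite eqxx scale1r mpolyX0 mulr1 addr0.
by rewrite eq_sym (negPf ji) scale0r mulr0.
Qed.

(** The linear functions A |-> (A C) i j include the coordinates; [Dr X] and right translations
    carry them into one another by multiplying C on the left. *)
Definition form C i j : R := (gmx k n *m cmx C) i j.

Lemma gmxE i j : gmx k n i j = 'X_(mxvec_index i j).
Proof. by rewrite !mxE. Qed.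

Lemma formE C i j : form C i j = \sum_l C l j *: 'X_(mxvec_index i l).
Proof.
rewrite /form mxE; apply: eq_bigr => l _.
by rewrite gmxE mxE mulrC mul_mpolyC.
Qed.

Lemma form_linear c A B i j : form (c *: A + B) i j = c *: form A i j + form B i j.
Proof.
rewrite !formE scaler_sumr -big_split /=; apply: eq_bigr => l _.
by rewrite !mxE scalerDl scalerA.
Qed.

Lemma form0 i j : form 0 i j = 0.
Proof. by rewrite formE big1 // => l _; rewrite mxE scale0r. Qed.

Lemma form_sum (T : Type) (s : seq T) (F : T -> 'M[k]_n) i j :
  form (\sum_(t <- s) F t) i j = \sum_(t <- s) form (F t) i j.
Proof.
elim: s => [|t s IH]; first by rewrite !big_nil form0.
by rewrite !big_cons -[F t]scale1r form_linear IH !scale1r.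
Qed.

Lemma form1 i j : form 1%:M i j = 'X_(mxvec_index i j).
Proof. by rewrite /form map_mx1 mulmx1 gmxE. Qed.

Lemma Dr_form X C i j : Dr X (form C i j) = form (X *m C) i j.
Proof.
rewrite formE raddf_sum /= /form map_mxM mulmxA mxE; apply: eq_bigr => l _.
by rewrite linearZ /= DrXi mxvecE [map_mx _ C l j]mxE [RHS]mulrC mul_mpolyC.
Qed.

Lemma psub_is_zmod_morphism (M : 'M[R]_n) : zmod_morphism (psub M).
Proof. by move=> p q; rewrite unlock rmorphB. Qed.

Lemma psub_is_monoid_morphism (M : 'M[R]_n) : monoid_morphism (psub M).
Proof. by rewrite unlock; split=> [|p q]; rewrite ?rmorph1 ?rmorphM. Qed.

HB.instance Definition _ M :=
  GRing.isZmodMorphism.Build _ _ (@psub k n M) (psub_is_zmod_morphism M).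
HB.instance Definition _ M :=
  GRing.isMonoidMorphism.Build _ _ (@psub k n M) (psub_is_monoid_morphism M).

Lemma psubC M c : psub M c%:MP = c%:MP :> R.
Proof. by rewrite unlock comp_mpolyC. Qed.

Lemma psubX (M : 'M[R]_n) i : psub M 'X_i = mxvec M 0 i.
Proof. by rewrite unlock comp_mpolyXU -tnth_nth tnth_mktuple. Qed.

Lemma rtrans_is_linear B : linear (@rtrans k n B).
Proof.
by move=> c p q; rewrite !rtrans.unlock rmorphD /= -mul_mpolyC rmorphM /= psubC mul_mpolyC.
Qed.

HB.instance Definition _ B :=
  GRing.isLinear.Build k R R _ (@rtrans k n B) (rtrans_is_linear B).

Lemma rtransM B p q : rtrans B (p * q) = rtrans B p * rtrans B q.
Proof. by rewrite rtrans.unlock rmorphM. Qed.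

Lemma rtransC B c : rtrans B c%:MP = c%:MP :> R.
Proof. by rewrite rtrans.unlock psubC. Qed.

Lemma rtrans_form B C i j : rtrans B (form C i j) = form (B *m C) i j.
Proof.
rewrite formE raddf_sum /= /form map_mxM mulmxA mxE; apply: eq_bigr => l _.
by rewrite linearZ /= rtrans.unlock psubX mxvecE [map_mx _ C l j]mxE [RHS]mulrC mul_mpolyC.
Qed.

End RightFields.

(** * Weights of a matrix on polynomial functions *)

Section Weights.
Variables (k : fieldType) (k_char0 : [pchar k] =i pred0) (n s r : nat).
Local Notation R := {mpoly k[n * n]}.
Local Notation wt := {ffun 'I_r -> int}.
Variables (E : 'I_s -> 'M[k]_n) (h : 'I_s -> wt) (b : 'I_r -> k) (X : 'M[k]_n).

(** Eigenvalues of X are written with integer coordinates m in elements b of k that are independent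
    over the integers. *)
Definition wt_val (m : wt) : k := \sum_l (m l)%:~R * b l.

Hypotheses (sumE : \sum_a E a = 1%:M)
  (orthE : forall a c, E a *m E c = if a == c then E a else 0)
  (b_free : forall m, wt_val m = 0 -> m = 0)
  (nilE : forall a, exists N, (X - (wt_val (h a))%:M) ^+ N *m E a = 0).

(** The part of the semisimple matrix [\sum_a wt_val (h a) *: E a] along the l-th basis element; it
    has integer eigenvalues and is tangent at 1 to the multiplicative curve [lam l]. *)
Definition Lam l : 'M[k]_n := \sum_a (h a l)%:~R *: E a.

Definition lam l (x : k) : 'M[k]_n := \sum_a x ^ h a l *: E a.

Lemma wt_val_is_zmod_morphism : zmod_morphism wt_val.
Proof.
move=> m m'; rewrite /wt_val -sumrB; apply: eq_bigr => l _.
by rewrite !ffunE rmorphB mulrBl.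
Qed.

HB.instance Definition _ :=
  GRing.isZmodMorphism.Build wt k wt_val wt_val_is_zmod_morphism.

Lemma wt_val_inj : injective wt_val.
Proof.
move=> m m' e; apply/eqP; rewrite -subr_eq0; apply/eqP/b_free.
by rewrite raddfB /= e subrr.
Qed.

(** One integer vector m governs X up to nilpotents, each [Lam l] and each [lam l]. Once the
    equations of G are split for X, they are therefore split for the other two families. *)
Definition weighted (m : wt) (p : R) : Prop :=
  [/\ exists N, iter N (shift_by (Dr X) (wt_val m)) p = 0,
      forall l, Dr (Lam l) p = (m l)%:~R *: p
    & forall l x, x != 0 -> rtrans (lam l x) p = x ^ m l *: p].

Lemma weighted0 m : weighted m 0.
Proof. by split=> [|l|l x _]; [exists 0%N|rewrite linear0 scaler0|rewrite linear0 scaler0]. Qed.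

Lemma weightedD m p q : weighted m p -> weighted m q -> weighted m (p + q).
Proof.
move=> [[N HN] Hp Hp'] [[N' HN'] Hq Hq']; split=> [|l|l x nx].
- exists (N + N')%N; rewrite linearD /= [X in _ + X]iterD HN' linear0 addr0.
  by rewrite addnC iterD HN linear0.
- by rewrite linearD /= Hp Hq scalerDr.
- by rewrite linearD /= Hp' ?Hq' ?scalerDr.
Qed.

Lemma weighted_iterM N N' m m' (p q : R) :
  iter N (shift_by (Dr X) (wt_val m)) p = 0 ->
  iter N' (shift_by (Dr X) (wt_val m')) q = 0 ->
  iter (N + N') (shift_by (Dr X) (wt_val (m + m'))) (p * q) = 0.
Proof.
have [K] := ubnP (N + N'); elim: K => // K IH in N N' p q *.
case: N => [|N]; first by rewrite /= => _ -> _; rewrite mul0r linear0.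
case: N' => [|N']; first by move=> _ _ /= ->; rewrite mulr0 !linear0.
move=> lt HN HN'; rewrite addSn iterSr.
have -> : shift_by (Dr X) (wt_val (m + m')) (p * q) =
    shift_by (Dr X) (wt_val m) p * q + p * shift_by (Dr X) (wt_val m') q.
  rewrite /shift_by raddfD /= DrM scalerDl !mulrBl !mulrBr opprD addrACA.
  by rewrite -!scalerAl -!scalerAr.
rewrite linearD /= [X in X + _]IH ?add0r; last 3 first.
- by move: lt; rewrite addSn ltnS.
- by rewrite -iterSr.
- by [].
rewrite addnS -addSn IH //; first by move: lt; rewrite addnS ltnS.
by rewrite -iterSr.
Qed.

Lemma weightedM m m' p q : weighted m p -> weighted m' q -> weighted (m + m') (p * q).
Proof.
move=> [[N HN] Hp Hp'] [[N' HN'] Hq Hq']; split=> [|l|l x nx].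
- by exists (N + N')%N; apply: weighted_iterM.
- by rewrite DrM Hp Hq -scalerAl -scalerAr -scalerDl ffunE rmorphD.
- by rewrite rtransM Hp' // Hq' // -scalerAl -scalerAr scalerA ffunE expfzDr.
Qed.

Lemma weightedC c : weighted 0 c%:MP.
Proof.
split=> [|l|l x nx].
- exists 1%N; change (Dr X c%:MP - wt_val 0 *: c%:MP = 0 :> R).
  by rewrite DrC raddf0 scale0r subrr.
- by rewrite DrC ffunE scale0r.
- by rewrite rtransC ffunE expr0z scale1r.
Qed.

Lemma Lam_mul l a : Lam l *m E a = (h a l)%:~R *: E a.
Proof.
rewrite mulmx_suml (bigD1 a) //= big1 ?addr0 => [|c nca].
  by rewrite -scalemxAl orthE eqxx.
by rewrite -scalemxAl orthE (negPf nca) scaler0.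
Qed.

Lemma lam_mul l x a : lam l x *m E a = x ^ h a l *: E a.
Proof.
rewrite mulmx_suml (bigD1 a) //= big1 ?addr0 => [|c nca].
  by rewrite -scalemxAl orthE eqxx.
by rewrite -scalemxAl orthE (negPf nca) scaler0.
Qed.

Lemma weighted_form a i j : weighted (h a) (form (E a) i j).
Proof.
split=> [|l|l x nx].
- have [N HN] := nilE a; exists N; rewrite -[RHS](form0 k i j) -HN.
  elim: N {HN} => [|N IH]; first by rewrite expr0 mul1mx.
  rewrite exprS -[_ * _ *m _]mulmxA iterS IH /shift_by /= Dr_form.
  by rewrite mulmxBl mul_scalar_mx -scaleNr addrC -form_linear addrC scaleNr.
- by rewrite Dr_form Lam_mul -[_ *: E a]addr0 form_linear form0 addr0.
- by rewrite rtrans_form lam_mul -[_ *: E a]addr0 form_linear form0 addr0.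
Qed.

Lemma weighted_decomp (p : R) : exists (S : seq wt) (F : wt -> R),
  [/\ uniq S, forall m, weighted m (F m) & p = \sum_(m <- S) F m].
Proof.
suff [t Ht ->] : exists2 t : seq (wt * R), forall x, x \in t -> weighted x.1 x.2
    & p = \sum_(x <- t) x.2.
  exists (undup (map fst t)), (fun m => \sum_(x <- t | x.1 == m) x.2).
  split; first exact: undup_uniq.
    move=> m; rewrite big_seq_cond; apply: big_ind; first exact: weighted0.
      by move=> u v; apply: weightedD.
    by move=> x /andP[/Ht + /eqP <-].
  rewrite (exchange_big_dep xpredT) //= big_seq [RHS]big_seq; apply: eq_bigr => x xt.
  rewrite -big_filter (perm_big [:: x.1]) ?big_seq1 //.
  apply: uniq_perm; rewrite ?filter_uniq ?undup_uniq // => m.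
  rewrite mem_filter mem_undup inE eq_sym andb_idr // => /eqP->.
  exact: map_f.
elim/mpoly_closed_ind: p => [c|i|p q [t Ht ->] [u Hu ->]|p q [t Ht ->] [u Hu ->]].
- exists [:: (0, c%:MP)]; last by rewrite big_seq1.
  by move=> x; rewrite inE => /eqP->; apply: weightedC.
- case/mxvec_indexP: i => i j.
  exists [seq (h a, form (E a) i j) | a <- enum 'I_s].
    by move=> x /mapP[a _ ->]; apply: weighted_form.
  by rewrite big_map big_enum -form1 -sumE form_sum.
- exists (t ++ u) => [x|]; last by rewrite big_cat.
  by rewrite mem_cat => /orP[/Ht|/Hu].
- exists [seq (x.1 + y.1, x.2 * y.2) | x <- t, y <- u].
    by move=> x /allpairsP[[y z] [/= /Ht Hy /Hu Hz ->]]; apply: weightedM.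
  by rewrite big_allpairs_dep mulr_suml; apply: eq_bigr => x _; rewrite mulr_sumr.
Qed.

Variables (G : 'M[k]_n -> Prop) (algG : alg_group G).

Lemma vanish_linear a p q : vanish G p -> vanish G q -> vanish G (a *: p + q).
Proof. by move=> Hp Hq g Gg; rewrite evD evZ Hp // Hq // mulr0 addr0. Qed.

Lemma vanish_Dr Y p : Lie G Y -> vanish G p -> vanish G (Dr Y p).
Proof. by move=> LY Ip g Gg; rewrite ev_Dr (dd_Lie_l k_char0 algG). Qed.

(** I(G) is stable under [Dr X], and distinct m give distinct eigenvalues [wt_val m], so I(G)
    contains the weight components of its elements. *)
Lemma weighted_decomp_vanish p : Lie G X -> vanish G p ->
  exists (S : seq wt) (F : wt -> R),
  [/\ forall m, weighted m (F m), forall m, m \in S -> vanish G (F m)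
    & p = \sum_(m <- S) F m].
Proof.
move=> LX Ip; have [S [F [uS HF def_p]]] := weighted_decomp p.
exists S, F; split=> //.
apply: (@split_stable _ _ (Dr X) (vanish G) _ vanish_linear _ _ S wt_val) => //.
- by case: (vanish_ideal G).
- by move=> q; apply: vanish_Dr.
- by move=> m m' _ _; apply: wt_val_inj.
- by move=> m _; case: (HF m).
- by rewrite -def_p.
Qed.

Lemma weighted_dd m p l : weighted m p -> dd p 1%:M (Lam l) = (m l)%:~R * ev 1%:M p.
Proof. by case=> _ H _; rewrite -[Lam l]mul1mx -ev_Dr H evZ. Qed.

(* The algebraic hull of [X] contains the tori generated by its rational weights. *)
Lemma Lie_Lam l : Lie G X -> Lie G (Lam l).
Proof.
move=> LX; apply/LieP => p /(weighted_decomp_vanish LX)[S [F [HF IF ->]]].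
rewrite big_seq; elim/big_ind: _ => [|u v Hu Hv|m /IF IFm].
- by rewrite -mpolyC0 ddC.
- by rewrite ddD Hu Hv addr0.
- by rewrite (weighted_dd _ (HF m)) IFm ?mulr0 //; apply: alg_group1.
Qed.

Lemma lamM l x y : x != 0 -> y != 0 -> lam l x *m lam l y = lam l (x * y).
Proof.
move=> nx ny; rewrite [lam l y]/lam mulmx_sumr; apply: eq_bigr => a _.
by rewrite -scalemxAr lam_mul scalerA mulrC expfzMl.
Qed.

Lemma lam1 l : lam l 1 = 1%:M.
Proof. by rewrite -sumE; apply: eq_bigr => a _; rewrite exp1rz scale1r. Qed.

Lemma lam_unit l x : x != 0 -> lam l x \in unitmx.
Proof.
move=> nx; have : lam l x *m lam l x^-1 = 1%:M by rewrite lamM ?invr_neq0 // divff ?lam1.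
by case/mulmx1_unit.
Qed.

Lemma lam_in l x : Lie G X -> x != 0 -> G (lam l x).
Proof.
move=> LX nx; apply: vanish_closed => //; first exact: lam_unit.
move=> p /(weighted_decomp_vanish LX)[S [F [HF IF ->]]].
rewrite ev_sum big_seq big1 // => m /IF IFm.
case: (HF m) => _ _ /(_ l x nx) E1.
by rewrite -[lam l x]mul1mx -ev_rtrans E1 evZ IFm ?mulr0 //; apply: alg_group1.
Qed.

End Weights.

(** * Spectral idempotents and rational coordinates of eigenvalues *)

Section SpectralPolynomials.
Variable (k : fieldType).

(** The Chinese remainder theorem in polynomial form, by a Bezout relation between one factor and
    the product of the others: modulo the product, the [g c] are the idempotents of the factors. The
    case [cs = [::]] is separate because an empty sum is not 1. *)
Lemma partition_of_unity (N : nat) (cs : seq k) : uniq cs ->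
  exists g : k -> {poly k},
    let F := \prod_(c <- cs) ('X - c%:P) ^+ N in
    [/\ \sum_(c <- cs) g c = 1,
        forall c, c \in cs -> F %| ('X - c%:P) ^+ N * g c
      & forall c d, c \in cs -> d \in cs -> c != d -> F %| g c * g d] \/ cs = [::].
Proof.
elim: cs => [_|c cs IH /= /andP[ccs ucs]]; first by exists (fun=> 0); right.
case: (cs =P [::]) => [->|ncs].
  exists (fun=> 1); left; rewrite !big_seq1; split=> // [d|d e].
    by rewrite inE => /eqP->; rewrite mulr1.
  by rewrite !inE => /eqP-> /eqP->; rewrite eqxx.
have [g [[Hsum HF Hprod]|//]] := IH ucs.
set F := \prod_(d <- cs) _ in HF Hprod.
have cop : coprimep (('X - c%:P) ^+ N) F.
  rewrite /F big_seq; elim/big_ind: _ => [|u v Hu Hv|d dcs].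
  - by rewrite coprimep1.
  - by rewrite coprimepMr Hu Hv.
  - apply/coprimep_expl/coprimep_expr; rewrite coprimep_XsubC root_XsubC.
    by apply: contra ccs => /eqP<-.
have {cop} [u [v Euv]] : exists u v, u * ('X - c%:P) ^+ N + v * F = 1.
  by have /Bezout_eq1_coprimepP[[u v] /= E] := cop; exists u, v.
set fc := ('X - c%:P) ^+ N in Euv *.
exists (fun x => if x == c then v * F else u * fc * g x); left.
rewrite !big_cons eqxx -/F -/fc; split.
- rewrite big_seq (eq_bigr (fun x => u * fc * g x)) => [|x xcs]; last first.
    by case: eqP => // xc; rewrite -xc xcs in ccs.
  by rewrite -big_seq -mulr_sumr Hsum mulr1 addrC.
- move=> d; rewrite inE; case: (d =P c) => [-> _|_ /= dcs].
    by rewrite -/fc mulrCA dvdp_mull // mulrC.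
  rewrite [X in _ %| X](_ : _ = u * (fc * (('X - d%:P) ^+ N * g d))); last by ring.
  by rewrite dvdp_mull // dvdp_mul // HF.
- have mixed x : x \in cs -> fc * F %| v * F * (u * fc * g x).
    move=> _; rewrite [X in _ %| X](_ : _ = v * u * g x * (fc * F)); last by ring.
    exact: dvdp_mull.
  move=> x y; rewrite !inE.
  case: (x =P c) => [->|nxc] /=; case: (y =P c) => [->|nyc] /= xcs ycs nxy.
  + by rewrite eqxx in nxy.
  + exact: mixed.
  + by rewrite [X in _ %| X]mulrC mixed.
  rewrite [X in _ %| X](_ : _ = u * u * fc * (fc * (g x * g y))); last by ring.
  by rewrite dvdp_mull // dvdp_mul // Hprod.
Qed.

End SpectralPolynomials.

Definition complete_idem (k : fieldType) (n s : nat) (E : 'I_s -> 'M[k]_n) : Prop :=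
  \sum_a E a = 1%:M /\ forall a c, E a *m E c = if a == c then E a else 0.

Lemma spectral_idem (k : closedFieldType) (n : nat) (X : 'M[k]_n) :
  exists (s : nat) (E : 'I_s -> 'M[k]_n) (e : 'I_s -> k),
  [/\ complete_idem E, forall Y, Y *m X = X *m Y -> forall a, E a *m Y = Y *m E a
    & exists N, forall a, (X - (e a)%:M) ^+ N *m E a = 0].
Proof.
case: n X => [|n] X.
  exists 1%N, (fun=> 1%:M), (fun=> 0); split; last by exists 0%N => a; apply: flatmx0.
    split=> [|a c]; first by rewrite big_ord1.
    by rewrite [LHS]flatmx0 [RHS]flatmx0.
  by move=> Y _ a; rewrite [LHS]flatmx0 [RHS]flatmx0.
have [rs def_p] := closed_field_poly_normal (char_poly X).
rewrite (monicP (char_poly_monic X)) scale1r in def_p.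
pose cs := undup rs; pose N := size rs.
have ucs : uniq cs by apply: undup_uniq.
(* [N] is the number of roots counted with multiplicity, so it bounds every multiplicity and the
   characteristic polynomial divides this product. *)
have pX : horner_mx X (\prod_(c <- cs) ('X - c%:P) ^+ N) = 0.
  have : char_poly X %| \prod_(c <- cs) ('X - c%:P) ^+ N.
    rewrite def_p prodrXl -/cs -/N.
    apply: (@dvdp_trans _ (\prod_(c <- rs) \prod_(d <- cs) ('X - d%:P))); last first.
      by rewrite big_const_seq count_predT -/N iter_mulr_1.
    have : {subset rs <= cs} by move=> c; rewrite mem_undup.
    elim: (rs) => [|c l IH] sub; first by rewrite !big_nil.
    rewrite !big_cons dvdp_mul ?IH // => [|d dl]; last by apply: sub; rewrite inE dl orbT.
    by rewrite (big_rem c) /= ?dvdp_mulr // sub ?mem_head.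
  case/dvdpP => q ->; rewrite rmorphM /= (Cayley_Hamilton X) mulr0 //.
have dvd0 p : \prod_(c <- cs) ('X - c%:P) ^+ N %| p -> horner_mx X p = 0.
  by case/dvdpP => q ->; rewrite rmorphM /= pX mulr0.
have [g [[Hsum HF Hprod]|cs0]] := partition_of_unity N ucs; last first.
  by move: pX => /eqP; rewrite cs0 big_nil rmorph1 oner_eq0.
exists (size cs), (fun a => horner_mx X (g cs`_a)), (fun a => cs`_a).
have csI (a : 'I_(size cs)) : cs`_a \in cs by rewrite mem_nth.
split.
- split=> [|a c].
    rewrite -[RHS]/(1 : 'M_n.+1) -(rmorph1 (horner_mx X)) -Hsum.
    by rewrite (big_nth 0) big_mkord rmorph_sum.
  case: eqP => [->|/eqP nac].
    apply/eqP; rewrite -subr_eq0 -[_ *m _]/(_ * _) -{3}[g _]mulr1 -rmorphM -rmorphB.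
    rewrite -mulrBr -Hsum (bigD1_seq cs`_c) //= opprD addNKr mulrN rmorphN oppr_eq0.
    rewrite mulr_sumr rmorph_sum big_seq_cond big1 // => d /andP[dcs nd].
    by apply/dvd0/Hprod => //; rewrite eq_sym.
  transitivity (horner_mx X (g cs`_a * g cs`_c)); first by rewrite rmorphM.
  by rewrite dvd0 // Hprod // nth_uniq.
- by move=> Y XY a; rewrite -comm_mx_horner //; apply: comm_mx_sym.
- exists N => a; rewrite -[RHS](dvd0 _ (HF _ (csI a))) rmorphM rmorphXn rmorphB /=.
  by rewrite horner_mx_X horner_mx_C.
Qed.

Lemma intr_char0_eq0 (k : fieldType) (k_char0 : [pchar k] =i pred0) (z : int) :
  z%:~R = 0 :> k -> z = 0.
Proof.
move=> z0; apply/eqP/negPn/negP => nz.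
have : (`|z|%N)%:R = 0 :> k.
  have := z0; case: (intP z) => [//|m|m]; rewrite ?abszN absz_nat //.
  by rewrite mulrNz => /eqP; rewrite oppr_eq0 => /eqP.
move/eqP; move/pcharf0P: k_char0 => ->.
by rewrite absz_eq0 (negPf nz).
Qed.

(** The numbers are added one at a time: one with a nonzero integer multiple in the span of b is
    absorbed by dividing b by that integer, any other joins the basis. *)
Lemma free_int_basis (k : fieldType) (k_char0 : [pchar k] =i pred0)
    (s : nat) (e : 'I_s -> k) :
  exists (r : nat) (h : 'I_s -> {ffun 'I_r -> int}) (b : 'I_r -> k),
    (forall m : {ffun 'I_r -> int}, wt_val b m = 0 -> m = 0) /\
    forall a, e a = wt_val b (h a).
Proof.
elim: s e => [|s IH] e.
  by exists 0%N, (fun=> [ffun=> 0]), (fun=> 0); split=> [m _|[]//]; apply/ffunP => - [].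
have [r [h [b [b_free eh]]]] := IH (fun a => e (lift ord0 a)).
have intr0 := intr_char0_eq0 k_char0.
have [[N [m [nN Em]]]|no] :=
  classic (exists (N : int) (m : {ffun 'I_r -> int}),
    N != 0 /\ N%:~R * e ord0 = wt_val b m).
  have nN' : N%:~R != 0 :> k by apply: contra nN => /eqP/intr0->.
  exists r, (fun a => if unlift ord0 a is Some j then [ffun l => N * h j l] else m),
    (fun l => b l / N%:~R).
  have wtE m' : wt_val (fun l => b l / N%:~R) m' = wt_val b m' / N%:~R.
    by rewrite /wt_val mulr_suml; apply: eq_bigr => l _; rewrite mulrA.
  split=> [m' /eqP|a]; rewrite wtE.
    by rewrite mulf_eq0 invr_eq0 (negPf nN') orbF => /eqP/b_free.
  case: unliftP => [j|] ->; last by rewrite -Em mulrAC divff ?mul1r.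
  rewrite eh -[LHS](mulfK nN'); congr (_ / _).
  by rewrite /wt_val mulr_suml; apply: eq_bigr => l _; rewrite ffunE rmorphM /= mulrC mulrA.
exists r.+1, (fun a => if unlift ord0 a is Some j
    then [ffun l => if unlift ord0 l is Some l' then h j l' else 0]
    else [ffun l => (l == ord0)%:Z]),
  (fun l => if unlift ord0 l is Some l' then b l' else e ord0).
have wtE m' : wt_val (fun l => if unlift ord0 l is Some l' then b l' else e ord0) m' =
    (m' ord0)%:~R * e ord0 + wt_val b [ffun l => m' (lift ord0 l)].
  rewrite /wt_val big_ord_recl unlift_none; congr (_ + _).
  by apply: eq_bigr => l _; rewrite liftK ffunE.
split=> [m'|a]; rewrite wtE.
  move=> E0; have m0 : m' ord0 = 0.
    apply/eqP/negPn/negP => n0; apply: no.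
    exists (m' ord0), (- [ffun l => m' (lift ord0 l)]); split=> //.
    apply/eqP; rewrite -subr_eq0 /wt_val -sumrN; apply/eqP.
    rewrite -[RHS]E0; congr (_ + _); apply: eq_bigr => l _.
    by rewrite !ffunE mulrNz mulNr opprK.
  move: E0; rewrite m0 mul0r add0r => /b_free /ffunP H.
  apply/ffunP => l; rewrite ffunE; case: (unliftP ord0 l) => [j|] -> //.
  by have := H j; rewrite !ffunE.
case: unliftP => [j|] ->.
  rewrite ffunE unlift_none mul0r add0r eh; congr (wt_val b _).
  by apply/ffunP => l; rewrite !ffunE liftK.
rewrite ffunE eqxx mul1r [wt_val _ _]big1 ?addr0 // => l _.
by rewrite !ffunE mul0r.
Qed.

(** In characteristic zero 2 has infinite order in the multiplicative group; evaluating at 2 will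
    separate integer weights. *)
Lemma exp2z_inj (k : fieldType) (k_char0 : [pchar k] =i pred0) (i j : int) :
  (2 : k) ^ i = 2 ^ j -> i = j.
Proof.
have n2 : (2 : k) != 0 by apply: (natr_neq0 k_char0 1).
have pos (m : nat) : (2 : k) ^+ m = 1 -> m = 0%N.
  rewrite -natrX -[1]/(1%:R) => /(natr_char0_inj k_char0) /eqP.
  by rewrite -[X in _ == X](expn0 2) eqn_exp2l // => /eqP.
have z (m : int) : (2 : k) ^ m = 1 -> m = 0.
  case: (intP m) => [//|q|q]; first by rewrite -exprnP => /pos.
  by rewrite -exprnN => /eqP; rewrite invr_eq1 => /eqP/pos.
move=> e; apply/eqP; rewrite -subr_eq0; apply/eqP/z.
by rewrite expfzDr // e -expfzDr // subrr expr0z.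
Qed.

(** * Cocharacters with given exponents on a family of idempotents *)

Section Cocharacters.
Variables (k : fieldType) (k_char0 : [pchar k] =i pred0) (n : nat).
Implicit Types (s : nat) (G : 'M[k]_n -> Prop).

(** The derivative at x = 1 of [cochar E h x]. *)
Definition cogen s (E : 'I_s -> 'M[k]_n) (h : 'I_s -> int) : 'M[k]_n :=
  \sum_a (h a)%:~R *: E a.

Definition cochar s (E : 'I_s -> 'M[k]_n) (h : 'I_s -> int) (x : k) : 'M[k]_n :=
  \sum_a x ^ h a *: E a.

Section OneCochar.
Variables (s : nat) (E : 'I_s -> 'M[k]_n) (h : 'I_s -> int).
Hypothesis idE : complete_idem E.

(** The weight decomposition is reused with a single coordinate and basis element 1. *)
Let h1 a : {ffun 'I_1 -> int} := [ffun=> h a].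
Let b1 : 'I_1 -> k := fun=> 1.

Let sumE : \sum_a E a = 1%:M. Proof. by case: idE. Qed.
Let orthE a c : E a *m E c = if a == c then E a else 0.
Proof. by case: idE => _ ->. Qed.

Let wt1 m : wt_val b1 m = (m 0)%:~R.
Proof. by rewrite /wt_val big_ord1 mulr1. Qed.

Let b1_free m : wt_val b1 m = 0 -> m = 0.
Proof.
rewrite wt1 => /(intr_char0_eq0 k_char0) m0.
by apply/ffunP => i; rewrite ord1 m0 ffunE.
Qed.

Lemma cogen_mul a : cogen E h *m E a = (h a)%:~R *: E a.
Proof.
rewrite mulmx_suml (bigD1 a) //= big1 ?addr0 => [|c nca].
  by rewrite -scalemxAl orthE eqxx.
by rewrite -scalemxAl orthE (negPf nca) scaler0.
Qed.

Let nil1 a : exists N, (cogen E h - (wt_val b1 (h1 a))%:M) ^+ N *m E a = 0.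
Proof.
by exists 1%N; rewrite expr1 mulmxBl cogen_mul mul_scalar_mx wt1 ffunE subrr.
Qed.

Let LamE : Lam E h1 0 = cogen E h.
Proof. by apply: eq_bigr => a _; rewrite ffunE. Qed.

Let lamE x : lam E h1 0 x = cochar E h x.
Proof. by apply: eq_bigr => a _; rewrite ffunE. Qed.

Lemma cochar_unit x : x != 0 -> cochar E h x \in unitmx.
Proof. by rewrite -lamE; apply: lam_unit. Qed.

Lemma cocharM x y : x != 0 -> y != 0 -> cochar E h x *m cochar E h y = cochar E h (x * y).
Proof. by rewrite -!lamE; apply: lamM. Qed.

Lemma cochar1 : cochar E h 1 = 1%:M.
Proof. by rewrite -lamE; apply: lam1. Qed.

Lemma invmx_cochar x : x != 0 -> invmx (cochar E h x) = cochar E h x^-1.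
Proof.
move=> nx; rewrite -[LHS]mulmx1 -cochar1 -(divff nx) -cocharM ?invr_eq0 //.
by rewrite mulKmx // cochar_unit.
Qed.

Variables (G : 'M[k]_n -> Prop) (algG : alg_group G).

Lemma cochar_in x : Lie G (cogen E h) -> x != 0 -> G (cochar E h x).
Proof.
move=> LG nx; rewrite -lamE.
exact: (lam_in k_char0 sumE orthE b1_free nil1 algG 0 LG nx).
Qed.

(** Right translation by the point at parameter 2 preserves I(G) and acts on the weight components
    with distinct eigenvalues [2 ^ m], so I(G) splits; a component of weight m has derivative m
    times its value at 1, which is 0. *)
Lemma cochar_Lie : (forall x, x != 0 -> G (cochar E h x)) -> Lie G (cogen E h).
Proof.
move=> HG; have n2 : (2 : k) != 0 by apply: (natr_neq0 k_char0 1).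
apply/LieP => p Ip; have [S [F [uS HF def_p]]] := weighted_decomp sumE orthE nil1 p.
have IF m : m \in S -> vanish G (F m).
  apply: (@split_stable _ _ (@rtrans k n (cochar E h 2)) (vanish G) _
    (@vanish_linear k n G) _ _ S (fun m => 2 ^ m 0) F uS).
  - by case: (vanish_ideal G).
  - by move=> q; apply: vanish_rtrans => //; apply: HG.
  - move=> m1 m2 _ _ /(exp2z_inj k_char0) e12; apply/ffunP => i.
    by rewrite ord1.
  - move=> m1 _; exists 1%N; case: (HF m1) => _ _ /(_ 0 2 n2); rewrite lamE => e2.
    by change (rtrans (cochar E h 2) (F m1) - 2 ^ m1 0 *: F m1 = 0); rewrite e2 subrr.
  - by rewrite -def_p.
rewrite def_p big_seq; elim/big_ind: _ => [|u v Hu Hv|m /IF IFm].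
- by rewrite -mpolyC0 ddC.
- by rewrite ddD Hu Hv addr0.
- by rewrite -LamE (weighted_dd _ (HF m)) IFm ?mulr0 //; apply: alg_group1.
Qed.

(** Along the curve each weight component is a constant times a power of x; clearing the negative
    powers gives a polynomial, the form in which [curve_cover] uses curves. *)
Lemma cochar_Laurent (g : 'M[k]_n) (p : {mpoly k[n * n]}) :
  exists (u : {poly k}) (N : nat),
    forall x, x != 0 -> x ^+ N * ev (g *m cochar E h x) p = u.[x].
Proof.
have [S [F [uS HF ->]]] := weighted_decomp sumE orthE nil1 p.
elim: S uS => [_|m S IH /= /andP[_ uS]].
  by exists 0, 0%N => x _; rewrite big_nil ev0 mulr0 horner0.
have [u [N Hu]] := IH uS; rewrite big_cons.
have [_ _ /(_ 0) Hm] := HF m.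
have : exists (v : {poly k}) (M : nat),
    forall x, x != 0 -> x ^+ M * ev (g *m cochar E h x) (F m) = v.[x].
  have E1 x : x != 0 -> ev (g *m cochar E h x) (F m) = x ^ m 0 * ev g (F m).
    by move=> nx; rewrite -ev_rtrans -lamE Hm // evZ.
  case: (intP (m 0)) E1 => [|i|i] E1.
  - exists (ev g (F m))%:P, 0%N => x nx.
    by rewrite E1 // expr0z expr0 !mul1r hornerC.
  - exists ((ev g (F m)) *: 'X^(i.+1)), 0%N => x nx.
    by rewrite E1 // expr0 mul1r hornerZ hornerXn mulrC.
  - exists (ev g (F m))%:P, i.+1 => x nx.
    by rewrite E1 // -exprnN mulrA divff ?mul1r ?hornerC // expf_eq0.
case=> v [M Hv]; exists ('X^M * u + 'X^N * v), (M + N)%N => x nx.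
rewrite evD mulrDr hornerD !hornerM !hornerXn -Hu // -Hv // exprD addrC.
by rewrite -mulrA; congr (_ + _); rewrite mulrCA mulrA.
Qed.

End OneCochar.
End Cocharacters.

Lemma exp_sub_idem (k : fieldType) n s (E : 'I_s -> 'M[k]_n) (e : 'I_s -> k) (X : 'M[k]_n) N :
  complete_idem E -> (forall a, E a *m X = X *m E a) ->
  (forall a, (X - (e a)%:M) ^+ N *m E a = 0) ->
  (X - \sum_a e a *: E a) ^+ N = 0.
Proof.
move=> [sumE orthE] cE H; set Y := \sum_a _.
have YE a : Y *m E a = e a *: E a.
  rewrite mulmx_suml (bigD1 a) //= big1 ?addr0 => [|c nca].
    by rewrite -scalemxAl orthE eqxx.
  by rewrite -scalemxAl orthE (negPf nca) scaler0.
have EX a M : (X - Y) ^+ M *m E a = (X - (e a)%:M) ^+ M *m E a.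
  elim: M => [|M IH]; first by rewrite !expr0.
  have AE : (X - Y) *m E a = (X - (e a)%:M) *m E a.
    by rewrite !mulmxBl YE mul_scalar_mx.
  have BE : (X - (e a)%:M) *m E a = E a *m (X - (e a)%:M).
    by rewrite mulmxBl mulmxBr cE scalar_mxC.
  rewrite exprSr -[_ * _ *m _]mulmxA AE BE mulmxA IH -mulmxA -BE mulmxA.
  by rewrite exprSr.
rewrite -[LHS]mulmx1 -sumE mulmx_sumr big1 // => a _.
by rewrite EX H.
Qed.

(** An additive Jordan decomposition inside Lie G, in which the semisimple part is moreover a
    k-combination of derivatives of cocharacters, each lying in Lie G. *)
Lemma Lie_rational_parts (k : closedFieldType) (k_char0 : [pchar k] =i pred0) n
    (G : 'M[k]_n -> Prop) (algG : alg_group G) (X : 'M[k]_n) : Lie G X ->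
  exists s r (E : 'I_s -> 'M[k]_n) (h : 'I_s -> {ffun 'I_r -> int}) (b : 'I_r -> k),
  let Xs := \sum_l b l *: cogen E (fun a => h a l) in
  [/\ complete_idem E /\ (forall m, wt_val b m = 0 -> m = 0),
      forall Y, Y *m X = X *m Y -> forall a, E a *m Y = Y *m E a,
      forall l, Lie G (cogen E (fun a => h a l)),
      Xs = \sum_a wt_val b (h a) *: E a
    & exists N, (X - Xs) ^+ N = 0 /\ forall a, (X - (wt_val b (h a))%:M) ^+ N *m E a = 0].
Proof.
move=> LX; have [s [E [e [idE cE [N HN]]]]] := spectral_idem X.
have [r [h [b [b_free eh]]]] := free_int_basis k_char0 e.
have XsE : \sum_l b l *: cogen E (fun a => h a l) = \sum_a wt_val b (h a) *: E a.
  rewrite /wt_val; under [RHS]eq_bigr => a _ do rewrite scaler_suml.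
  rewrite exchange_big; apply: eq_bigr => l _; rewrite scaler_sumr.
  by apply: eq_bigr => a _; rewrite scalerA mulrC.
have HN' a : (X - (wt_val b (h a))%:M) ^+ N *m E a = 0 by rewrite -eh.
exists s, r, E, h, b; split=> //.
- case: idE => sumE orthE l; rewrite -/(Lam E h l).
  by apply: (Lie_Lam k_char0 sumE orthE b_free _ algG l LX) => a; exists N.
- exists N; split=> //; rewrite XsE; apply: exp_sub_idem => // a; exact: cE.
Qed.

(** * Zariski closures and maximal tori *)

Section ZariskiClosure.
Variables (k : fieldType) (n : nat).
Local Notation R := {mpoly k[n * n]}.
Implicit Types (A B Y Z : 'M[k]_n -> Prop) (g h : 'M[k]_n) (p : R).

Definition zclosure A g : Prop :=
  g \in unitmx /\ forall p, vanish A p -> ev g p = 0.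

Lemma zclosure_closed A : zclosed (zclosure A).
Proof.
exists (vanish A) => g; split=> -[ug Hg]; split=> // p /Hg; by rewrite mxevalE.
Qed.

Lemma sub_zclosure A g : (forall h, A h -> h \in unitmx) -> A g -> zclosure A g.
Proof. by move=> Au Ag; split=> [|p]; [apply: Au|apply]. Qed.

Lemma zclosure_min A Z : zclosed Z -> (forall g, A g -> Z g) ->
  forall g, zclosure A g -> Z g.
Proof.
case=> S HS AZ g [ug Hg]; apply/HS; split=> // p Sp; rewrite mxevalE; apply: Hg => h Ah.
by case/HS: (AZ h Ah) => _ /(_ p Sp); rewrite mxevalE.
Qed.

Lemma zclosure_connected A : (forall h, A h -> h \in unitmx) ->
  zconnected A -> zconnected (zclosure A).
Proof.
move=> Au [[g0 Ag0] conn]; split; first by exists g0; apply: sub_zclosure.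
move=> Y Z cY cZ cov [y [cly Yy]] [z [clz Zz]].
have cov' g : A g -> Y g \/ Z g by move=> Ag; apply/cov/sub_zclosure.
have [[y' [Ay' Yy']]|noY] := classic (exists g, A g /\ Y g); last first.
  exists y; split=> //; apply: (zclosure_min cZ) cly => g Ag.
  by case: (cov' g Ag) => // Yg; case: noY; exists g.
have [[z' [Az' Zz']]|noZ] := classic (exists g, A g /\ Z g); last first.
  exists z; split=> //; apply: (zclosure_min cY) clz => g Ag.
  by case: (cov' g Ag) => // Zg; case: noZ; exists g.
have [||g [Ag Yg Zg]] := conn Y Z cY cZ cov'; [by exists y'|by exists z'|].
by exists g; split=> //; apply: sub_zclosure.
Qed.

Lemma zclosure_group A : (forall h, A h -> h \in unitmx) -> A 1%:M ->
  (forall g h, A g -> A h -> A (g *m h)) -> (forall g, A g -> A (invmx g)) ->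
  alg_group (zclosure A).
Proof.
move=> Au A1 AM AV; split; first exact: zclosure_closed.
- exact: sub_zclosure.
- move=> g h [ug Hg] [uh Hh]; split; first by rewrite unitmx_mul ug.
  move=> p Ip; rewrite -ev_rtrans; apply: Hg => a Aa; rewrite ev_rtrans -ev_ltrans.
  by apply: Hh => b Ab; rewrite ev_ltrans; apply/Ip/AM.
- move=> g [ug Hg]; split; first by rewrite unitmx_inv.
  move=> p Ip; have [q [m Hq]] := ev_inv p.
  have : ev g q = 0.
    by apply: Hg => a Aa; rewrite Hq ?Au // Ip ?mulr0 //; apply: AV.
  rewrite Hq // => /eqP; rewrite mulf_eq0 expf_eq0.
  by move: ug; rewrite unitmxE unitfE => /negPf->; rewrite andbF => /eqP.
Qed.

Hypothesis k_char0 : [pchar k] =i pred0.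

(** If the curve leaves Y at x1 and Z at x0, an equation of each set gives a nonzero polynomial in
    the parameter; at a common nonroot the curve would be in neither set. *)
Lemma curve_cover (c : k -> 'M[k]_n) Y Z x0 x1 :
  (forall x, x != 0 -> c x \in unitmx) ->
  (forall p, exists (u : {poly k}) (N : nat),
     forall x, x != 0 -> x ^+ N * ev (c x) p = u.[x]) ->
  zclosed Y -> zclosed Z -> (forall x, x != 0 -> Y (c x) \/ Z (c x)) ->
  x0 != 0 -> x1 != 0 -> Y (c x0) ->
  Y (c x1) \/ (exists2 x, x != 0 & Y (c x) /\ Z (c x)).
Proof.
move=> cu cL [SY HY] [SZ HZ] cov n0 n1 Y0.
have [Y1|nY1] := classic (Y (c x1)); first by left.
right; have [Z0|nZ0] := classic (Z (c x0)); first by exists x0.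
have sep (S : R -> Prop) (W : 'M[k]_n -> Prop) (x : k) : x != 0 ->
    (forall g, W g <-> g \in unitmx /\ (forall p, S p -> mxeval p g = 0)) ->
    ~ W (c x) -> exists2 p, S p & ev (c x) p != 0.
  move=> nx HW nW; apply: NNPP => no; apply: nW; apply/HW; split; first exact: cu.
  move=> p Sp; rewrite mxevalE; apply/eqP/negPn/negP => np; apply: no.
  by exists p.
have [p SYp np] := sep _ _ _ n1 HY nY1; have [q SZq nq] := sep _ _ _ n0 HZ nZ0.
have [u [N Hu]] := cL p; have [v [M Hv]] := cL q.
have nu : u != 0.
  by apply/eqP => u0; move: (Hu _ n1); rewrite u0 horner0 => /eqP;
    rewrite mulf_eq0 expf_eq0 (negPf n1) (negPf np) andbF.
have nv : v != 0.
  by apply/eqP => v0; move: (Hv _ n0); rewrite v0 horner0 => /eqP;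
    rewrite mulf_eq0 expf_eq0 (negPf n0) (negPf nq) andbF.
have [m] := poly_nonroot k_char0 (mulf_neq0 nu nv).
have nm := natr_neq0 k_char0 m; set x := _%:R in nm *.
rewrite hornerM -Hu // -Hv // !mulf_eq0 !negb_or => /andP[/andP[_ nup] /andP[_ nvq]].
case: (cov x nm) => [/HY[_ /(_ p SYp)]|/HZ[_ /(_ q SZq)]]; rewrite mxevalE => /eqP.
  by rewrite (negPf nup).
by rewrite (negPf nvq).
Qed.

End ZariskiClosure.

Section Diagonal.
Variables (k : fieldType) (n : nat).
Implicit Types (P A B : 'M[k]_n).

Definition diag_for P A : bool := is_diag_mx (P *m A *m invmx P).

Lemma diag_forP P A :
  reflect (forall i j, i != j -> (P *m A *m invmx P) i j = 0) (diag_for P A).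
Proof.
by apply: (iffP is_diag_mxP) => H i j nij; apply: H; rewrite // val_eqE.
Qed.

Lemma diag_for_linear P c A B : diag_for P A -> diag_for P B -> diag_for P (c *: A + B).
Proof.
move=> /diag_forP dA /diag_forP dB; apply/diag_forP => i j nij.
by rewrite mulmxDr mulmxDl -scalemxAr -scalemxAl mxE dB // addr0 mxE dA ?mulr0.
Qed.

Lemma diag_for0 P : diag_for P 0.
Proof. by apply/diag_forP => i j _; rewrite mulmx0 mul0mx mxE. Qed.

Lemma diag_for_sum P (T : Type) (s : seq T) (F : T -> 'M[k]_n) :
  (forall t, diag_for P (F t)) -> diag_for P (\sum_(t <- s) F t).
Proof.
move=> H; elim: s => [|t s IH]; first by rewrite big_nil diag_for0.
by rewrite big_cons -[F t]scale1r diag_for_linear.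
Qed.

Lemma diag_forZ P c A : diag_for P A -> diag_for P (c *: A).
Proof. by move=> dA; rewrite -[_ *: A]addr0 diag_for_linear ?diag_for0. Qed.

Lemma diag_mulC A B : is_diag_mx A -> is_diag_mx B -> A *m B = B *m A.
Proof.
case/diag_mxP => a ->; case/diag_mxP => b ->; apply/matrixP => i j.
rewrite !mul_diag_mx !mxE; case: eqP => [->|_]; last by rewrite !mulr0n !mulr0.
by rewrite !mulr1n mulrC.
Qed.

Lemma diag_mul A B : is_diag_mx A -> is_diag_mx B -> is_diag_mx (A *m B).
Proof.
case/diag_mxP => a ->; case/diag_mxP => b ->; apply/is_diag_mxP => i j nij.
by rewrite mul_diag_mx !mxE -val_eqE (negPf nij) mulr0n mulr0.
Qed.

Hypothesis k_char0 : [pchar k] =i pred0.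
Variables (P : 'M[k]_n) (uP : P \in unitmx).

Lemma conjM A B : P *m (A *m B) *m invmx P =
  (P *m A *m invmx P) *m (P *m B *m invmx P).
Proof. by rewrite !mulmxA mulmxKV. Qed.

Lemma conj_inj A B : P *m A *m invmx P = P *m B *m invmx P -> A = B.
Proof.
move=> e; apply: (can_inj (mulKmx uP)).
by apply: (can_inj (mulmxK (_ : invmx P \in unitmx))) e; rewrite unitmx_inv.
Qed.

Lemma diag_forM A B : diag_for P A -> diag_for P B -> diag_for P (A *m B).
Proof. by rewrite /diag_for conjM; apply: diag_mul. Qed.

Lemma diag_for_mulC A B : diag_for P A -> diag_for P B -> A *m B = B *m A.
Proof. by move=> dA dB; apply: conj_inj; rewrite !conjM diag_mulC. Qed.

Lemma diag_forE A : diag_for P A = (conjmx P A \in is_diag_mx).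
Proof. by rewrite conjumx. Qed.

Lemma diag_for_zclosure (T : 'M[k]_n -> Prop) :
  (forall t, T t -> diag_for P t) -> forall t, zclosure T t -> diag_for P t.
Proof.
move=> dT t [_ Ht]; apply/diag_forP => i j nij.
pose M := map_mx (@mpolyC (n * n) k) P *m gmx k n *m map_mx (@mpolyC _ _) (invmx P).
have eM A : ev A (M i j) = (P *m A *m invmx P) i j.
  have -> : ev A (M i j) = map_mx (ev A) M i j by rewrite [RHS]mxE.
  by rewrite !map_mxM !ev_constmx ev_gmx.
by rewrite -eM; apply: Ht => s /dT /diag_forP ds; rewrite eM ds.
Qed.

End Diagonal.

Lemma idem_diagonalizable (k : fieldType) n (A : 'M[k]_n) : A *m A = A -> diagonalizable A.
Proof.
case: n A => [|n] A AA.
  by exists 1%:M; rewrite ?unitmx1 //; apply/is_diag_mxP => -[].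
apply/diagonalizableP; exists [:: 0; 1]; first by rewrite /= inE eq_sym oner_eq0.
apply: mxminpoly_min; rewrite big_cons big_seq1 subr0 rmorphM rmorphB /=.
by rewrite horner_mx_X horner_mx_C mulrBr mulr1 -[A * A]/(A *m A) AA subrr.
Qed.

(** * Cocharacters commuting with a maximal torus *)

Section MaximalTorus.
Variables (k : closedFieldType) (k_char0 : [pchar k] =i pred0) (n : nat).
Implicit Types (G T : 'M[k]_n -> Prop).

Lemma Lie_mono G T X : (forall t, T t -> G t) -> Lie T X -> Lie G X.
Proof. by move=> TG /LieP H; apply/LieP => p Ip; apply: H => t /TG/Ip. Qed.

(** T may be infinite, so joint diagonalization is applied to a finite family spanning the space of
    all matrices that are diagonal for P and commute with the idempotents; this space contains T. *)
Lemma codiag_idem (T : 'M[k]_n -> Prop) s (E : 'I_s -> 'M[k]_n) : complete_idem E ->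
  (exists2 P : 'M[k]_n, P \in unitmx & forall t, T t -> diag_for P t) ->
  (forall a t, T t -> E a *m t = t *m E a) ->
  exists2 P : 'M[k]_n, P \in unitmx &
    (forall t, T t -> diag_for P t) /\ (forall a, diag_for P (E a)).
Proof.
move=> [sumE orthE] [P uP dP] cE.
pose V (z : 'rV[k]_(n * n)) :=
  diag_for P (vec_mx z) /\ forall a, E a *m vec_mx z = vec_mx z *m E a.
have [||C HC] := @prop_subspace _ _ V.
- by split=> [|a]; rewrite linear0 ?diag_for0 // mulmx0 mul0mx.
- move=> c u v [du cu] [dv cv]; rewrite /V linearP /=; split; first exact: diag_for_linear.
  by move=> a; rewrite mulmxDl mulmxDr -scalemxAl -scalemxAr cu cv.
have VC i : V (row i C) by apply/HC/row_sub.
pose Bs := [seq vec_mx (row i C) | i <- enum 'I_(n * n)].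
pose Es := [seq E a | a <- enum 'I_s].
have BsP B : B \in Bs -> diag_for P B /\ forall a, E a *m B = B *m E a.
  by case/mapP => i _ ->; apply: VC.
have EsP B : B \in Es -> exists a, B = E a by case/mapP => a _ ->; exists a.
have [Q uQ /allP/= dQ] : codiagonalizable (Bs ++ Es).
  apply/codiagonalizableP; split=> [A B|A].
    rewrite !mem_cat => /orP[/BsP[dA cA]|/EsP[a ->]] /orP[/BsP[dB cB]|/EsP[c ->]].
    - exact: diag_for_mulC uP _ _ dA dB.
    - by rewrite /comm_mx cA.
    - by rewrite /comm_mx cB.
    - by rewrite /comm_mx !orthE eq_sym; case: eqP => [->|].
  rewrite mem_cat => /orP[/BsP[dA _]|/EsP[a ->]].
    by exists P => //; move: dA; rewrite diag_forE.
  by apply: idem_diagonalizable; rewrite orthE eqxx.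
exists Q => //; split=> [t Tt|a]; last first.
  rewrite diag_forE //; apply: dQ; rewrite mem_cat; apply/orP; right.
  by apply/mapP; exists a; rewrite ?mem_enum.
have /HC/submxP[D HD] : V (mxvec t) by rewrite /V mxvecK; split=> [|a]; [apply: dP|apply: cE].
rewrite -(mxvecK t) HD mulmx_sum_row linear_sum; apply: diag_for_sum => i.
rewrite linearZ; apply: diag_forZ; rewrite diag_forE //; apply: dQ.
by rewrite mem_cat; apply/orP; left; apply/mapP; exists i; rewrite ?mem_enum.
Qed.

Variables (G T : 'M[k]_n -> Prop) (algG : alg_group G) (T_max : maximal_torus G T).

Lemma max_torus_alg : alg_group T. Proof. by case: T_max => -[]. Qed.
Lemma max_torus_conn : zconnected T. Proof. by case: T_max => -[]. Qed.
Lemma max_torus_sub t : T t -> G t. Proof. by case: T_max => _ H _; apply: H. Qed.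
Lemma max_torus_diag : exists2 P : 'M[k]_n, P \in unitmx & forall t, T t -> diag_for P t.
Proof. by case: T_max => -[_ _ [P uP H]] _ _; exists P. Qed.

Let algT := max_torus_alg.
Let Tu := alg_group_unit algT.

(** T and the image of the cocharacter commute and are jointly diagonalizable, so the closure of
    their product is a torus in G containing T, and equals T by maximality. *)
Lemma max_torus_cochar s (E : 'I_s -> 'M[k]_n) (h : 'I_s -> int) : complete_idem E ->
  (forall x, x != 0 -> G (cochar E h x)) -> (forall a t, T t -> E a *m t = t *m E a) ->
  forall x, x != 0 -> T (cochar E h x).
Proof.
move=> idE HG cE x nx.
have [P uP [dT dE]] := codiag_idem idE max_torus_diag cE.
pose A g := exists t y, [/\ T t, y != 0 & g = t *m cochar E h y].
have cu := @cochar_unit k n s E h idE.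
have cc t y : T t -> cochar E h y *m t = t *m cochar E h y.
  move=> Tt; rewrite mulmx_suml mulmx_sumr; apply: eq_bigr => a _.
  by rewrite -scalemxAl cE // scalemxAr.
have Au g : A g -> g \in unitmx.
  by case=> t [y [Tt ny ->]]; rewrite unitmx_mul Tu ?cu.
have TA t : T t -> A t.
  by move=> Tt; exists t, 1; rewrite oner_neq0 cochar1 ?mulmx1.
have A1 : A 1%:M by apply: TA; apply: (alg_group1 algT).
have AM g h' : A g -> A h' -> A (g *m h').
  move=> [t [y [Tt ny ->]]] [u [z [Tu' nz ->]]]; exists (t *m u), (y * z).
  split; [exact: alg_groupM|by rewrite mulf_neq0|].
  by rewrite -mulmxA [_ *m (u *m _)]mulmxA cc // -!mulmxA cocharM.
have AV g : A g -> A (invmx g).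
  move=> [t [y [Tt ny ->]]]; exists (invmx t), y^-1.
  split; [exact: alg_groupV|by rewrite invr_eq0|].
  rewrite invmx_mul ?cu ?Tu // invmx_cochar // cc //; exact: alg_groupV.
have dA g : A g -> diag_for P g.
  case=> t [y [Tt ny ->]]; apply: diag_forM => //; first exact: dT.
  by apply: diag_for_sum => a; apply: diag_forZ.
have connA : zconnected A.
  split; first by exists 1%:M.
  move=> Y Z cY cZ cov exY exZ; apply: NNPP => no.
  (* A member of a closed cover without common points contains a whole curve [t *m cochar E h y] as
     soon as it contains one of its points. Moving the parameter to 1 reduces the connectedness of A
     to that of T. *)
  have run (Y' Z' : 'M[k]_n -> Prop) t y z : zclosed Y' -> zclosed Z' ->
      (forall g, A g -> Y' g \/ Z' g) -> (~ exists g, [/\ A g, Y' g & Z' g]) ->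
      T t -> y != 0 -> z != 0 -> Y' (t *m cochar E h y) -> Y' (t *m cochar E h z).
    move=> cY' cZ' cov' no' Tt ny nz Yy.
    have tA v : v != 0 -> A (t *m cochar E h v) by exists t, v.
    have [||v nv|//|[v nv [Yv Zv]]] := curve_cover (c := fun v => t *m cochar E h v)
      k_char0 _ _ cY' cZ' _ ny nz Yy.
    - by move=> v nv; apply/Au/tA.
    - by move=> p; apply: cochar_Laurent.
    - exact/cov'/tA.
    by case: no'; exists (t *m cochar E h v); split=> //; apply: tA.
  have toT (Y' Z' : 'M[k]_n -> Prop) : zclosed Y' -> zclosed Z' ->
      (forall g, A g -> Y' g \/ Z' g) -> (~ exists g, [/\ A g, Y' g & Z' g]) ->
      (exists g, A g /\ Y' g) -> exists t, T t /\ Y' t.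
    move=> cY' cZ' cov' no' [g [[t [y [Tt ny ->]]] Yg]]; exists t; split=> //.
    rewrite -[t]mulmx1 -(cochar1 h idE).
    exact: (run Y' Z' t y 1 cY' cZ' cov' no' Tt ny (oner_neq0 _) Yg).
  have covC g : A g -> Z g \/ Y g by case/cov; [right|left].
  have noC : ~ exists g, [/\ A g, Z g & Y g].
    by case=> g [Ag Zg Yg]; apply: no; exists g.
  have exYT := toT Y Z cY cZ cov no exY; have exZT := toT Z Y cZ cY covC noC exZ.
  have [_ connT] := max_torus_conn.
  have [g Tg|g [Tg Yg Zg]] := connT Y Z cY cZ _ exYT exZT; first exact/cov/TA.
  by apply: no; exists g; split=> //; apply: TA.
have torS : torus (zclosure A).
  split; [exact: zclosure_group|exact: zclosure_connected|].
  by exists P => // t; apply: diag_for_zclosure.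
case: T_max => _ _ /(_ _ torS) H.
have SG g : zclosure A g -> G g.
  apply: zclosure_min; first by case: algG.
  move=> _ [t [y [Tt ny ->]]]; apply: (alg_groupM algG (max_torus_sub Tt)); exact: HG.
have TS t : T t -> zclosure A t by move=> Tt; apply: sub_zclosure => //; apply: TA.
apply/(H SG TS); apply: sub_zclosure => //.
by exists 1%:M, x; rewrite mul1mx; split=> //; apply: alg_group1.
Qed.

(** The spectral idempotents of X commute with everything that commutes with X, in particular with
    T; so the cocharacters given by the rational parts of X lie in T. *)
Lemma max_torus_jordan X : Lie G X -> (forall t, T t -> t *m X = X *m t) ->
  exists Xs, [/\ Lie T Xs, (forall Y, Y *m X = X *m Y -> Y *m Xs = Xs *m Y)
    & exists N, (X - Xs) ^+ N = 0].
Proof.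
move=> LX cX; have [s [r [E [h [b []]]]]] := Lie_rational_parts k_char0 algG LX.
set Xs := \sum_l _ => -[idE b_free] cE LE XsE [N [HN _]].
have cT a t : T t -> E a *m t = t *m E a by move=> Tt; apply: cE; apply: cX.
have LT l : Lie T (cogen E (fun a => h a l)).
  apply: (cochar_Lie k_char0 idE algT); apply: max_torus_cochar => // x nx.
  exact: (cochar_in k_char0 idE algG).
exists Xs; split; last by exists N.
  rewrite /Xs; elim/big_ind: _ => [|u v Hu Hv|l _]; first exact: Lie0.
    by rewrite -[u]scale1r; apply: Lie_linear.
  by rewrite -[_ *: _]addr0; apply: Lie_linear; rewrite ?LT //; apply: Lie0.
move=> Y cY; rewrite XsE mulmx_suml mulmx_sumr; apply: eq_bigr => a _.
by rewrite -scalemxAl -scalemxAr cE.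
Qed.

End MaximalTorus.

(** * Engel's theorem and the radical of the trace form *)

Section Engel.
Variables (k : fieldType) (n : nat).
Implicit Types (X Y v : 'M[k]_n) (l w : seq 'M[k]_n) (C S : 'M[k]_n -> Prop).

Definition mprod l : 'M[k]_n := foldr mulmx 1%:M l.

Definition all_in C l : Prop := forall X, X \in l -> C X.

Definition nilset C : Prop := exists m, forall l, size l = m -> all_in C l -> mprod l = 0.

Lemma mprod_cat l w : mprod (l ++ w) = mprod l *m mprod w.
Proof. by elim: l => [|x l IH] /=; rewrite ?mul1mx // IH mulmxA. Qed.

Lemma mprod_rcons l X : mprod (rcons l X) = mprod l *m X.
Proof. by rewrite -cats1 mprod_cat /= mulmx1. Qed.

Lemma all_in_cat C l w : all_in C (l ++ w) <-> all_in C l /\ all_in C w.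
Proof.
split=> [H|[H1 H2] X]; last by rewrite mem_cat => /orP[/H1|/H2].
by split=> X Xl; apply: H; rewrite mem_cat Xl ?orbT.
Qed.

Lemma all_in_cons C X l : all_in C (X :: l) <-> C X /\ all_in C l.
Proof.
split=> [H|[H1 H2] Y]; last by rewrite inE => /predU1P[->|/H2].
by split=> [|Y Yl]; apply: H; rewrite inE ?eqxx ?Yl ?orbT.
Qed.

Lemma all_in_rcons C X l : all_in C (rcons l X) <-> all_in C l /\ C X.
Proof.
rewrite -cats1; split=> [/all_in_cat[H /all_in_cons[]]|[H CX]] //.
by apply/all_in_cat; split=> //; apply/all_in_cons.
Qed.

Lemma mprod_long C m l : (forall l, size l = m -> all_in C l -> mprod l = 0) ->
  (m <= size l)%N -> all_in C l -> mprod l = 0.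
Proof.
move=> Hm le; rewrite -(cat_take_drop m l) => /all_in_cat[H1 _].
by rewrite mprod_cat (Hm (take m l)) ?mul0mx // size_takel.
Qed.

(** The terms of an increasing filtration, lowered by one step by each element of C. *)
Definition killed C i v : Prop := forall l, size l = i -> all_in C l -> mprod l *m v = 0.

Lemma killed0 C v : killed C 0 v -> v = 0.
Proof. by move/(_ [::] erefl); rewrite mul1mx; apply=> X. Qed.

Lemma killed_linear C i c u v : killed C i u -> killed C i v -> killed C i (c *: u + v).
Proof.
by move=> Hu Hv l sl Cl; rewrite mulmxDr -scalemxAr Hu // Hv // scaler0 addr0.
Qed.

Lemma killedS C i v : killed C i v -> killed C i.+1 v.
Proof.
move=> H [//|X l] [sl] /all_in_cons[_ Cl].
by rewrite /= -mulmxA H // mulmx0.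
Qed.

Lemma killed_mul C i X v : C X -> killed C i.+1 v -> killed C i (X *m v).
Proof.
move=> CX H l sl Cl; rewrite mulmxA -mprod_rcons H ?size_rcons ?sl //.
by apply/all_in_rcons.
Qed.

Lemma killed_normal C i X v : (forall Y, C Y -> C (Y *m X - X *m Y)) ->
  killed C i v -> killed C i (X *m v).
Proof.
move=> nX; elim: i v => [|i IH] v; first by move/killed0->; rewrite mulmx0 => l _ _; rewrite mulmx0.
move=> H l; case/lastP: l => [//|l Y]; rewrite size_rcons => -[sl] /all_in_rcons[Cl CY].
rewrite mprod_rcons -mulmxA.
have -> : Y *m (X *m v) = X *m (Y *m v) + (Y *m X - X *m Y) *m v.
  by rewrite mulmxBl !mulmxA addrC subrK.
rewrite mulmxDr IH //; last exact: killed_mul.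
by rewrite add0r (killed_mul (nX _ CY) H).
Qed.

(** X preserves each term of the filtration [killed C i] because it normalizes C. Modulo the term i,
    a word in elements [Y + c *: X] acts on the term i + 1 as a multiple of a power of X, so N
    letters lower the index by one. *)
Lemma nilset_extend C X N : nilset C -> C 0 ->
  (forall Y, C Y -> C (Y *m X - X *m Y)) -> X ^+ N = 0 ->
  nilset (fun Z => exists c Y, C Y /\ Z = Y + c *: X).
Proof.
move=> [m Hm] C0 nX XN; exists (N * m)%N.
have step i v w : killed C i.+1 v ->
    all_in (fun Z => exists c Y, C Y /\ Z = Y + c *: X) w ->
    exists a u, killed C i u /\ mprod w *m v = a *: (X ^+ size w *m v) + u.
  move=> Kv; elim: w => [_|Z w IH /all_in_cons[[c [Y [CY ->]]] /IH[a [u [Ku E]]]]].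
    by exists 1, 0; rewrite scale1r expr0 addr0 mul1mx; split=> // l _ _; rewrite mulmx0.
  have KX j : killed C i.+1 (X ^+ j *m v).
    elim: j => [|j IHj]; first by rewrite expr0 mul1mx.
    by rewrite exprS -mulmxA; apply: killed_normal.
  exists (c * a), (c *: (X *m u) + Y *m (a *: (X ^+ size w *m v) + u)); split.
    apply: killed_linear; first exact: killed_normal.
    by apply: killed_mul => //; apply: killed_linear; [exact: KX|exact: killedS].
  rewrite /= -mulmxA E mulmxDl addrC addrA; congr (_ + _).
  by rewrite -scalemxAl mulmxDr scalerDr -scalemxAr scalerA exprS -[X * _ *m v]mulmxA.
suff H i v w : killed C i v -> size w = (N * i)%N ->
    all_in (fun Z => exists c Y, C Y /\ Z = Y + c *: X) w -> mprod w *m v = 0.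
  move=> l sl Cl; rewrite -[LHS]mulmx1; apply: (H m) => // w sw Cw.
  by rewrite mulmx1 Hm.
elim: i v w => [|i IH] v w Kv; first by rewrite (killed0 Kv) mulmx0.
rewrite mulnS addnC => sw; rewrite -(cat_take_drop (N * i) w) => /all_in_cat[C1 C2].
rewrite mprod_cat -mulmxA; apply: IH => //; last by rewrite size_takel // sw leq_addr.
have [a [u [Ku ->]]] := step i v _ Kv C2.
by rewrite size_drop sw addKn XN mul0mx scaler0 add0r.
Qed.

(** A subalgebra C of S whose long products vanish is enlarged by an element of S outside C that
    normalizes C, until it is all of S. *)
Theorem engel S : S 0 -> (forall c X Y, S X -> S Y -> S (c *: X + Y)) ->
  (forall X Y, S X -> S Y -> S (X *m Y - Y *m X)) ->
  (forall X, S X -> exists N, X ^+ N = 0) -> nilset S.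
Proof.
move=> S0 SL SB SN.
pose good (C : 'M[k]_(n * n)) := let W := fun X => (mxvec X <= C)%MS in
  [/\ forall X, W X -> S X, forall X Y, W X -> W Y -> W (X *m Y - Y *m X) & nilset W].
suff H d (C : 'M[k]_(n * n)) : (n * n - \rank C <= d)%N -> good C -> nilset S.
  apply: (H (n * n)%N 0); first exact: leq_subr.
  split=> [X|X Y|]; rewrite ?submx0.
  - by move/eqP => X0; rewrite -(mxvecK X) X0 linear0.
  - move=> /eqP X0 _; have -> : X = 0 by rewrite -(mxvecK X) X0 linear0.
    by rewrite mul0mx mulmx0 subrr linear0.
  - exists 1%N => -[//|X [|//]] _ /all_in_cons[].
    by rewrite submx0 => /eqP X0 _; rewrite /= mulmx1 -(mxvecK X) X0 linear0.
elim: d C => [|d IH] C Cd [CS CB Cnil];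
  have [all|no] := classic (forall X, S X -> (mxvec X <= C)%MS);
  try by case: Cnil => m Hm; exists m => l sl Sl; apply: Hm => // X /Sl /all.
- by case: no => X _; rewrite submx_full // /row_full eqn_leq rank_leq_col -subn_eq0 -leqn0.
have [X0 nX0] := not_all_ex_not _ _ no.
have [SX0 CX0] : S X0 /\ ~~ (mxvec X0 <= C)%MS.
  by split; [apply: NNPP => H; case: nX0|apply/negP => H; apply: nX0].
pose W X := is_true (mxvec X <= C)%MS.
have WL c X Y : W X -> W Y -> W (c *: X + Y).
  by move=> WX WY; rewrite /W linearP /=; apply: addmx_sub => //; apply: scalemx_sub.
have W0 : W 0 by rewrite /W linear0 sub0mx.
(* Otherwise iterated brackets of [X0] with suitable elements of C never enter C. But after j
   brackets, a product with letters of C on both sides vanishes as soon as their number plus j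
   reaches 2m; for j = 2m the iterated bracket itself is 0. *)
have [X [SX WX nX]] : exists X, [/\ S X, ~ W X & forall Y, W Y -> W (Y *m X - X *m Y)].
  apply: NNPP => noX; have [m Hm] := Cnil.
  have H j : exists Y, [/\ S Y, ~ W Y & forall A B, all_in W A -> all_in W B ->
      (m + m <= size A + size B + j)%N -> mprod A *m Y *m mprod B = 0].
    elim: j => [|j [Y [SY WY HY]]].
      exists X0; split=> //.
      move=> A B WA WB; rewrite addn0 => le.
      have [leA|ltA] := leqP m (size A); first by rewrite (mprod_long Hm leA WA) !mul0mx.
      by rewrite (mprod_long Hm _ WB) ?mulmx0 //; lia.
    have [t [Wt nt]] : exists t, W t /\ ~ W (t *m Y - Y *m t).
      apply: NNPP => no_t; apply: noX; exists Y; split=> // t Wt.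
      by apply: NNPP => nt; apply: no_t; exists t.
    exists (t *m Y - Y *m t); split=> //; first by apply: SB => //; apply: CS.
    move=> A B WA WB le; rewrite mulmxBr mulmxBl !mulmxA -(mprod_rcons A t).
    have e1 : mprod (rcons A t) *m Y *m mprod B = 0.
      by apply: HY => //; [apply/all_in_rcons|rewrite size_rcons; lia].
    have e2 : mprod A *m Y *m mprod (t :: B) = 0.
      by apply: HY => //; [apply/all_in_cons|rewrite /=; lia].
    by rewrite e1 -(mulmxA _ t) e2 subr0.
  have [Y [_ WY HY]] := H (m + m)%N; apply: WY.
  suff -> : Y = 0 by [].
  by rewrite -[Y]mul1mx -[_ *m Y]mulmx1; apply: (HY [::] [::]).
have [N XN] := SN X SX.
have CX' Z : (mxvec Z <= (C + mxvec X)%MS)%MS <-> exists c Y, W Y /\ Z = Y + c *: X.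
  split=> [/sub_addsmxP[[A D]] /= E|[c [Y [WY ->]]]].
    exists (D 0 0), (vec_mx (A *m C)); rewrite /W vec_mxK submxMl; split=> //.
    rewrite -[LHS]mxvecK E linearD /=; congr (_ + _).
    by rewrite {1}[D]mx11_scalar mul_scalar_mx linearZ /= mxvecK.
  rewrite linearD linearZ /= addmx_sub ?scalemx_sub ?addsmxSr //.
  exact: submx_trans WY (addsmxSl _ _).
apply: (IH (C + mxvec X)%MS).
  have : (\rank C < \rank (C + mxvec X))%N.
    rewrite ltnNge; apply/negP => le; apply: WX.
    apply: submx_trans (addsmxSr C _) _.
    by rewrite (geq_leqif (mxrank_leqif_sup (addsmxSl C _))) // in le.
  have := rank_leq_col C; lia.
split=> [Z /CX'[c [Y [WY ->]]]|Z Z' /CX'[c [Y [WY ->]]] /CX'[c' [Y' [WY' ->]]]|].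
- by rewrite addrC; apply: SL => //; apply: CS.
- apply/CX'; exists 0, ((Y *m Y' - Y' *m Y) + (c' *: (Y *m X - X *m Y) -
    c *: (Y' *m X - X *m Y'))); split.
    rewrite -[X in X + _]scale1r; apply: (WL); first exact: CB.
    by rewrite -scaleNr; apply: (WL) => //; [exact: nX|rewrite -[_ *: _]addr0; apply: (WL) => //; exact: nX].
  rewrite scale0r addr0 !mulmxDl !mulmxDr -!scalemxAl -!scalemxAr !scalerBr !scalerA.
  have shuffle (V : zmodType) (a b d1 d2 e1 e2 f : V) :
      a + d1 + (e1 + f) - (b + e2 + (d2 + f)) = a - b + (d1 - d2 - (e2 - e1)).
    have E1 : a + d1 - (b + e2) = a - b + (d1 - e2) by rewrite opprD addrACA.
    have E2 : e1 + f - (d2 + f) = e1 - d2 by rewrite opprD addrACA subrr addr0.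
    rewrite opprD addrACA E1 E2 -addrA; congr (_ + _).
    by rewrite opprB addrACA [RHS]addrACA; congr (_ + _); rewrite addrC.
  by rewrite [c' * c]mulrC shuffle.
- have [m Hm] := nilset_extend Cnil W0 nX XN.
  by exists m => l sl Cl; apply: Hm => // Z /Cl /CX'.
Qed.

End Engel.

(** Left invariant derivations along Lie G preserve I(G), and their commutator is the derivation of
    the bracket, as is checked on linear forms. *)
Lemma LieM_bracket (k : fieldType) (k_char0 : [pchar k] =i pred0) n
    (G : 'M[k]_n -> Prop) (algG : alg_group G) X Y :
  Lie G X -> Lie G Y -> Lie G (X *m Y - Y *m X).
Proof.
move=> LX LY; apply/LieP => p Ip.
have comm q : Dr X (Dr Y q) - Dr Y (Dr X q) = Dr (X *m Y - Y *m X) q.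
  elim/mpoly_closed_ind: q => [c|i|p1 p2 H1 H2|p1 p2 H1 H2].
  - by rewrite !DrC !raddf0 ?subrr ?addr0.
  - case/mxvec_indexP: i => i j; rewrite -form1 !Dr_form !mulmx1.
    rewrite [X *m Y - _](_ : _ = (-1) *: (Y *m X) + X *m Y); last first.
      by rewrite scaleN1r addrC.
    by rewrite form_linear scaleN1r addrC.
  - by rewrite !linearD /= -H1 -H2 ?opprD addrACA.
  - rewrite !DrM !linearD /= !DrM -H1 -H2.
    move: (Dr X (Dr Y p1)) (Dr Y (Dr X p1)) (Dr X p1) (Dr Y p1) => a1 a2 a3 a4.
    move: (Dr X (Dr Y p2)) (Dr Y (Dr X p2)) (Dr X p2) (Dr Y p2) => b1 b2 b3 b4.
    by ring.
rewrite -[_ - _]mul1mx -ev_Dr -comm evB.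
have G1 := alg_group1 algG.
rewrite (vanish_Dr k_char0 algG LX (vanish_Dr k_char0 algG LY Ip) G1).
by rewrite (vanish_Dr k_char0 algG LY (vanish_Dr k_char0 algG LX Ip) G1) subrr.
Qed.

Lemma Lie_conj (k : fieldType) (k_char0 : [pchar k] =i pred0) n
    (G : 'M[k]_n -> Prop) (algG : alg_group G) g X :
  G g -> Lie G X -> Lie G (g *m X *m invmx g).
Proof.
move=> Gg /LieP LX; apply/LieP => p Ip.
have ug := alg_group_unit algG Gg.
pose q := ltrans g (rtrans (invmx g) p).
have evq C : ev C q = ev (g *m C *m invmx g) p.
  by rewrite ev_ltrans ev_rtrans.
have Iq : vanish G q.
  move=> h Gh; rewrite evq; apply: Ip; apply: alg_groupM => //.
    exact: alg_groupM.
  exact: alg_groupV.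
have := LX q Iq.
rewrite (dd_comp_affine k_char0 (p := p) (phi := fun C => g *m C *m invmx g)
  (psi := fun C => g *m C *m invmx g)) ?mulmx1 ?mulmxV // => t.
by rewrite mulmxDr mulmxDl -scalemxAr -scalemxAl ?mulmx1 ?mulmxV.
Qed.

(** * Nilpotent associative algebras *)

Section AssocAlgebra.
Variables (k : fieldType) (n : nat) (S : 'M[k]_n -> Prop).
Implicit Types (X Y : 'M[k]_n).

(** The associative algebra without unit generated by S. When long products of elements of S vanish
    it consists of nilpotent matrices, and the matrices 1 + a with a in it are closed under products
    and inverses. *)
Inductive assoc : 'M[k]_n -> Prop :=
  | assoc_gen X : S X -> assoc X
  | assoc_linear c X Y : assoc X -> assoc Y -> assoc (c *: X + Y)
  | assoc_mul X Y : assoc X -> assoc Y -> assoc (X *m Y).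

Lemma assoc_killed i v Y : assoc Y -> killed S i.+1 v -> killed S i (Y *m v).
Proof.
move=> AY; elim: AY i v => {Y} [X SX|c X Y _ IX _ IY|X Y _ IX _ IY] i v Kv.
- exact: killed_mul.
- by rewrite mulmxDl -scalemxAl; apply: killed_linear; auto.
rewrite -mulmxA; case: i Kv => [|i] Kv.
  by rewrite (killed0 (IY _ _ Kv)) mulmx0 => l _ _; rewrite mulmx0.
by apply: killedS; apply/IX/IY.
Qed.

Hypotheses (S0 : S 0) (nilS : nilset S).

Lemma assoc0 : assoc 0. Proof. exact: assoc_gen. Qed.

Lemma assocZ c X : assoc X -> assoc (c *: X).
Proof. by move=> AX; rewrite -[_ *: X]addr0; apply/assoc_linear/assoc0. Qed.

Lemma assocD X Y : assoc X -> assoc Y -> assoc (X + Y).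
Proof. by move=> AX AY; rewrite -[X]scale1r; apply: assoc_linear. Qed.

Lemma assoc_sum (I : Type) (r : seq I) (F : I -> 'M[k]_n) :
  (forall i, assoc (F i)) -> assoc (\sum_(i <- r) F i).
Proof.
by move=> H; elim/big_ind: _ => // [|X Y]; [apply: assoc0|apply: assocD].
Qed.

Lemma assoc_exp X i : assoc X -> assoc (X ^+ i.+1).
Proof. by move=> AX; elim: i => [|i IH]; rewrite ?expr1 // exprS; apply: assoc_mul. Qed.

Lemma assoc_nil : exists m, forall Y, assoc Y -> Y ^+ m.+1 = 0.
Proof.
have [m Hm] := nilS; exists m => Y AY.
suff H i j : (i + j = m)%N -> killed S i (Y ^+ j).
  by rewrite exprSr (killed0 (H 0 m erefl)) mul0r.
elim: j i => [|j IH] i eij.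
  by move=> l sl Sl; rewrite expr0 mulmx1 Hm // sl -eij addn0.
by rewrite exprS; apply: assoc_killed => //; apply: IH; rewrite addSn -addnS.
Qed.

(** The geometric series of -X is finite, and its terms after the first lie in the algebra. *)
Lemma one_plus_inv X : assoc X -> exists Y, [/\ assoc Y, 1%:M + X \in unitmx
  & invmx (1%:M + X) = 1%:M + Y].
Proof.
move=> AX; have [m Hm] := assoc_nil; pose b := - X.
have Ab : assoc b by rewrite /b -scaleN1r; apply: assocZ.
pose Y := \sum_(i < m) b ^+ i.+1.
have E : (1%:M + X) *m (1%:M + Y) = 1%:M.
  have geo j : (1%:M + X) *m (\sum_(i < j) b ^+ i) = 1%:M - b ^+ j.
    elim: j => [|j IH]; first by rewrite big_ord0 mulmx0 expr0 subrr.
    rewrite big_ord_recr /= mulmxDr IH exprS mulmxDl mul1mx.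
    by rewrite [X *m _](_ : _ = - (b * b ^+ j)) ?addrA ?subrK // /b mulNr opprK.
  have -> : 1%:M + Y = \sum_(i < m.+1) b ^+ i by rewrite big_ord_recl expr0.
  by rewrite geo Hm // subr0.
have [u _] := mulmx1_unit E; exists Y; split=> //; first by apply: assoc_sum => i; apply: assoc_exp.
by rewrite -[RHS](mulKmx u) E mulmx1.
Qed.

End AssocAlgebra.

Section Traces.
Variables (k : closedFieldType) (k_char0 : [pchar k] =i pred0).

Lemma trace_nilpotent n (X : 'M[k]_n) N : X ^+ N = 0 -> \tr X = 0.
Proof.
case: n X => [|n] X XN; first by rewrite /mxtrace big_ord0.
have [rs def_p] := closed_field_poly_normal (char_poly X).
rewrite (monicP (char_poly_monic X)) scale1r in def_p.
have rs0 a : a \in rs -> a = 0.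
  move=> ars; have : root (char_poly X) a by rewrite def_p root_prod_XsubC.
  rewrite -eigenvalue_root_char => /eigenvalueP[v vX nv].
  have vXi i : v *m X ^+ i = a ^+ i *: v.
    elim: i => [|i IH]; first by rewrite !expr0 mulmx1 scale1r.
    by rewrite exprSr mulmxA IH -scalemxAl vX scalerA exprSr.
  have := vXi N; rewrite XN mulmx0 => /esym/eqP.
  by rewrite scaler_eq0 (negPf nv) orbF expf_eq0 => /andP[_ /eqP].
have pXn : char_poly X = 'X^(n.+1).
  rewrite def_p (eq_big_seq (fun=> 'X)) => [|a /rs0->]; last by rewrite subr0.
  rewrite big_const_seq count_predT iter_mulr_1; congr ('X^_).
  by have := size_char_poly X; rewrite def_p size_prod_XsubC => -[].
have /esym := char_poly_trace X (ltn0Sn n).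
by rewrite pXn coefXn ltn_eqF ?leqnn // => /eqP; rewrite oppr_eq0 => /eqP.
Qed.

Lemma trace_idem n (E : 'M[k]_n) : E *m E = E -> \tr E = (\rank E)%:R.
Proof.
move=> EE; have := mulmx_base E.
have /row_freeP[B] := row_base_free E; have /row_fullP[B'] := col_base_full E.
move: (col_base E) (row_base E) => C D CB RB def_E.
have e : D *m C *m D = D.
  rewrite -[LHS]mul1mx -[RHS]mul1mx -CB -!(mulmxA B'); congr (_ *m _).
  by rewrite !mulmxA def_E -mulmxA def_E EE.
rewrite -{1}def_E mxtrace_mulC; suff -> : D *m C = 1%:M by rewrite mxtrace1.
by rewrite -[LHS]mulmx1 -{1}RB mulmxA e RB.
Qed.

End Traces.

(** Every point is joined to 1 by a curve to which [curve_cover] applies. The endpoints are at the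
    parameters 1 and 2 because 0 is excluded. *)
Lemma connected_by_curves (k : fieldType) (k_char0 : [pchar k] =i pred0) n
    (X : 'M[k]_n -> Prop) : X 1%:M -> (forall g, X g -> g \in unitmx) ->
  (forall g, X g -> exists2 c : k -> 'M[k]_n,
     [/\ c 1 = 1%:M, c 2 = g & forall x, x != 0 -> X (c x)] &
     forall p, exists (u : {poly k}) (N : nat),
       forall x, x != 0 -> x ^+ N * ev (c x) p = u.[x]) -> zconnected X.
Proof.
move=> X1 Xu Hc; split; first by exists 1%:M.
have n2 : (2 : k) != 0 by apply: (natr_neq0 k_char0 1).
have run (Y Z : 'M[k]_n -> Prop) z : zclosed Y -> zclosed Z ->
    (forall A, X A -> Y A \/ Z A) -> Y 1%:M -> X z -> Z z ->
    exists A, [/\ X A, Y A & Z A].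
  move=> cY cZ cov Y1 Xz Zz; have [c [c1 c2 cX] cL] := Hc z Xz.
  have cu x : x != 0 -> c x \in unitmx by move=> nx; apply/Xu/cX.
  have ccov x : x != 0 -> Y (c x) \/ Z (c x) by move=> nx; apply/cov/cX.
  have Yc1 : Y (c 1) by rewrite c1.
  have [Yz|[x nx [Yx Zx]]] := curve_cover k_char0 cu cL cY cZ ccov (oner_neq0 _) n2 Yc1.
    by exists z; rewrite c2 in Yz.
  by exists (c x); split=> //; apply: cX.
move=> Y Z cY cZ cov [y [Xy Yy]] [z [Xz Zz]].
case: (cov _ X1) => [Y1|Z1]; first exact: (run Y Z z).
have covC A : X A -> Z A \/ Y A by move=> /cov[]; [right|left].
by have [A [XA ZA YA]] := run Z Y y cZ cY covC Z1 Xy Yy; exists A.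
Qed.

(** * Polynomial curves through unipotent matrices *)

Section Curves.
Variables (k : fieldType) (k_char0 : [pchar k] =i pred0) (n : nat).
Implicit Types (a X : 'M[k]_n).

Lemma sum_ord_extend (V : nmodType) (F : nat -> V) i j :
  (forall l, (i <= l)%N -> F l = 0) -> (i <= j)%N -> \sum_(l < j) F l = \sum_(l < i) F l.
Proof.
move=> F0 leij; rewrite -!(big_mkord xpredT) (big_cat_nat (leq0n i) leij) /=.
by rewrite [X in _ + X]big_nat_cond [X in _ + X]big1 ?addr0 // => l /andP[/andP[/F0]].
Qed.

(** The binomial coefficient of the variable over j. *)
Definition binp j : {poly k} := (j`!)%:R^-1 *: \prod_(i < j) ('X - (i%:R)%:P).

Lemma binp_nat j m : (binp j).[m%:R] = 'C(m, j)%:R.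
Proof.
rewrite hornerZ horner_prod.
have -> : \prod_(i < j) ('X - (i%:R)%:P).[m%:R] = (m ^_ j)%:R :> k.
  have [lejm|ltmj] := leqP j m.
    rewrite ffact_prod natr_prod; apply: eq_bigr => i _.
    by rewrite !hornerE natrB // (leq_trans (ltnW (ltn_ord i))).
  by rewrite ffact_small // (bigD1 (Ordinal ltmj)) //= !hornerE subrr mul0r.
rewrite -bin_ffact natrM mulrA mulrAC mulVf ?mul1r //.
by have := fact_gt0 j; case: (j`!) => // f _; apply: natr_neq0.
Qed.

(** The binomial series of the power (1 + a)^t, finite when a is nilpotent. *)
Definition power_curve M a : 'M[{poly k}]_n :=
  \sum_(j < M) binp j *: map_mx polyC (a ^+ j).

Lemma horner_mx_sum (T : Type) (s : seq T) (F : T -> {poly k}) (B : T -> 'M[k]_n) t :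
  map_mx (horner_eval t) (\sum_(j <- s) F j *: map_mx polyC (B j)) =
  \sum_(j <- s) (F j).[t] *: B j.
Proof.
apply/matrixP => i j; rewrite mxE !summxE /horner_eval horner_sum.
by apply: eq_bigr => l _; rewrite !mxE hornerM hornerC.
Qed.

Lemma power_curve_nat M a m : a ^+ M = 0 ->
  map_mx (horner_eval m%:R) (power_curve M a) = (1%:M + a) ^+ m.
Proof.
move=> aM; rewrite horner_mx_sum.
have -> : (1%:M + a) ^+ m = \sum_(j < m.+1) 'C(m, j)%:R *: a ^+ j.
  rewrite exprDn_comm; last by rewrite /GRing.comm [LHS]mul1mx [RHS]mulmx1.
  apply: eq_bigr => j _; rewrite scaler_nat; congr (_ *+ _).
  by rewrite [X in X * _]expr1n [LHS]mul1mx.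
rewrite (eq_bigr (fun j : 'I_M => 'C(m, j)%:R *: a ^+ j)) => [|j _]; last by rewrite binp_nat.
pose F j := 'C(m, j)%:R *: a ^+ j : 'M[k]_n.
rewrite -(@sum_ord_extend _ F M (M + m.+1)) ?leq_addr // => [|l leM].
  rewrite -(@sum_ord_extend _ F m.+1 (M + m.+1)) ?leq_addl // => l ltm.
  by rewrite /F bin_small // scale0r.
by rewrite /F -(subnK leM) exprD aM mulr0 scaler0.
Qed.

Lemma pcurve_nat_vanish p (M : 'M[{poly k}]_n) :
  (forall m : nat, ev (map_mx (horner_eval m%:R) M) p = 0) ->
  forall t, ev (map_mx (horner_eval t) M) p = 0.
Proof.
move=> H t; rewrite -horner_pcurve; suff -> : pcurve p M = 0 by rewrite horner0.
apply/eqP/negPn/negP => /(poly_nonroot k_char0)[m].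
by rewrite horner_pcurve H eqxx.
Qed.

Definition exp_curve M X : 'M[{poly k}]_n :=
  \sum_(j < M) ((j`!)%:R^-1 *: 'X^j) *: map_mx polyC (X ^+ j).

Lemma exp_curveE M X t :
  map_mx (horner_eval t) (exp_curve M X) = \sum_(j < M) ((j`!)%:R^-1 * t ^+ j) *: X ^+ j.
Proof.
by rewrite horner_mx_sum; apply: eq_bigr => j _; rewrite hornerZ hornerXn.
Qed.

Lemma exp_curve_deriv M X t : X ^+ M = 0 ->
  map_mx (fun u : {poly k} => u^`().[t]) (exp_curve M X) =
  map_mx (horner_eval t) (exp_curve M X) *m X.
Proof.
move=> XM; rewrite exp_curveE mulmx_suml.
have -> : map_mx (fun u : {poly k} => u^`().[t]) (exp_curve M X) =
    \sum_(j < M) ((j`!)%:R^-1 * (t ^+ j.-1 *+ j)) *: X ^+ j.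
  apply/matrixP => i j; rewrite mxE !summxE linear_sum /= horner_sum.
  apply: eq_bigr => l _; rewrite !mxE derivM derivC mulr0 addr0 derivZ derivXn.
  by rewrite hornerM hornerC hornerZ hornerMn hornerXn.
case: M XM => [|M] XM; first by rewrite !big_ord0.
rewrite big_ord_recl mulr0n mulr0 scale0r add0r big_ord_recr /=.
rewrite -scalemxAl -[X ^+ M *m X]/(X ^+ M * X) -exprSr XM scaler0 addr0.
apply: eq_bigr => j _; rewrite -scalemxAl -[X ^+ j *m X]/(X ^+ j * X) -exprSr.
congr (_ *: _); rewrite /bump /= add1n factS natrM invfM -[t ^+ _ *+ _]mulr_natl mulrACA mulVf ?mul1r //.
exact: natr_neq0.
Qed.

Variables (G : 'M[k]_n -> Prop) (algG : alg_group G).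

(** Each Taylor coefficient of p along exp(tX) after the first is, up to a nonzero factor, the
    preceding one of [Dr X p], which vanishes on G like p. *)
Lemma exp_curve_vanish M X p t : Lie G X -> X ^+ M.+1 = 0 -> vanish G p ->
  ev (map_mx (horner_eval t) (exp_curve M.+1 X)) p = 0.
Proof.
move=> LX XM; set c := exp_curve M.+1 X.
have c0 : map_mx (horner_eval 0) c = 1%:M.
  rewrite exp_curveE big_ord_recl !expr0 fact0 invr1 mulr1 scale1r big1 ?addr0 //.
  by move=> j _; rewrite expr0n /= mulr0 scale0r.
have dc q : (pcurve q c)^`() = pcurve (Dr X q) c.
  apply: (poly_eq_evals k_char0 (oner_neq0 _)) => s _.
  by rewrite deriv_pcurve exp_curve_deriv // horner_pcurve ev_Dr.
suff H j q : vanish G q -> (pcurve q c)`_j = 0.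
  move=> Ip; rewrite -horner_pcurve; suff -> : pcurve p c = 0 by rewrite horner0.
  by apply/polyP => j; rewrite H // coef0.
elim: j q => [|j IH] q Iq.
  by rewrite -horner_coef0 horner_pcurve c0 Iq //; apply: alg_group1.
have := IH _ (vanish_Dr k_char0 algG LX Iq); rewrite -dc coef_deriv => /eqP.
by rewrite -mulr_natr mulf_eq0 (negPf (natr_neq0 k_char0 j)) orbF => /eqP.
Qed.

End Curves.

(** * The radical of the trace form *)

Section TraceRadical.
Variables (k : closedFieldType) (k_char0 : [pchar k] =i pred0) (n : nat).
Variables (G : 'M[k]_n -> Prop) (algG : alg_group G).
Implicit Types (X Y : 'M[k]_n).

Definition trad X : Prop := Lie G X /\ forall Y, Lie G Y -> \tr (X *m Y) = 0.

Lemma trad0 : trad 0.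
Proof. by split=> [|Y _]; [apply: Lie0|rewrite mul0mx linear0]. Qed.

Lemma trad_linear c X Y : trad X -> trad Y -> trad (c *: X + Y).
Proof.
move=> [LX HX] [LY HY]; split=> [|Z LZ]; first exact: Lie_linear.
by rewrite mulmxDl -scalemxAl linearP /= HX ?HY ?mulr0 ?addr0.
Qed.

Lemma trad_bracket X Y : trad X -> trad Y -> trad (X *m Y - Y *m X).
Proof.
move=> [LX HX] [LY HY]; split=> [|Z LZ]; first exact: LieM_bracket.
have := HX _ (LieM_bracket k_char0 algG LY LZ).
have trB (C D : 'M[k]_n) : \tr (C - D) = \tr C - \tr D by rewrite linearB.
rewrite mulmxBr mulmxBl !trB !mulmxA => /eqP; rewrite subr_eq0 => /eqP ->.
by rewrite mxtrace_mulC mulmxA subrr.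
Qed.

Lemma trad_conj g X : G g -> trad X -> trad (g *m X *m invmx g).
Proof.
move=> Gg [LX HX]; split=> [|Z LZ]; first exact: Lie_conj.
have ug := alg_group_unit algG Gg.
have := HX _ (Lie_conj k_char0 algG (alg_groupV algG Gg) LZ).
by rewrite invmxK -!mulmxA => <-; rewrite mxtrace_mulC !mulmxA.
Qed.

(* Pairing [X] with the rational coroots of its semisimple part [sum_a e_a E_a] gives *)
(* [sum_a rank(E_a) h_a^2 = 0] for each of the rational coordinates [h] of [e].       *)
Lemma trad_nilpotent X : trad X -> exists N, X ^+ N = 0.
Proof.
move=> [LX HX]; have [s [r [E [h [b []]]]]] := Lie_rational_parts k_char0 algG LX.
set Xs := \sum_l _ => -[[sumE orthE] b_free] cE LE XsE [N [HN HNa]].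
suff Xs0 : Xs = 0 by exists N; rewrite -HN Xs0 subr0.
have EE a : E a *m E a = E a by rewrite orthE eqxx.
have cX a : E a *m X = X *m E a by apply: cE.
have trE a : \tr (X *m E a) = wt_val b (h a) * (\rank (E a))%:R.
  set e := wt_val b (h a); pose B := (X - e%:M) *m E a.
  have -> : X *m E a = e *: E a + B by rewrite /B mulmxBl mul_scalar_mx addrC subrK.
  rewrite linearD linearZ /= trace_idem // (@trace_nilpotent _ _ B N.+1) ?addr0 //.
  have cB : E a *m (X - e%:M) = (X - e%:M) *m E a by rewrite mulmxBl mulmxBr cX scalar_mxC.
  have powB m : B ^+ m.+1 = (X - e%:M) ^+ m.+1 *m E a.
    elim: m => [|m IH]; first by rewrite !expr1.
    rewrite exprSr IH [in RHS]exprSr -[_ * B]/(_ *m B) /B -!mulmxA.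
    by rewrite [E a *m (_ *m _)]mulmxA cB -!mulmxA EE.
  by rewrite powB exprS -[_ * _ *m _]mulmxA HNa mulmx0.
have H a : wt_val b (h a) *: E a = 0.
  have [E0|nE0] := eqVneq (E a) 0; first by rewrite E0 scaler0.
  suff -> : h a = 0 by rewrite /wt_val big1 ?scale0r // => l _; rewrite ffunE mul0r.
  apply/ffunP => l; rewrite ffunE.
  pose m : {ffun 'I_r -> int} := [ffun l' => \sum_c (h c l * h c l') * (\rank (E c))%:Z].
  have /b_free/ffunP/(_ l) : wt_val b m = 0.
    have <- := HX _ (LE l); rewrite /cogen mulmx_sumr linear_sum /=.
    have mE l' : (m l')%:~R * b l' =
        \sum_c (h c l)%:~R * ((h c l')%:~R * b l') * (\rank (E c))%:R.
      rewrite ffunE rmorph_sum mulr_suml; apply: eq_bigr => c _.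
      by rewrite !rmorphM /= mulrAC; congr (_ * _); rewrite mulrA.
    rewrite [LHS](eq_bigr _ (fun l' _ => mE l')) exchange_big; apply: eq_bigr => c _ /=.
    by rewrite -scalemxAr linearZ /= trE /wt_val -mulr_suml -mulr_sumr mulrA.
  rewrite !ffunE => /eqP; rewrite psumr_eq0 => [/allP/(_ a)|c _]; last first.
    by rewrite mulr_ge0 // -expr2 sqr_ge0.
  rewrite mem_index_enum => /(_ isT) /=; rewrite !mulf_eq0 orbb => /orP[/eqP //|].
  by rewrite -[0]/(0%:Z) eqz_nat mxrank_eq0 (negPf nE0).
by rewrite XsE big1.
Qed.

Lemma trad_nilset : nilset trad.
Proof.
by apply: engel; [exact: trad0|exact: trad_linear|exact: trad_bracket|exact: trad_nilpotent].
Qed.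

Let A := assoc trad.

(** The unipotent subgroup to which simplicity of G is applied. *)
Definition trad_group g : Prop := G g /\ A (g - 1%:M).

Let assoc_conj g Y : G g -> A Y -> A (g *m Y *m invmx g).
Proof.
move=> Gg AY; have ug := alg_group_unit algG Gg.
elim: AY => {Y} [X tX|c X Y _ IX _ IY|X Y _ IX _ IY].
- by apply: assoc_gen; apply: trad_conj.
- by rewrite mulmxDr mulmxDl -scalemxAr -scalemxAl; apply: assoc_linear.
- have -> : g *m (X *m Y) *m invmx g = (g *m X *m invmx g) *m (g *m Y *m invmx g).
    by rewrite !mulmxA mulmxKV.
  exact: assoc_mul.
Qed.

Let A0 : A 0 := assoc0 trad0.

Lemma trad_group_normal : normal_subgroup trad_group G.
Proof.
have [C HC] : exists C : 'M[k]_(n * n), forall z, A (vec_mx z) <-> (z <= C)%MS.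
  apply: (@prop_subspace _ _ (fun z => A (vec_mx z))) => [|c u v Au Av].
    by rewrite linear0.
  by rewrite linearP; apply: assoc_linear.
have inA Y : A Y <-> (mxvec Y <= C)%MS by rewrite -HC mxvecK.
split; [split| |] => [||g h [Gg Ag] [Gh Ah]|g [Gg Ag]|h []//|g h Gg [Gh Ah]].
(* The algebra A is the row space of a matrix C; membership of g - 1 in it is a system of linear
   equations in the coordinates of g, read off the cokernel of C. *)
- pose P p := exists j, p = \sum_i cokermx C i j *: @coord k n i.
  have [S HS] := zclosed_sub algG P; exists S => g; rewrite -HS.
  have evP j : ev g (\sum_i cokermx C i j *: @coord k n i) =
      (mxvec (g - 1%:M) *m cokermx C) 0 j.
    rewrite mxE ev_sum; apply: eq_bigr => i _.
    by rewrite evZ /coord evB evX evC linearB !mxE mulrC.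
  split=> -[Gg H]; split=> //.
    by move=> p [j ->]; rewrite evP; move/inA: H; rewrite submxE => /eqP->; rewrite mxE.
  apply/inA; rewrite submxE; apply/eqP/matrixP => i j; rewrite ord1 -evP mxE.
  by apply: H; exists j.
- by split; [exact: alg_group1|rewrite subrr].
- split; first exact: alg_groupM.
  have -> : g *m h - 1%:M = (g - 1%:M) *m (h - 1%:M) + ((g - 1%:M) + (h - 1%:M)).
    rewrite mulmxBl mulmxBr mulmxBr !mulmx1 !mul1mx.
    by rewrite opprB addrA addrACA [_ - g + _]addrC; apply/matrixP => i j; rewrite !mxE; ring.
  by rewrite -[_ *m _]scale1r; apply: assoc_linear; [apply: assoc_mul|exact: assocD].
- split; first exact: alg_groupV.
  have [Y [AY _]] := one_plus_inv trad0 trad_nilset Ag.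
  by rewrite [1%:M + _]addrC subrK => ->; rewrite addrC addKr.
- split; first by apply: alg_groupM => //; [exact: alg_groupM|exact: alg_groupV].
  have ug := alg_group_unit algG Gg.
  have -> : g *m h *m invmx g - 1%:M = g *m (h - 1%:M) *m invmx g.
    by rewrite mulmxBr mulmxBl mulmx1 mulmxV.
  exact: assoc_conj.
Qed.

(** An element 1 + a is joined to 1 by its powers (1 + a)^t, which are in G for natural t and hence
    for all t by Zariski density. The parameter is shifted so that 1 and g are reached at 1 and
    2. *)
Lemma trad_group_connected : zconnected trad_group.
Proof.
have [[_ N1 _ _] NG _] := trad_group_normal.
have [m Hm] := assoc_nil trad_nilset.
apply: connected_by_curves => // [g [Gg _]|g [Gg Ag]]; first exact: alg_group_unit Gg.
set a := g - 1%:M in Ag; pose M := power_curve m.+1 a.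
have am : a ^+ m.+1 = 0 by apply: Hm.
have def_g : g = 1%:M + a by rewrite /a addrC subrK.
have AM t : A (map_mx (horner_eval t) M - 1%:M).
  rewrite /M /power_curve horner_mx_sum big_ord_recl expr0.
  rewrite /binp big_ord0 fact0 invr1 scale1r hornerC scale1r addrC addKr.
  apply: (assoc_sum trad0) => j; apply: (assocZ trad0).
  exact: (assoc_exp j Ag).
have Gpow j : G (g ^+ j).
  elim: j => [|j IH]; first by rewrite expr0; apply: alg_group1.
  by rewrite exprS; apply: alg_groupM.
have GM t : trad_group (map_mx (horner_eval t) M).
  split=> //; apply: (vanish_closed algG) => [|p Ip].
    have [Y [_ u _]] := one_plus_inv trad0 trad_nilset (AM t).
    by rewrite addrC subrK in u.
  apply: (pcurve_nat_vanish k_char0) => j.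
  by rewrite (power_curve_nat k_char0) // -def_g Ip.
exists (fun x => map_mx (horner_eval (x - 1)) M) => [|p].
  split=> [||x _]; last exact: GM.
    by rewrite subrr -[0](mulr0n 1) (power_curve_nat k_char0) // expr0.
  by rewrite addrK -[1](mulr1n 1) (power_curve_nat k_char0) // expr1.
exists (pcurve p M \Po ('X - 1%:P)), 0%N => x _.
by rewrite mul1r horner_comp !hornerE horner_pcurve.
Qed.

(** The curve exp(tX) runs in [trad_group]; if this group is trivial, the coefficient X of t is
    0. *)
Lemma trad_in_trivial X : (forall g, trad_group g -> g = 1%:M) -> trad X -> X = 0.
Proof.
move=> N1 tX; have [m Hm] := assoc_nil trad_nilset.
have AX : A X by apply: assoc_gen.
have Xm1 : X ^+ m.+2 = 0 by rewrite exprS (Hm X AX) mulr0.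
pose c := exp_curve m.+2 X.
have cE t : map_mx (horner_eval t) c - 1%:M =
    \sum_(j < m.+1) ((j.+1`!)%:R^-1 * t ^+ j.+1) *: X ^+ j.+1.
  rewrite exp_curveE big_ord_recl !expr0 fact0 invr1 mulr1 scale1r addrC addKr.
  by [].
have Ac t : A (map_mx (horner_eval t) c - 1%:M).
  rewrite cE; apply: (assoc_sum trad0) => j; apply: (assocZ trad0).
  exact: (assoc_exp j AX).
have c1 t : map_mx (horner_eval t) c = 1%:M.
  apply: N1; split=> //; apply: (vanish_closed algG) => [|p Ip].
    have [Y [_ u _]] := one_plus_inv trad0 trad_nilset (Ac t).
    by rewrite addrC subrK in u.
  by apply: (exp_curve_vanish k_char0 algG) => //; case: tX.
apply/matrixP => i j; rewrite mxE.
have cij : c i j = ((1%:M : 'M[k]_n) i j)%:P.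
  apply: (poly_eq_evals k_char0 (oner_neq0 _)) => t _.
  by rewrite hornerC -(c1 t) mxE.
have : (c i j)`_1 = X i j.
  rewrite /c /exp_curve summxE coef_sum (bigD1 (Ordinal (isT : (1 < m.+2)%N))) //=.
  rewrite !mxE coefMC coefZ coefXn invr1 !mul1r expr1 big1 ?addr0 // => l nl.
  rewrite !mxE coefMC coefZ coefXn [(1 == _)%N](_ : _ = false) ?mulr0 ?mul0r //.
  by apply: contraNF nl => /eqP e; apply/eqP/val_inj.
by rewrite cij coefC => <-.
Qed.

End TraceRadical.

Lemma diag_for_nilpotent (k : fieldType) n (P A : 'M[k]_n) N : P \in unitmx ->
  diag_for P A -> A ^+ N = 0 -> A = 0.
Proof.
move=> uP dA AN; apply: (conj_inj uP); rewrite mulmx0 mul0mx.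
have pw m : P *m A ^+ m *m invmx P = (P *m A *m invmx P) ^+ m.
  elim: m => [|m IH]; first by rewrite !expr0 mulmx1 mulmxV.
  by rewrite !exprS -IH -[A * _]/(A *m _) conjM.
have /diag_mxP[d def_d] := dA; rewrite def_d.
have dpow m : diag_mx d ^+ m = diag_mx (\row_i d 0 i ^+ m).
  elim: m => [|m IH].
    by apply/matrixP => i j; rewrite !mxE expr0.
  rewrite exprS IH -[_ * _]/(_ *m _) mulmx_diag; congr diag_mx.
  by apply/rowP => i; rewrite !mxE exprS.
have := pw N; rewrite AN mulmx0 mul0mx def_d dpow => /esym/matrixP H.
apply/matrixP => i j; rewrite !mxE; case: eqP => [->|//].
have := H j j; rewrite !mxE eqxx !mulr1n => /eqP; rewrite expf_eq0 => /andP[_ /eqP->].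
by [].
Qed.

(** If the unipotent subgroup were G it would contain T; but a matrix that is both unipotent and
    diagonalizable is 1. *)
Theorem simple_trad0 (k : closedFieldType) (k_char0 : [pchar k] =i pred0) n
    (G T : 'M[k]_n -> Prop) : simple_alg_group G -> maximal_torus G T ->
  (exists2 t, T t & t <> 1%:M) -> forall X, trad G X -> X = 0.
Proof.
move=> [algG connG _ simpG] T_max [t Tt nt] X.
apply: (trad_in_trivial k_char0 algG).
case: (simpG _ (trad_group_normal k_char0 algG) (trad_group_connected k_char0 algG)) => // NG.
have /NG[_ At] := max_torus_sub T_max Tt.
have [m Hm] := assoc_nil (trad_nilset k_char0 algG).
have [P uP dP] := max_torus_diag T_max.
case: nt; apply/eqP; rewrite -subr_eq0; apply/eqP.
apply: (diag_for_nilpotent uP _ (Hm _ At)).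
rewrite addrC -scaleN1r; apply: diag_for_linear; last exact: dP.
by apply: dP; apply: alg_group1; apply: max_torus_alg T_max.
Qed.

(** * Weights of a torus *)

Section LinearForms.
Variables (k : fieldType) (k_char0 : [pchar k] =i pred0) (n : nat).
Implicit Types (U V A B : 'M[k]_n).

Definition lform U V i j : {mpoly k[n * n]} :=
  (map_mx (@mpolyC (n * n) k) U *m gmx k n *m map_mx (@mpolyC (n * n) k) V) i j.

Lemma ev_lform U V i j A : ev A (lform U V i j) = (U *m A *m V) i j.
Proof.
have -> : ev A (lform U V i j) = map_mx (ev A) (map_mx (@mpolyC (n * n) k) U *m
  gmx k n *m map_mx (@mpolyC (n * n) k) V) i j by rewrite [RHS]mxE.
by rewrite !map_mxM !ev_constmx ev_gmx.
Qed.

Lemma dd_lform U V i j A B : dd (lform U V i j) A B = (U *m B *m V) i j.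
Proof.
rewrite dd_line; have -> : pcurve (lform U V i j) (line A B) =
    ((U *m A *m V) i j)%:P + ((U *m B *m V) i j) *: 'X.
  apply: (poly_eq_evals k_char0 (oner_neq0 _)) => t _.
  rewrite horner_pline ev_lform hornerD hornerC hornerZ hornerX.
  by rewrite mulmxDr mulmxDl -scalemxAr -scalemxAl mxE [in RHS]mulrC; congr (_ + _); rewrite mxE.
by rewrite derivD derivC add0r derivZ derivX hornerZ hornerC mulr1.
Qed.

Lemma Lie_commute (T : 'M[k]_n -> Prop) A X : (forall t, T t -> A *m t = t *m A) ->
  Lie T X -> A *m X = X *m A.
Proof.
move=> cA /LieP LX; apply/matrixP => i j; apply/eqP; rewrite -subr_eq0; apply/eqP.
have := LX (lform A 1%:M i j - lform 1%:M A i j).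
rewrite ddD ddN !dd_lform mulmx1 mul1mx; apply => t Tt.
by rewrite evB !ev_lform mulmx1 mul1mx cA // subrr.
Qed.

Lemma Lie_diag (T : 'M[k]_n -> Prop) P X : (forall t, T t -> diag_for P t) ->
  Lie T X -> diag_for P X.
Proof.
move=> dT /LieP LX; apply/diag_forP => i j nij.
by rewrite -(dd_lform _ _ i j 1%:M) LX // => t /dT/diag_forP dt; rewrite ev_lform dt.
Qed.

Lemma Lie_diag_eq (T : 'M[k]_n -> Prop) P X i j :
  (forall t, T t -> (P *m t *m invmx P) i i = (P *m t *m invmx P) j j) ->
  Lie T X -> (P *m X *m invmx P) i i = (P *m X *m invmx P) j j.
Proof.
move=> dT /LieP LX; apply/eqP; rewrite -subr_eq0; apply/eqP.
rewrite -(dd_lform _ _ i i 1%:M) -(dd_lform _ _ j j 1%:M) -ddN -ddD LX // => t /dT e.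
by rewrite evB !ev_lform e subrr.
Qed.

End LinearForms.

Section TorusWeights.
Variables (k : closedFieldType) (k_char0 : [pchar k] =i pred0) (n : nat).
Variables (P : 'M[k]_n) (uP : P \in unitmx).

(** The projections onto the coordinate lines of the basis defined by P. *)
Definition pE (i : 'I_n) : 'M[k]_n := invmx P *m delta_mx i i *m P.

Lemma conj_pE i : P *m pE i *m invmx P = delta_mx i i.
Proof. by rewrite /pE !mulmxA mulmxV // mul1mx mulmxK. Qed.

Lemma pE_idem : complete_idem pE.
Proof.
split=> [|i j]; apply: (conj_inj uP).
  rewrite mulmx1 mulmxV // mulmx_sumr mulmx_suml; apply/matrixP => a b.
  rewrite summxE (bigD1 a) //= conj_pE big1 ?addr0 => [|c nca].
    by rewrite !mxE eqxx eq_sym.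
  by rewrite conj_pE !mxE eq_sym (negPf nca).
rewrite conjM // !conj_pE; case: eqP => [->|/eqP nij].
  by rewrite mul_delta_mx conj_pE.
by rewrite mul_delta_mx_0 // mulmx0 mul0mx.
Qed.

(** The diagonal entries in the basis defined by P; on T they are the weights of T on k^n. *)
Definition dg (A : 'M[k]_n) i : k := (P *m A *m invmx P) i i.

Lemma dgM A B i : diag_for P A -> diag_for P B -> dg (A *m B) i = dg A i * dg B i.
Proof.
rewrite /dg conjM // => /diag_mxP[a ->] /diag_mxP[b ->].
by rewrite mul_diag_mx !mxE eqxx !mulr1n.
Qed.

Lemma dg1 i : dg 1%:M i = 1.
Proof. by rewrite /dg mulmx1 mulmxV // mxE eqxx. Qed.

Lemma dg_sum (I : Type) (s : seq I) (c : I -> k) (F : I -> 'M[k]_n) i :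
  dg (\sum_(l <- s) c l *: F l) i = \sum_(l <- s) c l * dg (F l) i.
Proof.
rewrite /dg mulmx_sumr mulmx_suml summxE; apply: eq_bigr => l _.
by rewrite -scalemxAr -scalemxAl mxE.
Qed.

Lemma dg_pE_sum (c : 'I_n -> k) i : dg (\sum_j c j *: pE j) i = c i.
Proof.
rewrite dg_sum (bigD1 i) //= /dg conj_pE mxE !eqxx mulr1 big1 ?addr0 // => j nj.
by rewrite conj_pE mxE eq_sym (negPf nj) mulr0.
Qed.

Lemma dg_cogen h i : dg (cogen pE h) i = (h i)%:~R.
Proof. exact: dg_pE_sum. Qed.

Lemma dg_cochar h x i : dg (cochar pE h x) i = x ^ h i.
Proof. exact: dg_pE_sum. Qed.

Lemma diag_for_pE_sum (c : 'I_n -> k) : diag_for P (\sum_j c j *: pE j).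
Proof.
apply: diag_for_sum => j; apply: diag_forZ; apply/diag_forP => a b nab.
by rewrite conj_pE mxE; case: andP => // -[/eqP ea /eqP eb]; rewrite ea eb eqxx in nab.
Qed.

Lemma dg_inj A B : diag_for P A -> diag_for P B -> (forall i, dg A i = dg B i) -> A = B.
Proof.
move=> /diag_forP dA /diag_forP dB H; apply: (conj_inj uP); apply/matrixP => i j.
by have [->|nij] := eqVneq i j; [apply: H|rewrite dA ?dB].
Qed.

Lemma conj_commute_entries A t : diag_for P t -> A *m t = t *m A -> forall i j,
  (P *m A *m invmx P) i j != 0 -> dg t i = dg t j.
Proof.
move=> dt cA i j nA.
have : P *m (A *m t) *m invmx P = P *m (t *m A) *m invmx P by rewrite cA.
rewrite !conjM // /dg; have /diag_mxP[d ->] := dt; rewrite mul_diag_mx mul_mx_diag.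
move: (P *m A *m invmx P) nA => B nA /matrixP/(_ i j); rewrite !mxE !eqxx !mulr1n mulrC => /eqP.
by rewrite -subr_eq0 -mulrBl mulf_eq0 (negPf nA) orbF subr_eq0 => /eqP->.
Qed.

Lemma entries_commute A t : diag_for P t ->
  (forall i j, (P *m A *m invmx P) i j != 0 -> dg t i = dg t j) -> A *m t = t *m A.
Proof.
move=> dt H; apply: (conj_inj uP); rewrite !conjM //.
have := H; rewrite /dg; have /diag_mxP[d ->] := dt; rewrite mul_diag_mx mul_mx_diag.
move: (P *m A *m invmx P) => B {}H; apply/matrixP => i j; rewrite !mxE mulrC.
have [->|/H] := eqVneq (B i j) 0; first by rewrite !mulr0.
by rewrite !mxE !eqxx !mulr1n => ->.
Qed.

Variables (T : 'M[k]_n -> Prop) (algT : alg_group T) (connT : zconnected T).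
Hypothesis dT : forall t, T t -> diag_for P t.

Lemma dg_neq0 t i : T t -> dg t i != 0.
Proof.
move=> Tt; have tV := alg_groupV algT Tt; apply/eqP => d0.
have := dg1 i; rewrite -(mulmxV (alg_group_unit algT Tt)) dgM ?dT // d0 mul0r => /esym/eqP.
by rewrite oner_eq0.
Qed.

(** Expresses, through its derivative, that the cocharacter with exponents h lies in T. *)
Definition integral_Lie (h : 'I_n -> int) : Prop := Lie T (cogen pE h).

(** The nilpotent part of an element of Lie T vanishes because Lie T is diagonalizable, and the
    rational parts of the semisimple part have integer entries in the eigenbasis of T. *)
Lemma Lie_torus_span X : Lie T X -> exists (r : nat) (b : 'I_r -> k) (h : 'I_r -> 'I_n -> int),
  (forall l, integral_Lie (h l)) /\ X = \sum_l b l *: cogen pE (h l).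
Proof.
move=> LX; have [s [r [E [h [b []]]]]] := Lie_rational_parts k_char0 algT LX.
set Xs := \sum_l _ => -[[sumE orthE] b_free] cE LE XsE [N [HN HNa]].
have dL Y : Lie T Y -> diag_for P Y by apply: Lie_diag.
have defX : X = Xs.
  apply/eqP; rewrite -subr_eq0; apply/eqP; apply: (diag_for_nilpotent uP _ HN).
  rewrite addrC -scaleN1r; apply: diag_for_linear; last exact: dL.
  by apply: diag_for_sum => l; apply/diag_forZ/dL.
(* Row i of P is an eigenvector of the rational part; its image under some [E a] is nonzero, and
   there the eigenvalue is the integer [h a l]. *)
have int_entry l i : exists z : int, dg (cogen E (fun a => h a l)) i = z%:~R.
  set L := cogen _ _; have dLL := dL _ (LE l).
  have rowL : row i P *m L = dg L i *: row i P.
    have : P *m L = (P *m L *m invmx P) *m P by rewrite mulmxKV.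
    rewrite /dg; have /diag_mxP[d ->] := dLL; rewrite mul_diag_mx => /(congr1 (row i)).
    rewrite row_mul => ->; apply/rowP => j; rewrite !mxE eqxx mulr1n.
    by [].
  have [a na] : exists a, row i P *m E a != 0.
    apply: NNPP => no; have P0 : row i P = 0.
      rewrite -[LHS]mulmx1 -sumE mulmx_sumr big1 // => a _; apply/eqP/negPn/negP => na.
      by apply: no; exists a.
    have : row i P *m invmx P = 0 by rewrite P0 mul0mx.
    rewrite -row_mul mulmxV // => /rowP/(_ i); rewrite !mxE eqxx => /eqP.
    by rewrite oner_eq0.
  exists (h a l).
  have LEa : L *m E a = (h a l)%:~R *: E a by apply: cogen_mul.
  have ELa : E a *m L = (h a l)%:~R *: E a.
    rewrite /L /cogen mulmx_sumr (bigD1 a) //= big1 ?addr0 => [|c nca].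
      by rewrite -scalemxAr orthE eqxx.
    by rewrite -scalemxAr orthE eq_sym (negPf nca) scaler0.
  have : (row i P *m E a) *m L = dg L i *: (row i P *m E a).
    by rewrite -mulmxA ELa -LEa mulmxA rowL -scalemxAl.
  rewrite -mulmxA ELa -scalemxAr => /eqP; rewrite -subr_eq0 -scalerBl scaler_eq0 (negPf na).
  by rewrite orbF subr_eq0 => /eqP.
have choice l : exists g : 'I_n -> int, forall i, dg (cogen E (fun a => h a l)) i = (g i)%:~R.
  exact: (fin_all_exists (int_entry l)).
have [g Hg] := fin_all_exists choice.
have cg l : cogen pE (g l) = cogen E (fun a => h a l).
  apply: dg_inj => [||i]; [exact: diag_for_pE_sum|exact/dL/LE|by rewrite dg_cogen Hg].
exists r, b, g; split=> [l|]; first by rewrite /integral_Lie cg.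
by rewrite defX; apply: eq_bigr => l _; rewrite cg.
Qed.

(** The Laurent monomial in the weights with exponents e; along the cocharacter of exponents h it is
    the power of x given by [pairing e h]. *)
Definition mono (e : 'I_n -> int) (t : 'M[k]_n) : k := \prod_i dg t i ^ e i.

Definition pairing (e h : 'I_n -> int) : int := \sum_i e i * h i.

Lemma mono_cochar e h x : x != 0 -> mono e (cochar pE h x) = x ^ pairing e h.
Proof.
move=> nx; rewrite /mono /pairing.
rewrite (big_morph (fun z => x ^ z) (fun a b => expfzDr a b nx) (expr0z x)).
by apply: eq_bigr => i _; rewrite dg_cochar exprz_exp mulrC.
Qed.

(** Split e into its positive and negative parts. The two monomials have the same eigenvalue under
    each element of Lie T, which is spanned by derivatives of cocharacters; their difference
    vanishes at 1, hence on T. *)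
Lemma mono_trivial e : (forall h, integral_Lie h -> pairing e h = 0) ->
  forall t, T t -> mono e t = 1.
Proof.
move=> He.
pose ep i := if (0 <= e i) then `|e i|%N else 0%N.
pose en i := if (0 <= e i) then 0%N else `|e i|%N.
have eE i : e i = (ep i)%:Z - (en i)%:Z.
  rewrite /ep /en; case: ifP => [/gez0_abs->|/negbT]; first by rewrite subr0.
  by rewrite -ltNge => /ltz0_abs ->; rewrite sub0r opprK.
pose x i := lform P (invmx P) i i.
have evx i A : ev A (x i) = dg A i by apply: ev_lform.
pose mon (m : 'I_n -> nat) := \prod_i x i ^+ m i.
pose eig X f c := forall t, T t -> dd f t (t *m X) = c * ev t f.
have eigM X f g c d : eig X f c -> eig X g d -> eig X (f * g) (c + d).
  move=> Hf Hg t Tt; rewrite ddM evM Hf // Hg //; ring.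
have eig1 X : eig X 1 0 by move=> t _; rewrite -mpolyC1 ddC mul0r.
have eigx X i : Lie T X -> eig X (x i) (dg X i).
  move=> LX t Tt; rewrite dd_lform // evx -/(dg (t *m X) i) dgM ?(dT Tt) //; first exact: mulrC.
  exact: (Lie_diag k_char0 dT LX).
have eig_mon X m : Lie T X -> eig X (mon m) (\sum_i (m i)%:R * dg X i).
  move=> LX; rewrite /mon; elim/big_ind2: _ => // [f c g d|i _]; first exact: eigM.
  elim: (m i) => [|j IH]; first by rewrite expr0 mul0r.
  by rewrite exprS -add1n natrD mulrDl mul1r; apply: eigM => //; apply: eigx.
have sumX X : Lie T X -> \sum_i (ep i)%:R * dg X i = \sum_i (en i)%:R * dg X i.
  move=> /Lie_torus_span[r [b [h [Hh ->]]]].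
  apply/eqP; rewrite -subr_eq0 -sumrB; apply/eqP.
  transitivity (\sum_l b l * (pairing e (h l))%:~R); last first.
    by rewrite big1 // => l _; rewrite He ?mulr0.
  rewrite (eq_bigr (fun i => \sum_l b l * ((e i)%:~R * (h l i)%:~R))) => [|i _]; last first.
    rewrite dg_sum -mulrBl mulr_sumr; apply: eq_bigr => l _.
    by rewrite dg_cogen mulrCA eE rmorphB.
  rewrite exchange_big; apply: eq_bigr => l _ /=; rewrite -mulr_sumr; congr (_ * _).
  by rewrite rmorph_sum; apply: eq_bigr => i _; rewrite rmorphM.
pose q := mon ep - mon en.
have Iq : vanish T q.
  apply: (@Lie_vanishing _ k_char0 _ _ algT connT (fun f => exists c, f = c *: q)).
  - move=> _ [c ->]; rewrite evZ /q evB /mon.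
    have ev1m m : ev 1%:M (mon m) = 1.
      rewrite rmorph_prod big1 //= => i _; rewrite evXn evx dg1 expr1n //.
    by rewrite !ev1m subrr mulr0.
  - move=> X _ LX [c ->]; exists (((\sum_i (ep i)%:R * dg X i) * c) *: q); first by eexists.
    move=> t Tt; rewrite ddZ evZ /q ddD ddN (eig_mon _ _ LX) // (eig_mon _ _ LX) //.
    by rewrite -(sumX X LX) evB; ring.
  - by exists 1; rewrite scale1r.
move=> t Tt; have := Iq t Tt; rewrite /q evB => /eqP; rewrite subr_eq0 => /eqP.
rewrite !rmorph_prod /=; under eq_bigr do rewrite evXn evx.
under [RHS]eq_bigr do rewrite evXn evx.
move=> E; rewrite /mono; under eq_bigr => i _ do
  rewrite eE expfzDr ?dg_neq0 // -exprnP -invr_expz -exprnP.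
rewrite prodf_div E divff // prodf_seq_neq0; apply/allP => i _ /=.
by rewrite expf_neq0 // dg_neq0.
Qed.

Lemma generic_cochar (es : seq ('I_n -> int)) :
  (forall e, List.In e es -> exists2 t, T t & mono e t <> 1) ->
  exists2 h, integral_Lie h & forall e, List.In e es -> pairing e h <> 0.
Proof.
elim: es => [|e es IH] H.
  exists (fun=> 0); last by move=> e [].
  rewrite /integral_Lie /cogen big1 => [|i _]; first exact: Lie0.
  by rewrite scale0r.
have [|h Lh Hh] := IH; first by move=> e' e's; apply: H; right.
have [h' Lh' Hh'] : exists2 h', integral_Lie h' & pairing e h' <> 0.
  apply: NNPP => no; have [t Tt] := H e (or_introl erefl); apply.
  apply: mono_trivial => // h' Lh'; apply: NNPP => ne; apply: no.
  by exists h'.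
(* M exceeds the absolute value of every pairing with h', so the two terms of the pairing with M h +
   h' cannot cancel. *)
pose M : nat := (\sum_(e' <- e :: es) `|pairing e' h'|).+1.
pose g i := M%:Z * h i + h' i.
have pg e' : pairing e' g = M%:Z * pairing e' h + pairing e' h'.
  rewrite /pairing mulr_sumr -big_split /=; apply: eq_bigr => i _.
  by rewrite /g mulrDr mulrCA.
have bound e' : List.In e' (e :: es) -> (`|pairing e' h'| < M)%N.
  rewrite /M ltnS; elim: (e :: es) => //= a l IHl [->|/IHl le]; rewrite big_cons.
    exact: leq_addr.
  by rewrite (leq_trans le) // leq_addl.
have nz e' : List.In e' (e :: es) -> pairing e' h <> 0 \/ pairing e' h' <> 0 ->
    pairing e' g <> 0.
  move=> e's nz; rewrite pg; move: (bound e' e's) nz.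
  set u := pairing e' h; set v := pairing e' h' => ltM nz E.
  have Ev : v = - (M%:Z * u) by rewrite -[LHS](addKr (M%:Z * u)) E addr0.
  move: ltM; rewrite Ev abszN abszM /= => ltM.
  have u0 : u = 0.
    apply/eqP; rewrite -absz_eq0 -leqn0 leqNgt; apply/negP => lt0.
    by have := leq_pmulr M lt0; rewrite leqNgt ltM.
  by case: nz => //; apply; rewrite Ev u0 mulr0 oppr0.
exists g => [|e' e's].
  rewrite /integral_Lie; have -> : cogen pE g = M%:R *: cogen pE h + cogen pE h'.
    rewrite /cogen scaler_sumr -big_split /=; apply: eq_bigr => i _.
    by rewrite scalerA -scalerDl /g rmorphD rmorphM.
  exact: Lie_linear.
apply: (nz) => //; case: e's => [<-|/Hh]; [by right|by left].
Qed.

End TorusWeights.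

Section Adjoint.
Variables (k : fieldType) (n : nat).
Implicit Types (A X Y : 'M[k]_n).

Definition adm A X : 'M[k]_n := A *m X - X *m A.

Lemma adm_is_linear A : linear (adm A).
Proof.
move=> c X Y; rewrite /adm mulmxDl mulmxDr -scalemxAl -scalemxAr opprD addrACA.
by rewrite scalerBr.
Qed.

HB.instance Definition _ A :=
  GRing.isLinear.Build k 'M[k]_n 'M[k]_n _ (adm A) (adm_is_linear A).

End Adjoint.

(** * The grading by a cocharacter, and regular cocharacters *)

Section Grading.
Variables (k : closedFieldType) (k_char0 : [pchar k] =i pred0) (n : nat).
Variables (P : 'M[k]_n) (uP : P \in unitmx) (h : 'I_n -> int).
Implicit Types (X Y : 'M[k]_n).

(** The component of Y of degree d for the grading in which the entry (i, j) has degree [h i - h j];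
    it is an eigencomponent of the bracket with [cogen (pE P) h]. *)
Definition gcomp (d : int) Y : 'M[k]_n :=
  invmx P *m (\matrix_(i, j) if h i - h j == d then (P *m Y *m invmx P) i j else 0) *m P.

Lemma conj_gcomp d Y i j : (P *m gcomp d Y *m invmx P) i j =
  if h i - h j == d then (P *m Y *m invmx P) i j else 0.
Proof.
rewrite /gcomp -!mulmxA mulmxV // mulmx1 mulKVmx // mxE.
by rewrite !mulmxA.
Qed.

Lemma conj_cogen : P *m cogen (pE P) h *m invmx P = diag_mx (\row_i (h i)%:~R).
Proof.
have /diag_mxP[d E] := diag_for_pE_sum uP (fun i => (h i)%:~R).
rewrite -/(cogen (pE P) h) in E; rewrite E; congr diag_mx; apply/rowP => i.
by rewrite mxE -(dg_cogen uP h i) /dg E !mxE eqxx mulr1n.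
Qed.

Lemma adm_gcomp d Y : adm (cogen (pE P) h) (gcomp d Y) = d%:~R *: gcomp d Y.
Proof.
have HB := conj_gcomp d Y; move: (gcomp d Y) HB => Y1 HB.
apply: (conj_inj uP); rewrite /adm mulmxBr mulmxBl !conjM // conj_cogen.
rewrite mul_diag_mx mul_mx_diag -scalemxAr -scalemxAl.
move: (P *m Y1 *m invmx P) HB => B HB.
apply/matrixP => i j; rewrite !mxE !HB mulrC.
case: eqP => [<-|_]; last by rewrite !(mulr0, mul0r) subr0.
by rewrite intrB -mulrBr mulrC.
Qed.

Lemma gcomp_sum Y : Y = \sum_(d <- undup [seq h x.1 - h x.2 | x : 'I_n * 'I_n]) gcomp d Y.
Proof.
apply: (conj_inj uP); rewrite mulmx_sumr mulmx_suml; apply/matrixP => i j; rewrite summxE.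
rewrite (bigD1_seq (h i - h j)) ?undup_uniq //=; last first.
  by rewrite mem_undup; apply/mapP; exists (i, j); rewrite ?mem_enum.
rewrite conj_gcomp eqxx big1 ?addr0 // => d nd.
by rewrite conj_gcomp eq_sym (negPf nd).
Qed.

Lemma gcomp_stable (W : 'M[k]_n -> Prop) d Y : W 0 ->
  (forall c u v, W u -> W v -> W (c *: u + v)) ->
  (forall v, W v -> W (adm (cogen (pE P) h) v)) -> W Y -> W (gcomp d Y).
Proof.
move=> W0 WL WD WY; set S := undup [seq h x.1 - h x.2 | x : 'I_n * 'I_n].
have [dS|dS] := boolP (d \in S); last first.
  have -> : gcomp d Y = 0; last exact: W0.
  apply: (conj_inj uP); rewrite mulmx0 mul0mx; apply/matrixP => i j.
  rewrite conj_gcomp [RHS]mxE; case: eqP => [e|//]; case/negP: dS.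
  by rewrite mem_undup -e; apply/mapP; exists (i, j); rewrite ?mem_enum.
refine (@split_stable _ _ (adm (cogen (pE P) h)) W W0 WL WD _ S (fun d : int => d%:~R)
  (fun d => gcomp d Y) _ _ _ _ d dS).
- exact: undup_uniq.
- move=> d1 d2 _ _ /eqP; rewrite -subr_eq0 -rmorphB /= => /eqP /(intr_char0_eq0 k_char0)/eqP.
  by rewrite subr_eq0 => /eqP.
- move=> d1 _; exists 1%N.
  change (adm (cogen (pE P) h) (gcomp d1 Y) - d1%:~R *: gcomp d1 Y = 0).
  by rewrite adm_gcomp subrr.
- by rewrite -gcomp_sum.
Qed.

End Grading.

Section Regular.
Variables (k : closedFieldType) (k_char0 : [pchar k] =i pred0) (n : nat).
Variables (P : 'M[k]_n) (uP : P \in unitmx).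
Variables (T : 'M[k]_n -> Prop) (algT : alg_group T) (connT : zconnected T).
Hypothesis dT : forall t, T t -> diag_for P t.

(** Exponents of the quotient of the weights i and j. *)
Definition ediff (i j l : 'I_n) : int := (l == i)%:Z - (l == j)%:Z.

Lemma pairing_delta i (h : 'I_n -> int) : \sum_l (l == i)%:Z * h l = h i.
Proof.
rewrite (bigD1 i) //= eqxx mul1r big1 ?addr0 // => l nl.
by rewrite (negPf nl) mul0r.
Qed.

Lemma pairing_diff i j (h : 'I_n -> int) : pairing (ediff i j) h = h i - h j.
Proof.
rewrite /pairing -[in RHS](pairing_delta i h) -[in RHS](pairing_delta j h) -sumrB.
by apply: eq_bigr => l _; rewrite mulrBl.
Qed.

Lemma mono_add (e e' : 'I_n -> int) t : T t ->
  mono P (fun l => e l + e' l) t = mono P e t * mono P e' t.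
Proof.
move=> Tt; rewrite /mono -big_split /=; apply: eq_bigr => l _.
by rewrite expfzDr // (dg_neq0 uP algT dT).
Qed.

Lemma mono_scale (e : 'I_n -> int) (z : int) t : mono P (fun l => e l * z) t = mono P e t ^ z.
Proof.
have expM (a b : k) : (a * b) ^ z = a ^ z * b ^ z by rewrite expfzMl.
rewrite /mono (big_morph (fun a => a ^ z) expM (exp1rz _ z)).
by apply: eq_bigr => l _; rewrite exprz_exp.
Qed.

Lemma mono_delta i t : mono P (fun l => (l == i)%:Z) t = dg P t i.
Proof.
rewrite /mono (bigD1 i) //= eqxx expr1z big1 ?mulr1 // => l nl.
by rewrite (negPf nl) expr0z.
Qed.

Lemma mono_diff i j t : T t -> mono P (ediff i j) t = dg P t i / dg P t j.
Proof.
move=> Tt; rewrite /ediff.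
rewrite (_ : mono _ _ _ = mono P (fun l => (l == i)%:Z + (l == j)%:Z * -1) t); last first.
  by apply: eq_bigr => l _; rewrite mulrN1.
by rewrite mono_add // mono_scale !mono_delta.
Qed.

Lemma generic_cochar_list (es : seq ('I_n -> int)) :
  exists2 h, integral_Lie P T h & forall e, List.In e es ->
    (exists2 t, T t & mono P e t <> 1) -> pairing e h <> 0.
Proof.
have [es' [H1 H2]] : exists es', (forall e, List.In e es' -> exists2 t, T t & mono P e t <> 1) /\
    forall e, List.In e es -> (exists2 t, T t & mono P e t <> 1) -> List.In e es'.
  elim: es => [|e es [es' [H1 H2]]]; first by exists [::].
  have [ne|te] := classic (exists2 t, T t & mono P e t <> 1).
    exists (e :: es'); split=> [e' /= [<-|/H1]|e' /= [->|/H2 H] ne'] //; [by left|].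
    by right; apply: H.
  exists es'; split=> // e' /= [<- //|/H2]; exact.
have [h Lh Hh] := generic_cochar k_char0 uP algT connT dT H1.
by exists h => // e /H2 H /H/Hh.
Qed.

Lemma cochar_in_torus h x : integral_Lie P T h -> x != 0 -> T (cochar (pE P) h x).
Proof. by move=> Lh nx; apply: (cochar_in k_char0 (pE_idem uP) algT). Qed.

(** A cocharacter on which finitely many nontrivial characters stay nontrivial. Among them are the
    quotients of weights, so it separates the weights as T itself does; [es] adds further
    characters. *)
Lemma regular_cochar (es : seq ('I_n -> int)) : exists h, [/\ integral_Lie P T h,
  forall i j, h i = h j <-> (forall t, T t -> dg P t i = dg P t j)
  & forall e, List.In e es -> (exists2 t, T t & mono P e t <> 1) -> pairing e h <> 0].
Proof.
pose ps := [seq ediff x.1 x.2 | x <- enum {: 'I_n * 'I_n}].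
have [h Lh Hh] := generic_cochar_list (ps ++ es).
have n2 : (2 : k) != 0 by apply: (natr_neq0 k_char0 1).
exists h; split=> // [i j|e ees]; last first.
  by apply: Hh; apply: List.in_or_app; right.
split=> [eh t Tt|H]; last first.
  apply: (exp2z_inj k_char0); rewrite -!(dg_cochar uP); apply: H.
  exact: cochar_in_torus.
apply: NNPP => nd; apply: (Hh (ediff i j)); last by rewrite pairing_diff eh subrr.
  apply: List.in_or_app; left; rewrite /ps.
  have : (i, j) \in enum {: 'I_n * 'I_n} by rewrite mem_enum.
  elim: (enum _) => //= x s IH; rewrite inE => /predU1P[<-|/IH]; [by left|by right].
exists t => //; rewrite mono_diff // => e1; apply: nd.
by rewrite -[LHS](divfK (dg_neq0 uP algT dT j Tt)) e1 mul1r.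
Qed.

End Regular.

Lemma nilpotent_mul (k : fieldType) n (A B : 'M[k]_n) N : A *m B = B *m A -> A ^+ N = 0 ->
  (A *m B) ^+ N = 0.
Proof. by move=> c AN; rewrite -[A *m B]/(A * B) exprMn_comm // AN mul0r. Qed.

(** * The centralizer of T in Lie G *)

Section CentralizerLie.
Variables (k : closedFieldType) (k_char0 : [pchar k] =i pred0) (n : nat).
Variables (G T : 'M[k]_n -> Prop) (algG : alg_group G) (T_max : maximal_torus G T).
Hypothesis trad0_G : forall X, trad G X -> X = 0.
Implicit Types (X Y : 'M[k]_n).

Let algT := max_torus_alg T_max.
Let connT := max_torus_conn T_max.

(** Let Xn be the nilpotent part of X. In its trace against Y only the component Y0 of degree 0
    counts. The semisimple part of Y0 commutes with Xn, so that their product is nilpotent; the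
    nilpotent part Yn is handled by expanding tr((Xn + Yn)^2) = 0. Thus Xn is in the radical of the
    trace form. *)
Theorem centralizer_Lie X : Lie G X -> (forall t, T t -> t *m X = X *m t) -> Lie T X.
Proof.
move=> LX cX; have [P uP dT] := max_torus_diag T_max.
have [h [Lh eqh _]] := regular_cochar k_char0 uP algT connT dT [::].
have TG Y : Lie T Y -> Lie G Y by apply: Lie_mono; apply: max_torus_sub T_max.
have commE Y : (forall t, T t -> t *m Y = Y *m t) <->
    (forall i j, (P *m Y *m invmx P) i j != 0 -> h i = h j).
  split=> [cY i j nY|HY t Tt].
    by apply/eqh => t Tt; apply: (conj_commute_entries uP (dT t Tt) _ nY); rewrite cY.
  apply/esym/(entries_commute uP (dT t Tt)) => i j /HY /eqh; exact.
(* The projection onto the weight space of T containing the i-th eigenvector. Traces against it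
   vanish on nilpotent matrices commuting with T, and on Lie T they detect the i-th diagonal entry
   because its multiplicity is nonzero in k. *)
pose F i := \sum_j (h j == h i)%:R *: pE P j.
have cF i Y : (forall t, T t -> t *m Y = Y *m t) -> F i *m Y = Y *m F i.
  move=> /commE HY; apply/esym/(entries_commute uP); first exact: diag_for_pE_sum.
  by move=> a b /HY e; rewrite !dg_pE_sum // e.
have trN i Y N : (forall t, T t -> t *m Y = Y *m t) -> Y ^+ N = 0 -> \tr (F i *m Y) = 0.
  move=> cY YN; rewrite cF //; apply: (@trace_nilpotent _ _ _ N).
  by apply: nilpotent_mul => //; rewrite cF.
have trF i Y : Lie T Y -> \tr (F i *m Y) = 0 -> dg P Y i = 0.
  move=> LY; have dY := Lie_diag k_char0 dT LY.
  have -> : \tr (F i *m Y) = \sum_j (h j == h i)%:R * dg P Y j.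
    rewrite -[F i *m Y](mulKmx uP) mxtrace_mulC /mxtrace; apply: eq_bigr => j _.
    rewrite -/(dg P (F i *m Y) j) dgM ?dg_pE_sum //; exact: diag_for_pE_sum.
  have dYe j : (h j == h i)%:R * dg P Y j = (h j == h i)%:R * dg P Y i.
    case: eqP => [e|_]; last by rewrite !mul0r.
    congr (_ * _); apply: (Lie_diag_eq k_char0 _ LY); exact: (proj1 (eqh j i) e).
  rewrite (eq_bigr _ (fun j _ => dYe j)) -mulr_suml -natr_sum => /eqP.
  rewrite (bigD1 i) //= eqxx add1n mulf_eq0 (negPf (natr_neq0 k_char0 _)).
  by move/eqP.
(* The semisimple part S of Y + Z lies in Lie T and has trace 0 against every such projection, since
   Y, Z and Y + Z - S are nilpotent; hence S = 0. *)
have nilD Y Z : Lie G Y -> Lie G Z -> (forall t, T t -> t *m Y = Y *m t) ->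
    (forall t, T t -> t *m Z = Z *m t) -> (exists N, Y ^+ N = 0) -> (exists N, Z ^+ N = 0) ->
    exists N, (Y + Z) ^+ N = 0.
  move=> LY LZ cY cZ [N YN] [M ZM].
  have LYZ : Lie G (Y + Z) by rewrite -[Y]scale1r; apply: Lie_linear.
  have cYZ t : T t -> t *m (Y + Z) = (Y + Z) *m t.
    by move=> Tt; rewrite mulmxDr mulmxDl cY ?cZ.
  have [S [LS cS [K SK]]] := max_torus_jordan k_char0 algG T_max LYZ cYZ.
  suff S0 : S = 0 by exists K; rewrite -SK S0 subr0.
  apply: (dg_inj uP (Lie_diag k_char0 dT LS) (diag_for0 P)) => i.
  rewrite [RHS](_ : _ = 0); last by rewrite /dg mulmx0 mul0mx mxE.
  apply: trF => //; have cN t : T t -> t *m (Y + Z - S) = (Y + Z - S) *m t.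
    by move=> Tt; rewrite mulmxBr mulmxBl cYZ ?cS ?cYZ.
  have := trN i _ _ cN SK.
  have -> : F i *m (Y + Z - S) = F i *m Y + F i *m Z - F i *m S.
    by rewrite mulmxBr mulmxDr.
  rewrite [\tr _]linearB [X in X - _]linearD /= (trN i Y N) // (trN i Z M) // addr0 sub0r.
  by move/eqP; rewrite oppr_eq0 => /eqP.
have [Xs [LXs cXs [N XN]]] := max_torus_jordan k_char0 algG T_max LX cX.
suff /eqP : X - Xs = 0 by rewrite subr_eq0 => /eqP->.
set Xn := X - Xs in XN *.
have LXn : Lie G Xn.
  by rewrite /Xn addrC -scaleN1r; apply: Lie_linear => //; apply: TG.
have cXn t : T t -> t *m Xn = Xn *m t.
  by move=> Tt; rewrite mulmxBr mulmxBl cX ?cXs ?cX.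
apply: trad0_G; split=> // Y LY.
pose Y0 := gcomp P h 0 Y.
have LY0 : Lie G Y0.
  apply: (gcomp_stable k_char0 uP) LY; [exact: Lie0|by move=> c u v; apply: Lie_linear|].
  by move=> Z LZ; apply: (LieM_bracket k_char0 algG) => //; apply: TG.
have cY0 : forall t, T t -> t *m Y0 = Y0 *m t.
  apply/commE => i j; rewrite conj_gcomp // subr_eq0.
  by have [//|nh] := eqVneq (h i) (h j); rewrite eqxx.
have -> : \tr (Xn *m Y) = \tr (Xn *m Y0).
  have trE Z : \tr (Xn *m Z) =
      \sum_i \sum_j (P *m Xn *m invmx P) i j * (P *m Z *m invmx P) j i.
    rewrite -[Xn *m Z](mulKmx uP) mxtrace_mulC conjM //.
    by rewrite /mxtrace; apply: eq_bigr => i _; rewrite mxE.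
  rewrite !trE; apply: eq_bigr => i _; apply: eq_bigr => j _.
  rewrite conj_gcomp // subr_eq0 eq_sym.
  have [->|] := eqVneq ((P *m Xn *m invmx P) i j) 0; first by rewrite !mul0r.
  by move/(proj1 (commE Xn) cXn) ->; rewrite eqxx.
have [Ys [LYs cYs [M YM]]] := max_torus_jordan k_char0 algG T_max LY0 cY0.
set Yn := Y0 - Ys in YM.
have LYn : Lie G Yn.
  by rewrite /Yn addrC -scaleN1r; apply: Lie_linear => //; apply: TG.
have cYn t : T t -> t *m Yn = Yn *m t.
  by move=> Tt; rewrite mulmxBr mulmxBl cY0 ?cYs ?cY0.
have -> : Y0 = Ys + Yn by rewrite /Yn addrC subrK.
rewrite mulmxDr linearD /= (@trace_nilpotent _ _ (Xn *m Ys) N) ?add0r; last first.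
  apply: nilpotent_mul => //; apply: (Lie_commute k_char0 _ LYs) => t Tt.
  by rewrite cXn.
have [K SK] : exists K, (Xn + Yn) ^+ K = 0.
  by apply: nilD => //; [exists N|exists M].
have sq (Z : 'M[k]_n) L : Z ^+ L = 0 -> \tr (Z *m Z) = 0.
  by move=> ZL; apply: (@trace_nilpotent _ _ _ L); apply: nilpotent_mul.
have := sq _ _ SK; clear - sq XN YM k_char0; move: Xn Yn XN YM => A B AN BM.
rewrite mulmxDl !mulmxDr.
have trD (C D : 'M[k]_n) : \tr (C + D) = \tr C + \tr D by rewrite linearD.
rewrite !trD (sq _ _ AN) (sq _ _ BM).
rewrite add0r addr0 [\tr (B *m A)]mxtrace_mulC -mulr2n -mulr_natr => /eqP.
by rewrite mulf_eq0 (negPf (natr_neq0 k_char0 1)) orbF => /eqP.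
Qed.

End CentralizerLie.

(** * The centralizer of a maximal torus *)

Section Schur.
Variables (k : fieldType) (n : nat) (Q E : 'M[k]_n).
Hypotheses (QQ : Q *m Q = Q) (EE : E *m E = E) (QE : Q *m E = 0) (EQ : E *m Q = 0).
Implicit Types (B b l v : 'M[k]_n).

(** The block of B on the range of Q, completed by the identity so that it can be inverted as a full
    matrix. *)
Definition corner B : 'M[k]_n := Q *m B *m Q + (1%:M - Q).

(** The Schur complement of the Q-block of B within the block of Q + E, placed on the range of E. *)
Definition schur B : 'M[k]_n := E *m (B - B *m Q *m invmx (corner B) *m Q *m B) *m E.

Lemma mulQ_corner B : Q *m corner B = Q *m B *m Q.
Proof. by rewrite /corner mulmxDr mulmxBr mulmx1 !mulmxA QQ subrr addr0. Qed.

Lemma mul_cornerQ B : corner B *m Q = Q *m B *m Q.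
Proof. by rewrite /corner mulmxDl mulmxBl mul1mx -!mulmxA QQ subrr addr0. Qed.

Section Solve.
Variables (B : 'M[k]_n) (uB : corner B \in unitmx).

(** The solution of Q B w = 0 with E-component E. Describing the Schur complement by this linear
    system turns its behaviour under products into a question of uniqueness. *)
Let w := E - Q *m invmx (corner B) *m Q *m B *m E.

Lemma schurE : schur B = E *m B *m w.
Proof. by rewrite /schur /w mulmxBr !mulmxBl mulmxBr !mulmxA. Qed.

Lemma schur_solution : Q *m B *m w = 0.
Proof.
rewrite /w mulmxBr !mulmxA -(mulmxA Q B) -mulmxA; apply/eqP; rewrite subr_eq0; apply/eqP.
rewrite [X in _ = X](_ : _ = Q *m corner B *m invmx (corner B) *m (Q *m (B *m E))).
  by rewrite mulmxK // !mulmxA QQ.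
by rewrite mulQ_corner !mulmxA.
Qed.

Lemma schur_unique v : v = Q *m v + E *m v -> Q *m B *m v = 0 ->
  E *m B *m v = schur B *m (E *m v).
Proof.
move=> dv Bv; have Qv : Q *m v = - (invmx (corner B) *m (Q *m (B *m (E *m v)))).
  apply: (can_inj (mulKmx uB)); rewrite mulmxN mulKVmx //.
  rewrite [LHS]mulmxA mul_cornerQ -mulmxA; apply/eqP; rewrite -addr_eq0; apply/eqP.
  by rewrite -[RHS]Bv [in RHS]dv mulmxDr !mulmxA.
have wv : w *m (E *m v) = v.
  suff -> : w *m (E *m v) = E *m v + Q *m v by rewrite [RHS]dv addrC.
  rewrite /w mulmxBl mulmxA EE; congr (_ + _).
  by rewrite -[in RHS]QQ -[in RHS]mulmxA Qv mulmxN -!mulmxA (mulmxA E E) EE.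
by rewrite schurE -[RHS]mulmxA wv.
Qed.

Lemma schur_support : Q *m w + E *m w = w /\ E *m w = E.
Proof.
have Ew : E *m w = E by rewrite /w mulmxBr !mulmxA EE EQ !mul0mx subr0.
split=> //; rewrite Ew /w mulmxBr !mulmxA QE QQ sub0r addrC.
by [].
Qed.

End Solve.

Lemma corner_mulr B b : b *m Q = Q *m b *m Q -> corner (B *m b) = corner B *m corner b.
Proof.
move=> bQ; rewrite {3}/corner mulmxDr mulmxBr mulmx1 mul_cornerQ !mulmxA mul_cornerQ.
have -> : Q *m B *m Q *m b *m Q = Q *m (B *m b) *m Q.
  by rewrite -!mulmxA [Q *m (b *m Q)]mulmxA -bQ.
by rewrite /corner; congr (_ + _); rewrite addrAC subrr add0r.
Qed.

Lemma corner_mull B l : Q *m l = Q *m l *m Q -> corner (l *m B) = corner l *m corner B.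
Proof.
move=> Ql; rewrite {2}/corner mulmxDl mulmxBl mul1mx -!mulmxA mulQ_corner !mulmxA.
rewrite -Ql /corner [Q *m (l *m B)]mulmxA; congr (_ + _).
by rewrite addrAC subrr add0r.
Qed.

(** If w solves the linear system of B b, then b w solves that of B, with E-component E b E;
    uniqueness gives the product formula. *)
Lemma schur_mulr B b : corner B \in unitmx -> corner b \in unitmx ->
  b *m Q = Q *m b *m Q -> b *m E = E *m b *m E + Q *m b *m E ->
  schur (B *m b) = schur B *m (E *m b *m E).
Proof.
move=> uB ub bQ bE; have uBb : corner (B *m b) \in unitmx.
  by rewrite corner_mulr // unitmx_mul uB.
set w := E - Q *m invmx (corner (B *m b)) *m Q *m (B *m b) *m E.
have [sw Ew] := schur_support (B *m b); rewrite -/w in sw Ew; rewrite Ew in sw.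
have bw : b *m w = Q *m b *m Q *m w + b *m E by rewrite -{1}sw mulmxDr mulmxA bQ.
have Ebw : E *m (b *m w) = E *m b *m E.
  by rewrite bw mulmxDr !mulmxA EQ !mul0mx add0r.
rewrite (schurE (B *m b)) -/w -Ebw -(schur_unique uB).
- by rewrite !mulmxA.
- rewrite Ebw {1}bw -{2}sw !mulmxDr !mulmxA bE [in RHS]addrAC -[in RHS]addrA.
  by congr (_ + _); rewrite addrC.
- by have := schur_solution uBb; rewrite -/w !mulmxA.
Qed.

(** Left multiplication by l changes neither the equations Q B w = 0 nor, on their solutions, the
    product E B w. *)
Lemma schur_mull B l : corner B \in unitmx -> corner l \in unitmx ->
  Q *m l = Q *m l *m Q -> E *m l = E + E *m l *m Q -> schur (l *m B) = schur B.
Proof.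
move=> uB ul Ql El; have ulB : corner (l *m B) \in unitmx.
  by rewrite corner_mull // unitmx_mul ul.
set w := E - Q *m invmx (corner (l *m B)) *m Q *m (l *m B) *m E.
have [sw Ew] := schur_support (l *m B); rewrite -/w in sw Ew.
have QBw : Q *m B *m w = 0.
  rewrite -[LHS](mulKmx ul) -(mulmxA Q) (mulmxA (corner l)) mul_cornerQ -Ql.
  by have := schur_solution ulB; rewrite -/w -!mulmxA => ->; rewrite !mulmx0.
rewrite (schurE (l *m B)) -/w !mulmxA El !mulmxDl -!mulmxA [Q *m (B *m w)]mulmxA QBw.
rewrite !mulmx0 addr0 mulmxA (schur_unique uB (esym sw) QBw) Ew.
by rewrite /schur -!mulmxA EE.
Qed.

End Schur.

(** * Regular functions on a principal open set *)

Section RegularFunctions.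
Variables (k : fieldType) (n : nat) (w : {mpoly k[n * n]}).
Implicit Types (phi psi : 'M[k]_n -> k) (A : 'M[k]_n).

Definition regular phi : Prop := exists q (m : nat),
  forall A, ev A w != 0 -> ev A q = ev A w ^+ m * phi A.

Definition regular_mx (p q : nat) (Phi : 'M[k]_n -> 'M[k]_(p, q)) : Prop :=
  forall i j, regular (fun A => Phi A i j).

Lemma regular_ext phi psi : (forall A, ev A w != 0 -> phi A = psi A) -> regular phi -> regular psi.
Proof. by move=> e [q [m H]]; exists q, m => A nA; rewrite H // e. Qed.

Lemma regular_ev q : regular (fun A => ev A q).
Proof. by exists q, 0%N => A _; rewrite expr0 mul1r. Qed.

Lemma regular_const c : regular (fun=> c).
Proof. by apply: regular_ext (regular_ev c%:MP) => A _; rewrite evC. Qed.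

Lemma regularM phi psi : regular phi -> regular psi -> regular (fun A => phi A * psi A).
Proof.
move=> [q [m H]] [q' [m' H']]; exists (q * q'), (m + m')%N => A nA.
by rewrite evM H // H' // exprD mulrACA.
Qed.

Lemma regularD phi psi : regular phi -> regular psi -> regular (fun A => phi A + psi A).
Proof.
move=> [q [m H]] [q' [m' H']]; exists (w ^+ m' * q + w ^+ m * q'), (m + m')%N => A nA.
by rewrite evD !evM H // H' // !evXn exprD; ring.
Qed.

Lemma regularN phi : regular phi -> regular (fun A => - phi A).
Proof.
move=> /(regularM (regular_const (- 1))); apply: regular_ext => A _.
by rewrite mulN1r.
Qed.

Lemma regular_sum (I : eqType) (s : seq I) (F : I -> 'M[k]_n -> k) :
  (forall i, i \in s -> regular (F i)) -> regular (fun A => \sum_(i <- s) F i A).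
Proof.
elim: s => [|i s IH] H.
  by apply: regular_ext (regular_const 0) => A _; rewrite big_nil.
have Hs : forall j, j \in s -> regular (F j) by move=> j js; apply: H; rewrite inE js orbT.
by apply: regular_ext (regularD (H i (mem_head i s)) (IH Hs)) => A _; rewrite big_cons.
Qed.

Lemma regular_prod (I : eqType) (s : seq I) (F : I -> 'M[k]_n -> k) :
  (forall i, i \in s -> regular (F i)) -> regular (fun A => \prod_(i <- s) F i A).
Proof.
elim: s => [|i s IH] H.
  by apply: regular_ext (regular_const 1) => A _; rewrite big_nil.
have Hs : forall j, j \in s -> regular (F j) by move=> j js; apply: H; rewrite inE js orbT.
by apply: regular_ext (regularM (H i (mem_head i s)) (IH Hs)) => A _; rewrite big_cons.
Qed.

Lemma regular_det m (Phi : 'M[k]_n -> 'M[k]_m) : regular_mx Phi ->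
  regular (fun A => \det (Phi A)).
Proof.
move=> H; apply: regular_sum => s _; apply: regularM; first exact: regular_const.
by apply: regular_prod => i _; apply: H.
Qed.

Lemma regular_constmx p q (C : 'M[k]_(p, q)) : regular_mx (fun=> C).
Proof. by move=> i j; apply: regular_const. Qed.

Lemma regular_idmx : regular_mx (fun A => A).
Proof.
move=> i j; apply: regular_ext (regular_ev 'X_(mxvec_index i j)) => A _.
by rewrite evX mxvecE.
Qed.

Lemma regular_mulmx p q r (F : 'M[k]_n -> 'M[k]_(p, q)) (H : 'M[k]_n -> 'M[k]_(q, r)) :
  regular_mx F -> regular_mx H -> regular_mx (fun A => F A *m H A).
Proof.
move=> rF rH i j.
apply: (regular_ext (phi := fun A => \sum_l F A i l * H A l j)); first by move=> A _; rewrite mxE.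
by apply: regular_sum => l _; apply: regularM.
Qed.

Lemma regular_addmx p q (F H : 'M[k]_n -> 'M[k]_(p, q)) :
  regular_mx F -> regular_mx H -> regular_mx (fun A => F A + H A).
Proof.
move=> rF rH i j; apply: regular_ext (regularD (rF i j) (rH i j)) => A _.
by rewrite mxE.
Qed.

Lemma regular_oppmx p q (F : 'M[k]_n -> 'M[k]_(p, q)) :
  regular_mx F -> regular_mx (fun A => - F A).
Proof.
move=> rF i j; apply: regular_ext (regularN (rF i j)) => A _.
by rewrite mxE.
Qed.

Lemma regular_summx (I : eqType) (s : seq I) p q (F : I -> 'M[k]_n -> 'M[k]_(p, q)) :
  (forall i, i \in s -> regular_mx (F i)) -> regular_mx (fun A => \sum_(i <- s) F i A).
Proof.
move=> H i j; apply: regular_ext (regular_sum (s := s) (fun l ls => H l ls i j)) => A _.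
by rewrite summxE.
Qed.

Lemma regular_invmx m (F : 'M[k]_n -> 'M[k]_m) : regular_mx F ->
  (forall A, ev A w != 0 -> F A \in unitmx) -> regular (fun A => (\det (F A))^-1) ->
  regular_mx (fun A => invmx (F A)).
Proof.
move=> rF uF rd i j.
apply: (regular_ext (phi := fun A => (\det (F A))^-1 * cofactor (F A) j i)).
  by move=> A nA; rewrite /invmx uF // !mxE.
apply: regularM => //; apply: regularM; first exact: regular_const.
apply: regular_det => a b.
by apply: regular_ext (rF (lift j a) (lift i b)) => A _; rewrite !mxE.
Qed.

Lemma regular_comp (Phi : 'M[k]_n -> 'M[k]_n) p : regular_mx Phi ->
  regular (fun A => ev (Phi A) p).
Proof.
move=> H; elim/mpoly_closed_ind: p => [c|i|p q Hp Hq|p q Hp Hq].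
- by apply: regular_ext (regular_const c) => A _; rewrite evC.
- case/mxvec_indexP: i => i j; apply: regular_ext (H i j) => A _.
  by rewrite evX mxvecE.
- by apply: regular_ext (regularD Hp Hq) => A _; rewrite evD.
- by apply: regular_ext (regularM Hp Hq) => A _; rewrite evM.
Qed.

End RegularFunctions.

Lemma regular1 (k : fieldType) n (phi : 'M[k]_n -> k) : regular 1 phi ->
  exists q, forall A, ev A q = phi A.
Proof.
move=> [q [m H]]; exists q => A; rewrite H ev1 ?expr1n ?mul1r //.
exact: oner_neq0.
Qed.

(** * Block triangular matrices and the block Gauss decomposition *)

Section BlockTriangular.
Variables (k : fieldType) (n : nat) (h : 'I_n -> int).
Implicit Types (A B b l : 'M[k]_n) (d : int).

Definition above d : 'M[k]_n := diag_mx (\row_i (d < h i)%R%:R).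
Definition level d : 'M[k]_n := diag_mx (\row_i (h i == d)%:R).
Definition levels : seq int := undup [seq h i | i : 'I_n].

Lemma mul_above_l d A i j : (above d *m A) i j = (d < h i)%R%:R * A i j.
Proof. by rewrite mul_diag_mx !mxE. Qed.

Lemma mul_above_r d A i j : (A *m above d) i j = A i j * (d < h j)%R%:R.
Proof. by rewrite mul_mx_diag !mxE. Qed.

Lemma mul_level_l d A i j : (level d *m A) i j = (h i == d)%:R * A i j.
Proof. by rewrite mul_diag_mx !mxE. Qed.

Lemma mul_level_r d A i j : (A *m level d) i j = A i j * (h j == d)%:R.
Proof. by rewrite mul_mx_diag !mxE. Qed.

Lemma above_idem d : above d *m above d = above d.
Proof.
apply/matrixP => i j; rewrite mul_above_l [in RHS]mxE [above d i j]mxE mxE.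
by case: (d < h i); rewrite ?mul1r // mul0r mul0rn.
Qed.

Lemma level_idem d : level d *m level d = level d.
Proof.
apply/matrixP => i j; rewrite mul_level_l [in RHS]mxE [level d i j]mxE mxE.
by case: (h i == d); rewrite ?mul1r // mul0r mul0rn.
Qed.

Lemma above_level d : above d *m level d = 0.
Proof.
apply/matrixP => i j; rewrite mul_above_l [in RHS]mxE [level d i j]mxE mxE.
by case: eqP => [->|_]; rewrite ?ltxx ?mul0r // mul0rn mulr0.
Qed.

Lemma level_above d : level d *m above d = 0.
Proof.
apply/matrixP => i j; rewrite mul_level_l [in RHS]mxE [above d i j]mxE mxE.
by case: eqP => [->|_]; rewrite ?ltxx ?mul0r // mul0rn mulr0.
Qed.

Lemma sum_level : \sum_(d <- levels) level d = 1%:M.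
Proof.
apply/matrixP => i j; rewrite summxE (bigD1_seq (h i)) ?undup_uniq //=; last first.
  by rewrite mem_undup; apply/mapP; exists i; rewrite ?mem_enum.
rewrite big1 => [|d nd]; first by rewrite !mxE eqxx addr0.
by rewrite mxE mxE eq_sym (negPf nd) mul0rn.
Qed.

(** Upper and lower refer to the indices ordered by decreasing h. *)
Definition block_upper b : Prop := forall i j, (h i < h j)%O -> b i j = 0.
Definition block_unilower l : Prop := forall i j, (h j <= h i)%O -> l i j = (i == j)%:R.

Lemma upper_above b d : block_upper b -> b *m above d = above d *m b *m above d.
Proof.
move=> ub; apply/matrixP => i j; rewrite !mul_above_r mul_above_l.
have [hij|hij] := ltP (h i) (h j); first by rewrite ub // mulr0 !mul0r.
by have [dj|//] := ltP d (h j); rewrite ?mulr0 // (lt_le_trans dj hij) mul1r.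
Qed.

Lemma upper_level b d : block_upper b ->
  b *m level d = level d *m b *m level d + above d *m b *m level d.
Proof.
move=> ub; apply/matrixP => i j.
rewrite [RHS]mxE !mul_level_r mul_above_l mul_level_l -mulrDl -mulrDl.
have [hij|hij] := ltP (h i) (h j); first by rewrite ub // mulr0 !mul0r.
case: eqP => [<-|_]; rewrite ?mulr0 // !mulr1.
by move: hij; rewrite le_eqVlt eq_sym; case: eqP => [->|_] /= hij; rewrite ?ltxx ?hij ?addr0 ?add0r mul1r.
Qed.

Lemma lower_above l d : block_unilower l -> above d *m l = above d *m l *m above d.
Proof.
move=> ul; apply/matrixP => i j; rewrite mul_above_r mul_above_l.
have [dj|jd] := ltP d (h j); first by rewrite mulr1.
have [di|] := ltP d (h i); last by rewrite !mul0r.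
rewrite ul; last exact: ltW (le_lt_trans jd di).
by case: eqP => [e|_]; rewrite ?mulr0 //; move: jd; rewrite -e leNgt di.
Qed.

Lemma lower_level l d : block_unilower l ->
  level d *m l = level d + level d *m l *m above d.
Proof.
move=> ul; apply/matrixP => i j.
rewrite mul_level_l [RHS]mxE mul_above_r mul_level_l.
have -> : level d i j = (h i == d)%:R *+ (i == j) by rewrite !mxE.
case: eqP => [<-|_]; last by rewrite !mul0r mul0rn addr0.
have [hij|hij] := ltP (h i) (h j); last by rewrite ul // mulr0 addr0 mul1r.
by case: eqP => [e|_]; [move: hij; rewrite e ltxx | rewrite mulr1 add0r].
Qed.

End BlockTriangular.

Section BlockDiagonalPart.
Variables (k : closedFieldType) (k_char0 : [pchar k] =i pred0) (n : nat).
Variables (P : 'M[k]_n) (uP : P \in unitmx) (h : 'I_n -> int).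
Implicit Types (A b l X : 'M[k]_n) (d : int).

Local Notation cj A := (P *m A *m invmx P).

Definition lcorner d A : 'M[k]_n := corner (above k h d) (cj A).

(** The product of the block principal minors; the block diagonal part below is meaningful only
    where it does not vanish. *)
Definition corner_prod A : k := \prod_(d <- levels h) \det (lcorner d A).

(** The block diagonal factor in a factorization of A as unipotent lower, block diagonal, unipotent
    upper; its blocks are Schur complements. *)
Definition block_diag_part A : 'M[k]_n :=
  invmx P *m (\sum_(d <- levels h) schur (above k h d) (level k h d) (cj A)) *m P.

Lemma conj_block_diag_part A : cj (block_diag_part A) =
  \sum_(d <- levels h) schur (above k h d) (level k h d) (cj A).
Proof. by rewrite /block_diag_part -!mulmxA mulmxV // mulmx1 mulKVmx. Qed.

Lemma lcorner_unit d A : corner_prod A != 0 -> d \in levels h -> lcorner d A \in unitmx.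
Proof.
move=> nA dS; rewrite unitmxE unitfE; apply: contraNneq nA => e.
by rewrite /corner_prod (bigD1_seq d) ?undup_uniq //= e mul0r.
Qed.

Lemma corner1 d : corner (above k h d) 1%:M = 1%:M.
Proof. by rewrite /corner mulmx1 above_idem addrC subrK. Qed.

Lemma lcorner1 d : lcorner d 1%:M = 1%:M.
Proof. by rewrite /lcorner mulmx1 mulmxV // corner1. Qed.

Lemma corner_prod1 : corner_prod 1%:M = 1.
Proof. by rewrite /corner_prod big1 // => d _; rewrite lcorner1 det1. Qed.

Lemma block_diag_part1 : block_diag_part 1%:M = 1%:M.
Proof.
rewrite /block_diag_part mulmx1 mulmxV // -[RHS](mulVmx uP) -[in RHS](mulmx1 (invmx P)).
congr (_ *m _ *m _); rewrite -[RHS](sum_level k h); apply: eq_bigr => d _.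
rewrite /schur mulmx1 mul1mx mulmxBr mulmx1 !mulmxA level_above !mul0mx subr0.
exact: level_idem.
Qed.

Lemma corner_prod_mulr A b : block_upper h (cj b) ->
  corner_prod (A *m b) = corner_prod A * corner_prod b.
Proof.
move=> ub; rewrite /corner_prod -big_split /=; apply: eq_bigr => d _.
by rewrite /lcorner conjM // corner_mulr ?det_mulmx ?above_idem //; apply: upper_above.
Qed.

Lemma corner_prod_mull l A : block_unilower h (cj l) ->
  corner_prod (l *m A) = corner_prod l * corner_prod A.
Proof.
move=> ul; rewrite /corner_prod -big_split /=; apply: eq_bigr => d _.
by rewrite /lcorner conjM // corner_mull ?det_mulmx ?above_idem //; apply: lower_above.
Qed.

Lemma block_diag_part_mulr A b b0 : corner_prod A != 0 -> corner_prod b != 0 ->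
  block_upper h (cj b) ->
  (forall i j, (cj b0) i j = if h i == h j then (cj b) i j else 0) ->
  block_diag_part (A *m b) = block_diag_part A *m b0.
Proof.
move=> nA nb ub Hb0; apply: (conj_inj uP); rewrite !conj_block_diag_part [RHS](conjM uP) conj_block_diag_part.
rewrite mulmx_suml [LHS]big_seq [RHS]big_seq; apply: eq_bigr => d dS.
rewrite conjM // schur_mulr ?above_idem ?level_idem ?above_level ?level_above //.
- have sE : schur (above k h d) (level k h d) (cj A) =
      schur (above k h d) (level k h d) (cj A) *m level k h d.
    by rewrite /schur -[RHS]mulmxA level_idem.
  rewrite [in RHS]sE -[RHS]mulmxA; congr (_ *m _); apply/matrixP => i j.
  rewrite mul_level_r !mul_level_l Hb0.
  have [->|] := eqVneq (h i) d; last by rewrite !mul0r.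
  by rewrite !mul1r eq_sym; case: eqP => _; rewrite ?mulr1 ?mulr0.
- exact: lcorner_unit.
- exact: lcorner_unit.
- exact: upper_above.
- exact: upper_level.
Qed.

Lemma block_diag_part_mull l A : corner_prod A != 0 -> corner_prod l != 0 ->
  block_unilower h (cj l) -> block_diag_part (l *m A) = block_diag_part A.
Proof.
move=> nA nl ul; rewrite /block_diag_part; congr (_ *m _ *m _).
rewrite [LHS]big_seq [RHS]big_seq; apply: eq_bigr => d dS.
rewrite conjM // schur_mull ?above_idem ?level_idem ?above_level ?level_above //.
- exact: lcorner_unit.
- exact: lcorner_unit.
- exact: lower_above.
- exact: lower_level.
Qed.

Lemma block_diag_part_id c : corner_prod c != 0 ->
  (forall i j, h i != h j -> (cj c) i j = 0) -> block_diag_part c = c.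
Proof.
move=> nc Hc; rewrite -{1}[c]mul1mx (block_diag_part_mulr (b0 := c)) //.
- by rewrite block_diag_part1 mul1mx.
- by rewrite corner_prod1 oner_neq0.
- by move=> i j hij; apply: Hc; rewrite lt_eqF.
- by move=> i j; case: eqP => // /eqP /Hc.
Qed.

Lemma regular_cj w : regular_mx w (fun A => cj A).
Proof.
apply: regular_mulmx; last exact: regular_constmx.
by apply: regular_mulmx; [apply: regular_constmx | apply: regular_idmx].
Qed.

Lemma regular_lcorner w d : regular_mx w (lcorner d).
Proof.
apply: regular_addmx; last exact: regular_constmx.
apply: regular_mulmx; last exact: regular_constmx.
by apply: regular_mulmx; [apply: regular_constmx | apply: regular_cj].
Qed.

Lemma corner_prod_poly : exists w, forall A, ev A w = corner_prod A.
Proof.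
by apply: regular1; apply: regular_prod => d _; apply: regular_det; apply: regular_lcorner.
Qed.

Lemma block_diag_part_regular w : (forall A, ev A w = corner_prod A) ->
  regular_mx w block_diag_part.
Proof.
move=> Ew; apply: regular_mulmx; last exact: regular_constmx.
apply: regular_mulmx; first exact: regular_constmx.
apply: regular_summx => d dS.
apply: regular_mulmx; last exact: regular_constmx.
apply: regular_mulmx; first exact: regular_constmx.
apply: regular_addmx; first exact: regular_cj.
apply: regular_oppmx; apply: regular_mulmx; last exact: regular_cj.
apply: regular_mulmx; last exact: regular_constmx.
apply: regular_mulmx; first by apply: regular_mulmx; [apply: regular_cj | apply: regular_constmx].
apply: regular_invmx; first exact: regular_lcorner.
  by move=> A; rewrite Ew => /lcorner_unit; apply.
(* The determinant of one corner divides [corner_prod], with the product of the others as quotient;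
   so its inverse has denominator w. *)
have [q Hq] : exists q, forall A, ev A q = \prod_(e <- levels h | e != d) \det (lcorner e A).
  apply: regular1; apply: regular_ext.
    by move=> A _; rewrite -big_filter.
  by apply: regular_prod => e _; apply: regular_det; apply: regular_lcorner.
exists q, 1%N => A nA; rewrite expr1 Ew /corner_prod (bigD1_seq d) ?undup_uniq //= Hq.
have /lcorner_unit/(_ dS) : corner_prod A != 0 by rewrite -Ew.
by rewrite unitmxE unitfE => nd; rewrite mulrAC mulfV // mul1r.
Qed.

Section Derivative.
Variables (w f p : {mpoly k[n * n]}) (m : nat).
Hypothesis Ew : forall A, ev A w = corner_prod A.
Hypothesis Ef : forall A, ev A w != 0 -> ev A f = ev A w ^+ m * ev (block_diag_part A) p.

Let ev1w : ev 1%:M w = 1. Proof. by rewrite Ew corner_prod1. Qed.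

Let wline_neq0 X : pcurve w (line 1%:M X) != 0.
Proof.
apply/eqP => e; have := horner_pline w 1%:M X 0.
by rewrite e horner0 scale0r addr0 ev1w => /esym/eqP; rewrite oner_eq0.
Qed.

Let derivE (W f' p' : {poly k}) a : f' = a%:P * (W ^+ m * p') -> W.[0] = 1 ->
  f'^`().[0] = a * ((m%:R * W^`().[0]) * p'.[0] + p'^`().[0]).
Proof.
move=> -> W0; rewrite derivM derivC mul0r add0r derivM deriv_exp.
rewrite !(hornerM, hornerD, hornerC, hornerMn, horner_exp) W0 !expr1n !mul1r.
by rewrite mulr_natl mulr1.
Qed.

Let idD_entry t (Y : 'M[k]_n) i j : (1%:M + t *: Y) i j = (i == j)%:R + t * Y i j.
Proof. by rewrite !mxE. Qed.

(** Along the curve A (1 + t X) the block diagonal part is multiplied on the right by that of 1 + t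
    X, and w by its value at 1 + t X; differentiating the factor [w ^+ m] gives the multiple of
    p. *)
Lemma dd_block_mulr A X X0 : ev A w != 0 -> block_upper h (cj X) ->
  (forall i j, (cj X0) i j = if h i == h j then (cj X) i j else 0) ->
  dd f A (A *m X) =
  ev A w ^+ m * ev (block_diag_part A) ((m%:R * dd w 1%:M X) *: p + Dr X0 p).
Proof.
move=> nA uX HX0; rewrite evD evZ ev_Dr !dd_line.
set W := pcurve w (line 1%:M X).
have W0 : W.[0] = 1 by rewrite horner_pline scale0r addr0.
set p' := pcurve p _.
have p'0 : p'.[0] = ev (block_diag_part A) p by rewrite horner_pline scale0r addr0.
suff fE : pcurve f (line A (A *m X)) = (ev A w ^+ m)%:P * (W ^+ m * p').
  by rewrite -p'0; apply: derivE fE W0.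
apply: (poly_eq_evals k_char0 (wline_neq0 X)) => t; rewrite !hornerM hornerC horner_exp !horner_pline.
have lE (B Y : 'M[k]_n) : B + t *: (B *m Y) = B *m (1%:M + t *: Y).
  by rewrite mulmxDr mulmx1 scalemxAr.
rewrite !lE => nt.
have cjE Y : cj (1%:M + t *: Y) = 1%:M + t *: cj Y.
  by rewrite mulmxDr mulmxDl mulmx1 mulmxV // -scalemxAr -scalemxAl.
have ub : block_upper h (cj (1%:M + t *: X)).
  move=> i j hij; rewrite cjE idD_entry uX // mulr0 addr0.
  by case: eqP hij => // ->; rewrite ltxx.
have wb : ev (A *m (1%:M + t *: X)) w = ev A w * ev (1%:M + t *: X) w.
  by rewrite !Ew corner_prod_mulr.
rewrite Ef wb ?mulf_neq0 // exprMn mulrA; congr (_ * ev _ p).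
rewrite Ew in nA; rewrite Ew in nt; apply: block_diag_part_mulr => // i j.
rewrite !cjE !idD_entry HX0; case: (h i =P h j) => // hij; rewrite mulr0 addr0.
by case: eqP => // e; case: hij; rewrite e.
Qed.

Lemma dd_block_mull A X : ev A w != 0 -> (forall i j, (h j <= h i)%O -> (cj X) i j = 0) ->
  dd f A (X *m A) = ev A w ^+ m * ev (block_diag_part A) ((m%:R * dd w 1%:M X) *: p).
Proof.
move=> nA lX; rewrite evZ !dd_line.
set W := pcurve w (line 1%:M X).
have W0 : W.[0] = 1 by rewrite horner_pline scale0r addr0.
suff fE : pcurve f (line A (X *m A)) =
    (ev A w ^+ m)%:P * (W ^+ m * (ev (block_diag_part A) p)%:P).
  by apply: etrans (derivE fE W0) _; rewrite derivC horner0 addr0 hornerC.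
apply: (poly_eq_evals k_char0 (wline_neq0 X)) => t; rewrite !hornerM !hornerC horner_exp !horner_pline.
have -> : A + t *: (X *m A) = (1%:M + t *: X) *m A by rewrite mulmxDl mul1mx scalemxAl.
move=> nt; have ul : block_unilower h (cj (1%:M + t *: X)).
  move=> i j hij; rewrite mulmxDr mulmxDl mulmx1 mulmxV // -scalemxAr -scalemxAl.
  by rewrite idD_entry lX // mulr0 addr0.
have wb : ev ((1%:M + t *: X) *m A) w = ev A w * ev (1%:M + t *: X) w.
  by rewrite !Ew corner_prod_mull // mulrC.
rewrite Ef wb ?mulf_neq0 // exprMn mulrA; congr (_ * ev _ p).
by rewrite Ew in nA; rewrite Ew in nt; apply: block_diag_part_mull.
Qed.

End Derivative.

End BlockDiagonalPart.

(** * The centralizer of T in G *)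

Section TorusCentralizer.
Variables (k : closedFieldType) (k_char0 : [pchar k] =i pred0) (n : nat).

Lemma conj_gcomp_sum (P : 'M[k]_n) (uP : P \in unitmx) (h : 'I_n -> int) (a : pred int) Y i j :
  (P *m (\sum_(d <- undup [seq h x.1 - h x.2 | x : 'I_n * 'I_n] | a d) gcomp P h d Y)
     *m invmx P) i j = if a (h i - h j) then (P *m Y *m invmx P) i j else 0.
Proof.
rewrite mulmx_sumr mulmx_suml summxE big_mkcond /=.
rewrite (bigD1_seq (h i - h j)) ?undup_uniq //=; last first.
  by rewrite mem_undup; apply/mapP; exists (i, j); rewrite ?mem_enum.
rewrite conj_gcomp // eqxx big1 ?addr0 // => d nd.
by rewrite conj_gcomp // eq_sym (negPf nd) if_same.
Qed.

Lemma Lie_sum (G : 'M[k]_n -> Prop) (I : Type) (s : seq I) (a : pred I) (F : I -> 'M[k]_n) :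
  (forall i, Lie G (F i)) -> Lie G (\sum_(i <- s | a i) F i).
Proof.
move=> LF; elim/big_ind: _ => [|X Y LX LY|i _]; [exact: Lie0| |exact: LF].
by rewrite -[X]scale1r; apply: Lie_linear.
Qed.

Variables (G T : 'M[k]_n -> Prop) (algG : alg_group G) (connG : zconnected G).
Variables (T_max : maximal_torus G T) (trad0_G : forall X, trad G X -> X = 0).

Let algT := max_torus_alg T_max.
Let connT := max_torus_conn T_max.

(** The pullbacks of the equations of T by the block diagonal part, with denominators cleared, form
    a family stable under Lie G, since the components of degree 0 of Lie G lie in Lie T. They vanish
    on G, and c is its own block diagonal part. *)
Theorem torus_centralizer c : G c -> (forall t, T t -> t *m c = c *m t) -> T c.
Proof.
move=> Gc cT; have [P uP dT] := max_torus_diag T_max.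
have [h [Lh eqh _]] := regular_cochar k_char0 uP algT connT dT [::].
have [w Ew] := corner_prod_poly P h.
have TG Y : Lie T Y -> Lie G Y by apply: Lie_mono; apply: max_torus_sub T_max.
have LieG_gcomp d Y : Lie G Y -> Lie G (gcomp P h d Y).
  apply: (gcomp_stable k_char0 uP); [exact: Lie0|by move=> a u v; apply: Lie_linear|].
  by move=> Z LZ; apply: (LieM_bracket k_char0 algG) => //; apply: TG.
have LieT_gcomp0 Y : Lie G Y -> Lie T (gcomp P h 0 Y).
  move=> LY; apply: (centralizer_Lie k_char0 algG T_max trad0_G) => [|t Tt]; first exact: LieG_gcomp.
  apply/esym/(entries_commute uP (dT t Tt)) => i j; rewrite conj_gcomp // subr_eq0.
  case: (h i =P h j) => [e _|_]; last by rewrite eqxx.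
  exact: (proj1 (eqh i j) e).
have block_zero g : G g -> (forall t, T t -> t *m g = g *m t) -> forall i j, h i != h j ->
    (P *m g *m invmx P) i j = 0.
  move=> Gg cg i j; apply: contraNeq => ng; apply/eqP/eqh => t Tt.
  by apply: (conj_commute_entries uP (dT t Tt) _ ng); rewrite cg.
pose F (f : {mpoly k[n * n]}) := exists p m, vanish T p /\ forall A, ev A w != 0 ->
  ev A f = ev A w ^+ m * ev (block_diag_part P h A) p.
have F0 f : F f -> vanish G f.
  move: f; apply: (infinitesimal_vanishing k_char0 algG connG) => [f [p [m [Tp Hf]]]|X LX].
    rewrite Hf ?Ew ?(corner_prod1 uP) ?oner_neq0 // expr1n mul1r block_diag_part1 //.
    by apply: Tp; apply: alg_group1 algT.
  pose S := undup [seq h x.1 - h x.2 | x : 'I_n * 'I_n].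
  (* The part of negative degree acts by multiplication on the left, which does not change the block
     diagonal part; the rest acts on the right. *)
  pose X2 := \sum_(d <- S | (d < 0)%R) gcomp P h d X.
  have X2E i j : (P *m X2 *m invmx P) i j =
      if (h i < h j)%R then (P *m X *m invmx P) i j else 0.
    by rewrite conj_gcomp_sum // subr_lt0.
  have LX2 : Lie G X2 by apply: Lie_sum => d; apply: LieG_gcomp.
  move: X2 X2E LX2 => X2 X2E LX2.
  have X1E i j : (P *m (X - X2) *m invmx P) i j =
      if (h i < h j)%R then 0 else (P *m X *m invmx P) i j.
    rewrite mulmxBr mulmxBl.
    have bE (A B : 'M[k]_n) : (A - B) i j = A i j - B i j by rewrite !mxE.
    by rewrite bE X2E; case: ifP; rewrite ?subrr ?subr0.
  exists (X - X2), X2; split=> //; [|by rewrite subrK|].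
    by rewrite addrC -scaleN1r; apply: Lie_linear.
  move: (X - X2) X1E => X1 X1E f [p [m [Tp Hf]]].
  exists (vf (gmx k n *m map_mx (@mpolyC _ _) X1 + map_mx (@mpolyC _ _) X2 *m gmx k n) f); last first.
    by move=> g _; rewrite ev_vf map_mxD !map_mxM !ev_gmx !ev_constmx linearD.
  exists ((m%:R * dd w 1%:M X1) *: p + Dr (gcomp P h 0 X) p + (m%:R * dd w 1%:M X2) *: p), m.
  split=> [t Tt|A nA].
    rewrite !evD !evZ !(Tp t Tt) !mulr0 add0r addr0.
    exact: (vanish_Dr k_char0 algT (LieT_gcomp0 X LX) Tp Tt).
  rewrite ev_vf map_mxD !map_mxM !ev_gmx !ev_constmx linearD evD mulrDr.
  congr (_ + _).
    apply: (dd_block_mulr k_char0 uP Ew Hf nA) => i j; first by rewrite X1E => ->.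
    rewrite conj_gcomp // subr_eq0 X1E; case: eqP => // ->.
    by rewrite ltxx.
  by apply: (dd_block_mull k_char0 uP Ew Hf nA) => i j hij; rewrite X2E ltNge hij.
have uc := alg_group_unit algG Gc.
have cTV t : T t -> t *m invmx c = invmx c *m t.
  by move=> Tt; rewrite -[LHS](mulKmx uc) (mulmxA c) -cT // mulmxK.
have GcV := alg_groupV algG Gc.
have bu g : G g -> (forall t, T t -> t *m g = g *m t) -> block_upper h (P *m g *m invmx P).
  by move=> Gg cg i j hij; apply: block_zero => //; rewrite lt_eqF.
(* The inverse of c is block diagonal too, and [corner_prod] is multiplicative on such matrices. *)
have nc : corner_prod P h c != 0.
  apply/eqP => e; have := corner_prod1 uP h.
  rewrite -(mulmxV uc) corner_prod_mulr ?e ?mul0r //; last exact: bu.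
  by move/esym/eqP; rewrite oner_eq0.
apply: (vanish_closed algT uc) => p Tp.
have [f [m Hf]] := regular_comp p (block_diag_part_regular Ew).
have /F0/(_ c Gc) : F f by exists p, m.
rewrite Hf ?Ew // (block_diag_part_id uP nc); last exact: block_zero.
by move/eqP; rewrite mulf_eq0 expf_eq0 (negPf nc) andbF => /eqP.
Qed.

End TorusCentralizer.

(** * Characters, roots and the center *)

Lemma mem_In (I : eqType) (s : seq I) x : x \in s -> List.In x s.
Proof.
elim: s => //= y s IH; rewrite inE => /orP[/eqP->|/IH]; [by left|by right].
Qed.

Section Characters.
Variables (k : fieldType) (n : nat).

Lemma det_poly : exists w : {mpoly k[n * n]}, forall A, ev A w = \det A.
Proof. by apply: regular1; apply: regular_det; apply: regular_idmx. Qed.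

Variables (T : 'M[k]_n -> Prop) (algT : alg_group T).
Implicit Types (chi psi : 'M[k]_n -> k) (t : 'M[k]_n).

Lemma regular_on_torus w chi psi : (forall A, ev A w = \det A) -> regular w psi ->
  (forall t, T t -> chi t = psi t) ->
  exists (p : {mpoly k[n * n]}) (m : nat), forall t, T t -> chi t = mxeval p t / (\det t) ^+ m.
Proof.
move=> Ew [q [m Hq]] e; exists q, m => t Tt.
have nt : \det t != 0 by have := alg_group_unit algT Tt; rewrite unitmxE unitfE.
by rewrite mxevalE Hq Ew // e // mulrAC mulfV ?mul1r // expf_neq0.
Qed.

Lemma regular_inv_det w m : (forall A : 'M[k]_n, ev A w = \det A) ->
  regular w (fun A => (\det A ^+ m)^-1).
Proof.
move=> Ew; exists 1, m => A nA.
by rewrite ev1 Ew mulfV // expf_neq0 // -Ew.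
Qed.

Lemma char1 chi : is_character T chi -> chi 1%:M = 1.
Proof.
move=> [_ chi0 chiM]; have T1 := alg_group1 algT.
by apply: (mulfI (chi0 _ T1)); rewrite -chiM // mulmx1 mulr1.
Qed.

Lemma char_invmx chi t : is_character T chi -> T t -> chi (invmx t) = (chi t)^-1.
Proof.
move=> Hc Tt; have [_ chi0 chiM] := Hc; apply: (mulfI (chi0 _ Tt)).
have ut := alg_group_unit algT Tt; have Tv := alg_groupV algT Tt.
by rewrite -chiM // mulmxV // (char1 Hc) mulfV // chi0.
Qed.

Lemma character1 : is_character T (fun=> 1).
Proof.
have [w Ew] := det_poly; split=> [|t _|s t _ _]; rewrite ?oner_neq0 ?mulr1 //.
exact: (regular_on_torus Ew (regular_const w 1)).
Qed.

Lemma characterM chi psi : is_character T chi -> is_character T psi ->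
  is_character T (fun t => chi t * psi t).
Proof.
move=> [[p [m Hp]] chi0 chiM] [[q [l Hq]] psi0 psiM]; split=> [|t Tt|s t Ts Tt].
- exists (p * q), (m + l)%N => t Tt.
  by rewrite Hp // Hq // !mxevalE evM exprD invfM mulrACA.
- by rewrite mulf_neq0 ?chi0 ?psi0.
- by rewrite chiM // psiM // mulrACA.
Qed.

Lemma characterV chi : is_character T chi -> is_character T (fun t => (chi t)^-1).
Proof.
move=> Hc; have [[p [m Hp]] chi0 chiM] := Hc; split=> [|t Tt|s t Ts Tt].
- have [w Ew] := det_poly.
  apply: (regular_on_torus (w := w) (psi := fun A => ev (invmx A) p * \det A ^+ m)) => //.
    apply: regularM; last by apply: regular_ext (regular_ev w (w ^+ m)) => A _; rewrite evXn Ew.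
    apply: regular_comp; apply: regular_invmx; first exact: regular_idmx.
      by move=> A; rewrite Ew unitmxE unitfE.
    by apply: regular_ext (regular_inv_det 1 Ew) => A _; rewrite expr1.
  move=> t Tt; have Tv := alg_groupV algT Tt.
  by rewrite -(char_invmx Hc Tt) Hp // mxevalE det_inv exprVn invrK.
- by rewrite invr_eq0 chi0.
- by rewrite chiM // invfM.
Qed.

Lemma character_exprz chi (z : int) : is_character T chi -> is_character T (fun t => chi t ^ z).
Proof.
move=> Hc; have HX m : is_character T (fun t => chi t ^+ m).
  elim: m => [|m IH]; first exact: character1.
  have [[p [l Hp]] c0 cM] := characterM Hc IH.
  split=> [|t Tt|s t Ts Tt]; last by rewrite !exprS cM.
    by exists p, l => t /Hp; rewrite exprS.
  by rewrite exprS c0.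
by case: z => m; [exact: HX | exact: (characterV (HX m.+1))].
Qed.

Lemma character_conj chi g : g \in unitmx -> (forall t, T t -> T (invmx g *m t *m g)) ->
  is_character T chi -> is_character T (fun t => chi (invmx g *m t *m g)).
Proof.
move=> ug gT [[p [m Hp]] chi0 chiM]; split=> [|t Tt|s t Ts Tt]; last first.
- rewrite -chiM; [|exact: gT|exact: gT].
  congr chi; rewrite -!mulmxA; do 2 congr (_ *m _).
  by rewrite !mulmxA mulmxV // mul1mx.
- exact/chi0/gT.
- have [w Ew] := det_poly.
  apply: (regular_on_torus (w := w)
    (psi := fun A => ev (invmx g *m A *m g) p * (\det A ^+ m)^-1)) => //.
    apply: regularM; last exact: regular_inv_det.
    apply: regular_comp; apply: regular_mulmx; last exact: regular_constmx.
    by apply: regular_mulmx; [apply: regular_constmx | apply: regular_idmx].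
  move=> t Tt; rewrite Hp; last exact: gT.
  rewrite mxevalE !det_mulmx det_inv mulrAC mulVf ?mul1r //.
  by move: ug; rewrite unitmxE unitfE.
Qed.

End Characters.

Section RootWeights.
Variables (k : closedFieldType) (k_char0 : [pchar k] =i pred0) (n : nat).
Variables (G T : 'M[k]_n -> Prop) (algG : alg_group G) (connG : zconnected G).
Variables (T_max : maximal_torus G T).

Let algT := max_torus_alg T_max.
Let connT := max_torus_conn T_max.

Lemma character_dg P i : P \in unitmx -> (forall t, T t -> diag_for P t) ->
  is_character T (fun t => dg P t i).
Proof.
move=> uP dT; split=> [|t Tt|s t Ts Tt]; last by rewrite dgM ?dT.
  have [w Ew] := det_poly k n; apply: (regular_on_torus algT Ew (psi := fun t => dg P t i)) => //.
  suff rP : regular_mx w (fun A => P *m A *m invmx P) by apply: rP.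
  apply: regular_mulmx; last exact: regular_constmx.
  by apply: regular_mulmx; [apply: regular_constmx | apply: regular_idmx].
exact: (dg_neq0 uP algT dT).
Qed.

Lemma diag_for_conjE (P t : 'M[k]_n) : diag_for P t -> P *m t *m invmx P = diag_mx (\row_i dg P t i).
Proof.
move=> /diag_mxP[d E]; rewrite /dg E; congr diag_mx; apply/rowP => l.
by rewrite !mxE eqxx mulr1n.
Qed.

Lemma weight_entries (P t X : 'M[k]_n) a : P \in unitmx -> diag_for P t ->
  t *m X = a *: (X *m t) <->
  (forall i j, (P *m X *m invmx P) i j != 0 -> dg P t i = a * dg P t j).
Proof.
move=> uP dt; have E i j : (P *m (t *m X) *m invmx P) i j =
    dg P t i * (P *m X *m invmx P) i j.
  by rewrite conjM // (diag_for_conjE dt) mul_diag_mx [LHS]mxE [Z in Z * _]mxE.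
have E' i j : (P *m (a *: (X *m t)) *m invmx P) i j =
    a * dg P t j * (P *m X *m invmx P) i j.
  rewrite -scalemxAr -scalemxAl conjM // (diag_for_conjE dt) mul_mx_diag [LHS]mxE [Z in a * Z]mxE.
  by rewrite [Z in _ * (_ * Z)]mxE mulrAC mulrA.
split=> [H i j nX|H]; first by apply: (mulIf nX); rewrite -E H E'.
apply: (conj_inj uP); apply/matrixP => i j; rewrite E E'.
have [->|/H->//] := eqVneq ((P *m X *m invmx P) i j) 0.
by rewrite !mulr0.
Qed.

Lemma conjg_eqP (t X : 'M[k]_n) a : t \in unitmx ->
  t *m X *m invmx t = a *: X <-> t *m X = a *: (X *m t).
Proof.
move=> ut; split=> [H|->]; last by rewrite -scalemxAl mulmxK.
by rewrite -[LHS](mulmxKV ut) H -scalemxAl.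
Qed.

(** The indices are those of a nonzero entry of a root vector in the eigenbasis of T. *)
Lemma root_weight P alpha : P \in unitmx -> (forall t, T t -> diag_for P t) ->
  is_root G T alpha ->
  exists i j, forall t, T t -> alpha t = dg P t i / dg P t j.
Proof.
move=> uP dT [_ _ [X [X0 _ HX]]].
have [i [j nX]] : exists i j, (P *m X *m invmx P) i j != 0.
  apply: NNPP => H; case/eqP: X0; apply: (conj_inj uP); apply/matrixP => i j.
  rewrite mulmx0 mul0mx [RHS]mxE; apply/eqP/negPn/negP => nX; apply: H.
  by exists i, j.
exists i, j => t Tt; have ut := alg_group_unit algT Tt.
have /conjg_eqP-/(_ ut)/(weight_entries _ _ uP (dT t Tt))/(_ i j nX)-> := HX t Tt.
by rewrite mulfK // (dg_neq0 uP algT dT).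
Qed.

(** X is graded by a cocharacter so generic that quotients of weights of equal degree coincide on T.
    Each nonzero component is then a weight vector, whose weight is trivial or a root. *)
Lemma roots_kernel_commute z : T z -> (forall alpha, is_root G T alpha -> alpha z = 1) ->
  forall X, Lie G X -> z *m X = X *m z.
Proof.
move=> Tz Hz X LX; have [P uP dT] := max_torus_diag T_max.
(* Exponents of the quotient of two quotients of weights. *)
pose dd4 (q : 'I_n * 'I_n * ('I_n * 'I_n)) l := ediff q.1.1 q.1.2 l + ediff q.2.2 q.2.1 l.
have [h [Lh eqh Hh]] := regular_cochar k_char0 uP algT connT dT
  [seq dd4 q | q <- enum {: 'I_n * 'I_n * ('I_n * 'I_n)}].
have TG Y : Lie T Y -> Lie G Y by apply: Lie_mono; apply: max_torus_sub T_max.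
have n0 t i : T t -> dg P t i != 0 by move=> Tt; apply: (dg_neq0 uP algT dT).
have same_weight i j l m : h i - h j = h l - h m -> forall t, T t ->
    dg P t i / dg P t j = dg P t l / dg P t m.
  move=> e t Tt; apply: NNPP => ne.
  have [] := Hh (dd4 (i, j, (l, m))).
  - by apply/List.in_map/mem_In; rewrite mem_enum.
  - exists t => //; rewrite (mono_add uP algT dT _ _ Tt) !(mono_diff uP algT dT _ _ Tt) /= => e1; apply: ne.
    rewrite -[RHS]mul1r -e1 -mulrA mulrA; field.
    by rewrite !n0.
  rewrite /dd4 /pairing /=.
  rewrite (eq_bigr (fun a => ediff i j a * h a + ediff m l a * h a)).
    by rewrite big_split /= -!/(pairing _ _) !pairing_diff e; ring.
  by move=> a _; rewrite mulrDl.
have key d : z *m gcomp P h d X = gcomp P h d X *m z.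
  have LY : Lie G (gcomp P h d X).
    apply: (gcomp_stable k_char0 uP) LX; [exact: Lie0|by move=> a u v; apply: Lie_linear|].
    by move=> Z LZ; apply: (LieM_bracket k_char0 algG) => //; apply: TG.
  have HY i j : (P *m gcomp P h d X *m invmx P) i j != 0 -> h i - h j = d.
    by rewrite conj_gcomp //; case: (h i - h j =P d) => //; rewrite eqxx.
  move: (gcomp P h d X) LY HY => Y LY HY.
  have [->|Y0] := eqVneq Y 0; first by rewrite mulmx0 mul0mx.
  have [i [j nY]] : exists i j, (P *m Y *m invmx P) i j != 0.
    apply: NNPP => H; case/eqP: Y0; apply: (conj_inj uP); apply/matrixP => i j.
    rewrite mulmx0 mul0mx [RHS]mxE; apply/eqP/negPn/negP => nX; apply: H.
    by exists i, j.
  pose chi t := dg P t i / dg P t j.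
  have wY t : T t -> t *m Y = chi t *: (Y *m t).
    move=> Tt; apply/(weight_entries _ _ uP (dT t Tt)) => a b nab.
    rewrite /chi (same_weight i j a b) ?divfK ?n0 //.
    by rewrite (HY _ _ nY) (HY _ _ nab).
  rewrite (wY z Tz); suff -> : chi z = 1 by rewrite scale1r.
  have [[t Tt nt]|triv] := classic (exists2 t, T t & chi t != 1); last first.
    by apply: NNPP => nz; apply: triv; exists z => //; apply/eqP.
  apply: (Hz chi); split; last 1 first.
  - exists Y; split=> // s Ts; apply/conjg_eqP; [exact: alg_group_unit Ts|exact: wY].
  - apply: characterM; first exact: character_dg.
    by apply: characterV => //; apply: character_dg.
  - by exists t.
rewrite (gcomp_sum uP h X) mulmx_sumr mulmx_suml; apply: eq_bigr => d _.
exact: key.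
Qed.

(** The entries of z A C - A z C, as functions of A, vanish at 1, and the derivation of X in Lie G
    replaces C by X C because X commutes with z. *)
Lemma Lie_commute_central z : G z -> (forall X, Lie G X -> z *m X = X *m z) ->
  forall g, G g -> z *m g = g *m z.
Proof.
move=> Gz cz g Gg.
pose F (f : {mpoly k[n * n]}) := exists C i j, f = lform z C i j - lform 1%:M (z *m C) i j.
have Fvan f : F f -> vanish G f.
  apply: (Lie_vanishing k_char0 algG connG) f => [f [C [i [j ->]]]|X f LX [C [i [j ->]]]].
    by rewrite evB !ev_lform !mulmx1 mul1mx subrr.
  exists (lform z (X *m C) i j - lform 1%:M (z *m (X *m C)) i j).
    by exists (X *m C), i, j.
  move=> A _; rewrite evB ddD ddN !(dd_lform k_char0).
  by rewrite !ev_lform !mul1mx !mulmxA -(mulmxA A X z) -cz // !mulmxA.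
apply/matrixP => i j.
have /Fvan/(_ g Gg)/eqP : F (lform z 1%:M i j - lform 1%:M (z *m 1%:M) i j).
  by exists 1%:M, i, j.
by rewrite evB !ev_lform !mulmx1 mul1mx subr_eq0 => /eqP.
Qed.

End RootWeights.

Lemma connected_image (k : fieldType) n (T : 'M[k]_n -> Prop) (phi : 'M[k]_n -> 'M[k]_n) :
  (forall t, T t -> t \in unitmx) -> (forall t, T t -> phi t \in unitmx) ->
  regular_mx 1 phi -> zconnected T -> zconnected (fun h => exists2 t, T t & h = phi t).
Proof.
move=> uT uphi rphi [[t0 Tt0] conn]; split; first by exists (phi t0), t0.
have pre Y : zclosed Y -> exists2 Y', zclosed Y' & forall t, T t -> (Y' t <-> Y (phi t)).
  move=> [S HS].
  pose S' (q : {mpoly k[n * n]}) := exists2 p, S p & forall A, ev A q = ev (phi A) p.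
  exists (fun A => A \in unitmx /\ forall q, S' q -> mxeval q A = 0); first by exists S'.
  move=> t Tt; split=> [[_ Ht]|/HS[_ Ht]].
    apply/HS; split=> [|p Sp]; first exact: uphi.
    have [q Hq] := regular1 (regular_comp p rphi).
    by rewrite mxevalE -Hq -mxevalE; apply: Ht; exists p.
  split=> [|q [p Sp Hq]]; first exact: uT.
  by rewrite mxevalE Hq -mxevalE Ht.
move=> Y Z /pre[Y' cY' HY] /pre[Z' cZ' HZ] cov [_ [[y Ty ->] Yy]] [_ [[z Tz ->] Zz]].
have [|||t [Tt /HY Yt /HZ Zt]] := conn _ _ cY' cZ'.
- move=> t Tt; have [|Yt|Zt] := cov (phi t); first by exists t.
    by left; apply/HY.
  by right; apply/HZ.
- by exists y; split=> //; apply/HY.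
- by exists z; split=> //; apply/HZ.
- by exists (phi t); split; [exists t|exact: Yt|exact: Zt].
Qed.

(** * Powers of the elements of a coset of T *)

Section TwistedPowers.
Variables (k : fieldType) (n : nat).
Implicit Types (g t : 'M[k]_n).

(* (g t)^m = g^m N_m(t), where N_m(t) is the product of the g^-i t g^i, 0 <= i < m *)
Fixpoint tnorm g (m : nat) t : 'M[k]_n :=
  if m is m'.+1 then invmx g *m tnorm g m' t *m g *m t else 1%:M.

Lemma exp_mulmx_tnorm g t m : g \in unitmx -> (g *m t) ^+ m = g ^+ m *m tnorm g m t.
Proof.
move=> ug; elim: m => [|m IH]; first by rewrite !expr0 mulmx1.
rewrite exprSr IH [g ^+ m.+1]exprSr /= -[(_ * _)%R]/(_ *m _) -[(_ * g)%R]/(_ *m g).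
by rewrite !mulmxA mulmxK.
Qed.

Variables (T : 'M[k]_n -> Prop) (algT : alg_group T).
Hypothesis commT : forall s t, T s -> T t -> s *m t = t *m s.

Section Element.
Variables (g : 'M[k]_n) (ug : g \in unitmx) (gT : forall t, T t -> T (invmx g *m t *m g)).

Lemma tnorm_in m t : T t -> T (tnorm g m t).
Proof.
move=> Tt; elim: m => [|m IH]; first exact: alg_group1 algT.
by apply: (alg_groupM algT) => //; apply: gT.
Qed.

Lemma conjg_mul s t : invmx g *m (s *m t) *m g = invmx g *m s *m g *m (invmx g *m t *m g).
Proof. by rewrite !mulmxA mulmxK. Qed.

Lemma tnormM m s t : T s -> T t -> tnorm g m (s *m t) = tnorm g m s *m tnorm g m t.
Proof.
move=> Ts Tt; elim: m => [|m IH] /=; first by rewrite mulmx1.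
rewrite IH conjg_mul; have := gT (tnorm_in m Tt).
move: (invmx g *m tnorm g m s *m g) (invmx g *m tnorm g m t *m g) => a b Tb.
by rewrite -!mulmxA (mulmxA b) -(commT Ts Tb) !mulmxA.
Qed.

Lemma tnorm1 m : tnorm g m 1%:M = 1%:M.
Proof. by elim: m => //= m ->; rewrite !mulmx1 mulVmx. Qed.

Lemma char_tnorm_fixed (chi : 'M[k]_n -> k) m t :
  (forall s t, T s -> T t -> chi (s *m t) = chi s * chi t) -> chi 1%:M = 1 ->
  (forall t, T t -> chi (invmx g *m t *m g) = chi t) ->
  T t -> chi (tnorm g m t) = chi t ^+ m.
Proof.
move=> chiM chi1 chig Tt; elim: m => [|m IH] //=.
have Tm := tnorm_in m Tt.
by rewrite chiM ?chig ?IH ?exprSr //; apply: gT.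
Qed.

End Element.
End TwistedPowers.

(** * The action of the normalizer on the root lattice *)

(** The character attached to the vector x of the root lattice. *)
Definition rchar (k : fieldType) n (alpha beta : 'M[k]_n -> k) (x : int * int) (t : 'M[k]_n) : k :=
  alpha t ^ x.1 * beta t ^ x.2.

(** The linear map sending the two basis vectors to [M.1] and [M.2]. *)
Definition lin2 (M : (int * int) * (int * int)) (x : int * int) : int * int :=
  (x.1 * M.1.1 + x.2 * M.2.1, x.1 * M.1.2 + x.2 * M.2.2).

(** The value at x of 1 + f + ... + f^(m-1). *)
Fixpoint orbit_sum (f : int * int -> int * int) (m : nat) (x : int * int) : int * int :=
  if m is m'.+1 then orbit_sum f m' (f x) + x else 0.

Lemma pair_eqP (x y : int * int) : x.1 = y.1 -> x.2 = y.2 -> x = y.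
Proof. by case: x y => [a b] [c d] /= -> ->. Qed.

Section RootLattice.
Variables (k : closedFieldType) (k_char0 : [pchar k] =i pred0) (n : nat).
Variables (G T : 'M[k]_n -> Prop) (G_simple : simple_alg_group G) (T_max : maximal_torus G T).
Variables (alpha beta : 'M[k]_n -> k).
Hypotheses (Ha : is_character T alpha) (Hb : is_character T beta).
Hypothesis indep : forall a b : int,
  (forall t, T t -> alpha t ^ a * beta t ^ b = 1) -> a = 0 /\ b = 0.
Hypothesis rootsE : forall chi, is_character T chi -> (is_root G T chi <->
  exists2 x, x \in G2_roots & forall t, T t -> chi t = alpha t ^ x.1 * beta t ^ x.2).

Let algT := max_torus_alg T_max.
Let connT := max_torus_conn T_max.

Local Notation rc := (rchar alpha beta).

Definition acts g (f : int * int -> int * int) : Prop :=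
  forall x t, T t -> rc x (invmx g *m t *m g) = rc (f x) t.

Lemma simple_alg : alg_group G. Proof. by case: G_simple. Qed.
Lemma simple_conn : zconnected G. Proof. by case: G_simple. Qed.
Let algG := simple_alg.
Let connG := simple_conn.

Lemma rchar_character x : is_character T (rc x).
Proof. by apply: characterM; apply: character_exprz. Qed.

Lemma rcharD x y t : T t -> rc (x + y) t = rc x t * rc y t.
Proof.
move=> Tt; have [_ a0 _] := Ha; have [_ b0 _] := Hb.
by rewrite /rchar !expfzDr ?a0 ?b0 // mulrACA.
Qed.

Lemma rchar0 t : rc 0 t = 1.
Proof. by rewrite /rchar !expr0z mulr1. Qed.

Lemma rcharN x t : T t -> rc (- x) t = (rc x t)^-1.
Proof.
move=> Tt; have [_ r0 _] := rchar_character x.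
by apply: (mulfI (r0 t Tt)); rewrite -rcharD // subrr rchar0 mulfV ?r0.
Qed.

Lemma rcharM x s t : T s -> T t -> rc x (s *m t) = rc x s * rc x t.
Proof. by have [_ _ H] := rchar_character x; apply: H. Qed.

Lemma rchar_neq0 x t : T t -> rc x t != 0.
Proof. by have [_ H _] := rchar_character x; apply: H. Qed.

Lemma rchar_inj x y : (forall t, T t -> rc x t = rc y t) -> x = y.
Proof.
move=> e; have [t Tt|] := indep (a := (x - y).1) (b := (x - y).2).
  by rewrite -/(rc (x - y) t) rcharD // rcharN // e // mulfV // rchar_neq0.
by move=> /eqP e1 /eqP e2; apply: pair_eqP; apply/eqP; rewrite -subr_eq0.
Qed.

Lemma rchar_exprz x (z : int) t : rc x t ^ z = rc (x.1 * z, x.2 * z) t.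
Proof. by rewrite /rchar expfzMl !exprz_exp. Qed.

Lemma rootP chi : is_root G T chi -> exists2 x, x \in G2_roots & forall t, T t -> chi t = rc x t.
Proof. by move=> Rchi; have [Hc _ _] := Rchi; have [/(_ Rchi)] := rootsE Hc. Qed.

Lemma rchar_root x : x \in G2_roots -> is_root G T (rc x).
Proof. by move=> xR; apply/(rootsE (rchar_character x)); exists x. Qed.

Lemma torus_comm s t : T s -> T t -> s *m t = t *m s.
Proof.
have [P uP dT] := max_torus_diag T_max.
by move=> Ts Tt; apply: (diag_for_mulC uP); apply: dT.
Qed.

Lemma torus_nontrivial : exists2 t, T t & t <> 1%:M.
Proof.
apply: NNPP => H; have [t Tt|] := indep (a := 1) (b := 0); last by [].
have -> : t = 1%:M by apply: NNPP => nt; apply: H; exists t.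
by rewrite (char1 algT Ha) expr1z mul1r expr0z.
Qed.

Let trad0_G := simple_trad0 k_char0 G_simple T_max torus_nontrivial.

Lemma normalizer_unit g : normalizer G T g -> g \in unitmx.
Proof. by case=> /(alg_group_unit algG). Qed.

Lemma normalizer_conjg g t : normalizer G T g -> T t -> T (invmx g *m t *m g).
Proof.
move=> Ng Tt; have ug := normalizer_unit Ng; have [_ H] := Ng; apply/H.
by rewrite !mulmxA mulmxV // mul1mx mulmxK.
Qed.

(** Conjugation by g permutes the root spaces. The images of the two simple roots define M, and the
    independence of alpha and beta identifies its value at every other root. *)
Lemma acts_exists g : normalizer G T g -> exists2 M, acts g (lin2 M) &
  forall x, x \in G2_roots -> lin2 M x \in G2_roots.
Proof.
move=> Ng; have ug := normalizer_unit Ng; have Gg := proj1 Ng.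
have conj_root chi : is_root G T chi -> is_root G T (fun t => chi (invmx g *m t *m g)).
  case=> Hc [t Tt nt] [X [X0 LX HX]]; split.
  - by apply: character_conj => // s; apply: normalizer_conjg.
  - exists (g *m t *m invmx g); first exact: (proj1 ((proj2 Ng) t) Tt).
    by rewrite !mulmxA mulVmx // mul1mx mulmxKV.
  - exists (g *m X *m invmx g); split; last first.
    + move=> s Ts; have us := alg_group_unit algT Ts; apply/conjg_eqP => //.
      have Ts' := normalizer_conjg Ng Ts.
      have /conjg_eqP-/(_ (alg_group_unit algT Ts')) := HX _ Ts'.
      set a := chi _; set s' := invmx g *m s *m g => e.
      have -> : s *m (g *m X *m invmx g) = g *m (s' *m X) *m invmx g.
        by rewrite /s' !mulmxA mulmxV // mul1mx.
      by rewrite e -scalemxAr -scalemxAl /s' !mulmxA mulmxK.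
    + exact: (Lie_conj k_char0 algG).
    + apply: contraNneq X0 => e; rewrite (_ : X = invmx g *m (g *m X *m invmx g) *m g).
        by rewrite e mulmx0 mul0mx.
      by rewrite !mulmxA mulVmx // mul1mx mulmxKV.
have [a aR Ea] := rootP (conj_root _ (rchar_root (isT : (1, 0) \in G2_roots))).
have [b bR Eb] := rootP (conj_root _ (rchar_root (isT : (0, 1) \in G2_roots))).
have act : acts g (lin2 (a, b)).
  move=> x t Tt; have := Ea t Tt; have := Eb t Tt.
  rewrite {1 3}/rchar /= !expr1z !expr0z mul1r mulr1 => eb ea.
  have -> : lin2 (a, b) x = (a.1 * x.1, a.2 * x.1) + (b.1 * x.2, b.2 * x.2).
    by rewrite /lin2 /= [x.1 * a.1]mulrC [x.1 * a.2]mulrC [x.2 * b.1]mulrC [x.2 * b.2]mulrC.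
  by rewrite {1}/rchar ea eb !rchar_exprz -rcharD.
exists (a, b) => // x xR.
have [y yR Ey] := rootP (conj_root _ (rchar_root xR)).
suff -> : lin2 (a, b) x = y by [].
by apply: rchar_inj => t Tt; rewrite -act // Ey.
Qed.

Lemma normalizerM g h : normalizer G T g -> normalizer G T h -> normalizer G T (g *m h).
Proof.
move=> Ng Nh; have [Gg Hg] := Ng; have [Gh Hh] := Nh.
split=> [|t]; first exact: alg_groupM.
have -> : g *m h *m t *m invmx (g *m h) = g *m (h *m t *m invmx h) *m invmx g.
  by rewrite invmx_mul ?normalizer_unit // !mulmxA.
split=> H; first exact: (proj1 (Hg _) (proj1 (Hh t) H)).
exact: (proj2 (Hh t) (proj2 (Hg _) H)).
Qed.

Lemma normalizer_torus t : T t -> normalizer G T t.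
Proof.
move=> Tt; have ut := alg_group_unit algT Tt.
split=> [|s]; first exact: max_torus_sub T_max _ Tt.
split=> [Ts|Tc]; first by rewrite -(torus_comm Ts Tt) mulmxK.
rewrite (_ : s = invmx t *m (t *m s *m invmx t) *m t).
  by apply: (alg_groupM algT) => //; apply: (alg_groupM algT) => //; apply: alg_groupV.
by rewrite !mulmxA mulVmx // mul1mx mulmxKV.
Qed.

Lemma normalizerX g m : normalizer G T g -> normalizer G T (g ^+ m).
Proof.
move=> Ng; elim: m => [|m IH]; first exact: normalizer_torus (alg_group1 algT).
by rewrite exprS; apply: normalizerM.
Qed.

Lemma conjg_comp (g h t : 'M[k]_n) : g \in unitmx -> h \in unitmx ->
  invmx (g *m h) *m t *m (g *m h) = invmx h *m (invmx g *m t *m g) *m h.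
Proof. by move=> ug uh; rewrite invmx_mul // !mulmxA. Qed.

Lemma actsM g h f f' : normalizer G T g -> normalizer G T h -> acts g f -> acts h f' ->
  acts (g *m h) (f \o f').
Proof.
move=> Ng Nh ag ah x t Tt; rewrite conjg_comp ?normalizer_unit // ah; last exact: normalizer_conjg.
by rewrite ag.
Qed.

Lemma acts_torus t : T t -> acts t id.
Proof.
move=> Tt x s Ts; have ut := alg_group_unit algT Tt.
by rewrite -mulmxA (torus_comm Ts Tt) mulKmx.
Qed.

Lemma actsX g f m : normalizer G T g -> acts g f -> acts (g ^+ m) (iter m f).
Proof.
move=> Ng ag; elim: m => [|m IH]; first exact: acts_torus (alg_group1 algT).
by rewrite exprS; apply: (actsM (f := f) (f' := iter m f)) => //; apply: normalizerX.
Qed.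

Lemma acts_inj g f f' : acts g f -> acts g f' -> f =1 f'.
Proof. by move=> ag ag' x; apply: rchar_inj => t Tt; rewrite -ag // ag'. Qed.

Lemma acts_coset g f t : normalizer G T g -> T t -> acts g f -> acts (g *m t) f.
Proof.
by move=> Ng Tt ag; apply: (actsM (f' := id)) => //; [apply: normalizer_torus|apply: acts_torus].
Qed.

Lemma rchar_tnorm g f x m t : normalizer G T g -> acts g f -> T t ->
  rc x (tnorm g m t) = rc (orbit_sum f m x) t.
Proof.
move=> Ng ag Tt; have gT s := @normalizer_conjg g s Ng.
elim: m x => [|m IH] x; first by rewrite rchar0; apply: (char1 algT (rchar_character x)).
have Tm := tnorm_in algT gT m Tt.
rewrite [tnorm _ _ _]/= rcharM // ?ag ?IH -?rcharD //; exact: gT.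
Qed.

Lemma kernel_central z : T z -> (forall x, rc x z = 1) -> forall g, G g -> z *m g = g *m z.
Proof.
move=> Tz Hz; apply: (Lie_commute_central k_char0 algG connG); first exact: max_torus_sub T_max _ Tz.
by apply: (roots_kernel_commute k_char0 algG T_max Tz) => chi /rootP[x _ ->].
Qed.

(* The image of N_m is a connected subgroup of T on which all roots are trivial, hence central in G. *)
Lemma tnorm_trivial g f m t : normalizer G T g -> acts g f -> (forall x, orbit_sum f m x = 0) ->
  T t -> tnorm g m t = 1%:M.
Proof.
move=> Ng ag f0 Tt; have gT s := @normalizer_conjg g s Ng.
have ug := normalizer_unit Ng; have uT := alg_group_unit algT.
pose A h := exists2 s, T s & h = tnorm g m s.
have AT h : A h -> T h by move=> [s Ts ->]; apply: tnorm_in.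
have Au h : A h -> h \in unitmx by move/AT/uT.
have ugm : g ^+ m \in unitmx by apply: normalizer_unit; apply: normalizerX.
have connA : zconnected A.
  apply: connected_image => // [s Ts|]; first by apply: Au; exists s.
  (* N_m(s) = g^-m (g s)^m is polynomial in s, so the image of the connected group T is
     connected. *)
  have rX : regular_mx 1 (fun s : 'M[k]_n => invmx (g ^+ m) *m (g *m s) ^+ m).
    apply: regular_mulmx; first exact: regular_constmx.
    elim: (m) => [|l IH]; first exact: regular_constmx.
    have rg : regular_mx 1 (fun s : 'M[k]_n => g *m s).
      by apply: regular_mulmx; [apply: regular_constmx|apply: regular_idmx].
    by move=> i j; apply: regular_ext (regular_mulmx rg IH i j) => s _; rewrite exprS.
  move=> i j; apply: regular_ext (rX i j) => s _.
  by rewrite exp_mulmx_tnorm // mulKmx.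
have GA h : A h -> G h by move/AT/(max_torus_sub T_max).
have [[zG _ _ _] _ [g1 [g2 [Gg1 Gg2 ng]]] simpleG] := G_simple.
have grpA : alg_group (zclosure A).
  apply: zclosure_group => // [|a b [s Ts ->] [s' Ts' ->]|a [s Ts ->]].
  - by exists 1%:M; rewrite ?tnorm1 //; apply: alg_group1 algT.
  - by exists (s *m s'); [apply: alg_groupM|rewrite (tnormM algT torus_comm)].
  - have Tv := alg_groupV algT Ts; exists (invmx s) => //.
    have us := uT _ (tnorm_in algT gT m Ts).
    rewrite -[LHS]mulmx1 -(tnorm1 ug m) -(mulmxV (uT _ Ts)) (tnormM algT torus_comm) // mulKmx //.
have subA h : zclosure A h -> G h by apply: zclosure_min.
have cenA h : zclosure A h -> forall g', G g' -> h *m g' = g' *m h.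
  move=> [_ Hh] g' Gg'; apply/matrixP => i j.
  have := Hh (lform 1%:M g' i j - lform g' 1%:M i j).
  rewrite evB !ev_lform !mulmx1 !mul1mx => H; apply/eqP; rewrite -subr_eq0; apply/eqP.
  apply: H => _ [s Ts ->]; rewrite evB !ev_lform !mulmx1 !mul1mx.
  rewrite (kernel_central (tnorm_in algT gT m Ts)) ?subrr // => x.
  by rewrite (rchar_tnorm _ _ Ng ag) // f0 rchar0.
have nA : normal_subgroup (zclosure A) G.
  split=> // g' h Gg' Ah; by rewrite -(cenA h Ah g' Gg') mulmxK // (alg_group_unit algG).
have [AG|triv] := simpleG _ nA (zclosure_connected Au connA).
  by case: ng; apply: cenA => //; apply/AG.
by apply: triv; apply: sub_zclosure => //; exists t.
Qed.

Lemma rchar_mono P x : P \in unitmx -> (forall t, T t -> diag_for P t) ->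
  exists e, forall t, T t -> rc x t = mono P e t.
Proof.
move=> uP dT.
have [i [j Eij]] := root_weight T_max uP dT (rchar_root (isT : (1, 0) \in G2_roots)).
have [a [b Eab]] := root_weight T_max uP dT (rchar_root (isT : (0, 1) \in G2_roots)).
exists (fun l => ediff i j l * x.1 + ediff a b l * x.2) => t Tt.
have := Eij t Tt; have := Eab t Tt; rewrite {1 2}/rchar /= !expr1z !expr0z mul1r mulr1 => eb ea.
by rewrite (mono_add uP algT dT _ _ Tt) !mono_scale !(mono_diff uP algT dT _ _ Tt) /rchar ea eb.
Qed.

(** The pairing with a cocharacter is an integer, so it vanishes as soon as m times it does: X(T)
    has no torsion. *)
Lemma mono_torsion P e m : P \in unitmx -> (forall t, T t -> diag_for P t) -> (0 < m)%N ->
  (forall t, T t -> mono P e t ^+ m = 1) -> forall t, T t -> mono P e t = 1.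
Proof.
move=> uP dT m0 H; apply: (mono_trivial k_char0 uP algT connT dT) => h Lh.
have n2 : (2%:R : k) != 0 by apply: (natr_neq0 k_char0).
have := H _ (cochar_in_torus k_char0 uP algT Lh n2).
rewrite mono_cochar // exprnP exprz_exp -(expr0z 2%:R) => /(exp2z_inj k_char0)/eqP.
by rewrite mulf_eq0 => /orP[/eqP//|]; rewrite eqz_nat => /eqP m00; rewrite m00 in m0.
Qed.

(** * Elements acting on the root lattice with f^2 = f - 1 *)

Section CoxeterAction.
Variables (g : 'M[k]_n) (f : int * int -> int * int).
Hypotheses (Ng : normalizer G T g) (ag : acts g f) (ff : forall x, f (f x) = f x - x).

Lemma coxeter_orbit_sum x : orbit_sum f 6 x = 0.
Proof.
have f3 y : f (f (f y)) = - y by rewrite ff ff addrAC subrr sub0r.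
by rewrite /= !f3 ff !add0r; case: x (f x) => [a b] [c d]; apply: pair_eqP => /=; ring.
Qed.

Hypothesis chi_g : forall chi, is_character T chi ->
  exists u, forall t, T t -> chi (invmx g *m t *m g) = chi t * rc u t.

(** For a weight chi of T on k^n, g moves chi by a vector u of the root lattice. As f (f u) + u = f
    u, adding f u to chi gives a character fixed by g; its sixth power is its value at N_6, which is
    1, so it is trivial. Hence chi is in the root lattice and is trivial at z. *)
Lemma kernel_trivial z : T z -> (forall x, rc x z = 1) -> z = 1%:M.
Proof.
move=> Tz Hz; have [P uP dT] := max_torus_diag T_max.
apply: (dg_inj uP (dT z Tz) (dT _ (alg_group1 algT))) => i; rewrite dg1 //.
have Hc := character_dg T_max i uP dT.
have [u Hu] := chi_g Hc; have [e He] := rchar_mono (f u) uP dT.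
pose chi' t := dg P t i * rc (f u) t.
have Hc' : is_character T chi' by apply: characterM => //; apply: rchar_character.
have fixed t : T t -> chi' (invmx g *m t *m g) = chi' t.
  move=> Tt; rewrite /chi' Hu // ag // ff rcharD // rcharN // mulrA.
  by have := rchar_neq0 u Tt; move: (rc u t) (rc (f u) t) (dg P t i) => a b c na; field.
have chi'6 t : T t -> mono P (fun l => (l == i)%:Z + e l) t ^+ 6 = 1.
  move=> Tt; rewrite (mono_add uP algT dT _ _ Tt) mono_delta -He // -/(chi' t).
  have [_ _ chiM] := Hc'.
  rewrite -(char_tnorm_fixed algT (fun s => @normalizer_conjg g s Ng) 6 chiM (char1 algT Hc') fixed Tt).
  by rewrite (tnorm_trivial Ng ag coxeter_orbit_sum Tt) (char1 algT Hc').
have := mono_torsion uP dT (isT : (0 < 6)%N) chi'6 Tz.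
by rewrite (mono_add uP algT dT _ _ Tz) mono_delta -He // Hz mulr1.
Qed.

(** All roots are trivial on the elements t^-1 h^-1 t h of T, which are therefore 1; so h
    centralizes T. *)
Lemma trivial_action_torus h : normalizer G T h -> acts h id -> T h.
Proof.
move=> Nh ah; apply: (torus_centralizer k_char0 algG connG T_max trad0_G (proj1 Nh)) => t Tt.
have uh := normalizer_unit Nh; have ut := alg_group_unit algT Tt.
have Tc := normalizer_conjg Nh Tt; have Tv := alg_groupV algT Tt.
have : invmx t *m (invmx h *m t *m h) = 1%:M.
  apply: kernel_trivial => [|x]; first exact: alg_groupM.
  rewrite rcharM // ah // -rcharM // mulVmx //; exact: (char1 algT (rchar_character x)).
move/(congr1 (mulmx t)); rewrite mulKVmx // mulmx1 => /(congr1 (mulmx h)).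
by rewrite !mulmxA mulmxV // mul1mx.
Qed.

(** g^6 acts trivially, so it lies in T. Being fixed by g, it has the same value under x, f x and f
    (f x) = f x - x; this value is therefore 1. *)
Lemma coxeter_power6 : g ^+ 6 = 1%:M.
Proof.
have f3 y : f (f (f y)) = - y by rewrite ff ff addrAC subrr sub0r.
have a6 : acts (g ^+ 6) id.
  by move=> x t Tt; rewrite (actsX 6 Ng ag) //= !f3 opprK.
have T6 := trivial_action_torus (normalizerX 6 Ng) a6; have ug := normalizer_unit Ng.
have fix6 x : rc (f x) (g ^+ 6) = rc x (g ^+ 6).
  rewrite -ag //; congr rchar; rewrite -mulmxA -[_ *m g]exprSr.
  by rewrite exprS -[g * _]/(g *m _) mulKmx.
apply: kernel_trivial => // x; rewrite -fix6 -fix6 ff rcharD // rcharN // fix6 mulfV //.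
exact: rchar_neq0.
Qed.

End CoxeterAction.

Lemma coset_order h f m t : normalizer G T h -> acts h f -> (0 < m)%N -> h ^+ m = 1%:M ->
  (forall x, orbit_sum f m x = 0) -> (forall j, (0 < j < m)%N -> exists x, iter j f x <> x) ->
  T t -> elt_order (h *m t) m.
Proof.
move=> Nh ah m0 hm f0 fm Tt; have uh := normalizer_unit Nh; split=> // [|j jm e].
  by rewrite exp_mulmx_tnorm // hm (tnorm_trivial Nh ah f0 Tt) mulmx1.
have [x] := fm j jm; apply.
have Nht := normalizerM Nh (normalizer_torus Tt).
have := actsX j Nht (acts_coset Nh Tt ah); rewrite e => aj.
exact: (acts_inj aj (acts_torus (alg_group1 algT))).
Qed.

(** If g and g s have orders a and b, where s is the value at 2 of a cocharacter, then N_m(s) = 1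
    for m = a b, whence v(s)^m = 1. As 2 has infinite order, v pairs to 0 with every cocharacter and
    is trivial on T. *)
Lemma fixed_vector_not_periodic g f v : normalizer G T g -> acts g f -> v <> 0 -> f v = v ->
  ~ periodic (coset T g).
Proof.
move=> Ng ag v0 fv per; have [P uP dT] := max_torus_diag T_max.
have ug := normalizer_unit Ng; have [e He] := rchar_mono v uP dT.
case: v0; apply: rchar_inj => t Tt; rewrite rchar0 He //.
apply: (mono_trivial k_char0 uP algT connT dT) => // h Lh.
have n2 : (2%:R : k) != 0 by apply: (natr_neq0 k_char0).
have Tc := cochar_in_torus k_char0 uP algT Lh n2.
have /per[a [a0 ga _]] : coset T g g by exists 1%:M; [apply: alg_group1 algT|rewrite mulmx1].
have /per[b [b0 gb _]] : coset T g (g *m cochar (pE P) h 2%:R) by exists (cochar (pE P) h 2%:R).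
have [_ _ rM] := rchar_character v.
have fixed s : T s -> rc v (invmx g *m s *m g) = rc v s by move=> Ts; rewrite ag ?fv.
have := char_tnorm_fixed algT (fun s => @normalizer_conjg g s Ng) (a * b) rM
  (char1 algT (rchar_character v)) fixed Tc.
have -> : tnorm g (a * b) (cochar (pE P) h 2%:R) = 1%:M.
  have := exp_mulmx_tnorm (cochar (pE P) h 2%:R) (a * b) ug.
  by rewrite mulnC exprM gb [(b * a)%N]mulnC exprM ga !expr1n mul1mx.
rewrite (char1 algT (rchar_character v)) He // mono_cochar // exprnP exprz_exp -(expr0z 2%:R).
move=> /(exp2z_inj k_char0)/esym/eqP; rewrite mulf_eq0 => /orP[/eqP//|].
by rewrite eqz_nat muln_eq0 => /orP[/eqP c|/eqP c]; [rewrite c in a0|rewrite c in b0].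
Qed.

End RootLattice.

(** * Linear automorphisms of the root system G_2 *)

Lemma lin2_comp M N x : lin2 M (lin2 N x) = lin2 (lin2 M N.1, lin2 M N.2) x.
Proof. by apply: pair_eqP; rewrite /lin2 /=; ring. Qed.

Definition lin2_iter M i := (iter i (lin2 M) (1, 0), iter i (lin2 M) (0, 1)).

Lemma iter_lin2 M i x : iter i (lin2 M) x = lin2 (lin2_iter M i) x.
Proof.
elim: i => [|i IH]; first by apply: pair_eqP; rewrite /lin2 /=; ring.
by rewrite iterS IH lin2_comp.
Qed.

Definition det2 (x y : int * int) : int := x.1 * y.2 - x.2 * y.1.

(** For G_2 this list is the Weyl group, of order twelve. *)
Definition G2_autos : seq ((int * int) * (int * int)) :=
  [seq M <- [seq (a, b) | a <- G2_roots, b <- G2_roots] | all (fun x => lin2 M x \in G2_roots) G2_roots].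

(* the two rotations by a sixth of a turn *)
Definition G2_coxeter : seq ((int * int) * (int * int)) :=
  [:: ((2, 1), (-3, -1)); ((-1, -1), (3, 2))].

(** The determinants vanish exactly when M moves each basis vector by a rational multiple of v, for
    v nonzero. *)
Definition reflects M v : bool :=
  [&& lin2 M v == - v, det2 (M.1 - (1, 0)) v == 0 & det2 (M.2 - (0, 1)) v == 0].

(** By Cramer's rule [det2 x w] and [det2 v x] are, up to the common factor [det2 v w], the
    coordinates of x in the basis v, w; a nonnegative product excludes opposite signs. *)
Definition is_basis v w : bool :=
  (det2 v w != 0) && all (fun x => 0 <= det2 x w * det2 v x) G2_roots.

Lemma G2_autosP M : (forall x, x \in G2_roots -> lin2 M x \in G2_roots) -> M \in G2_autos.
Proof.
case: M => a b H; rewrite mem_filter; apply/andP; split; first by apply/allP.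
apply/allpairsP; exists (a, b) => /=; split=> //.
  by have := H (1, 0) isT; rewrite /lin2 /= !mul1r !mul0r !addr0; case: (a).
by have := H (0, 1) isT; rewrite /lin2 /= !mul1r !mul0r !add0r; case: (b).
Qed.

(** The mirrors of two simple reflections of G_2 meet at a twelfth of a turn, so their product is a
    rotation by a sixth. *)
Lemma coxeter_check : all (fun v => all (fun w => is_basis v w ==>
  all (fun M => reflects M v ==> all (fun N => reflects N w ==>
    ((lin2 M N.1, lin2 M N.2) \in G2_coxeter)) G2_autos) G2_autos) G2_roots) G2_roots.
Proof. by vm_compute. Qed.

Lemma coxeter_product v w M N : v \in G2_roots -> w \in G2_roots -> is_basis v w ->
  M \in G2_autos -> N \in G2_autos -> reflects M v -> reflects N w ->
  exists2 K, K \in G2_coxeter & forall x, lin2 M (lin2 N x) = lin2 K x.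
Proof.
move=> vR wR bvw MA NA rM rN; exists (lin2 M N.1, lin2 M N.2); last exact: lin2_comp.
have := allP (implyP (allP (allP coxeter_check v vR) w wR) bvw) M MA.
by move=> /implyP/(_ rM)/allP/(_ N NA)/implyP; apply.
Qed.

(** Besides the five nontrivial powers of K there are the identity and six reflections; a reflection
    of G_2 fixes the roots orthogonal to its own. *)
Lemma autos_check : all (fun K => all (fun M =>
   has (fun i => lin2_iter K i == M) (iota 1 5) || has (fun v => lin2 M v == v) G2_roots)
   G2_autos) G2_coxeter.
Proof. by vm_compute. Qed.

Lemma autos_dichotomy K M : K \in G2_coxeter -> M \in G2_autos ->
  (exists2 i, (1 <= i <= 5)%N & forall x, iter i (lin2 K) x = lin2 M x) \/
  (exists2 v, v \in G2_roots & lin2 M v = v).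
Proof.
move=> KC MA; have /orP[/hasP[i Hi /eqP Ei]|/hasP[v vR /eqP Ev]] := allP (allP autos_check K KC) M MA.
  by left; exists i => [|x]; [rewrite mem_iota in Hi; lia|rewrite iter_lin2 Ei].
by right; exists v.
Qed.

Lemma orbit_sum_lin2 M m x : orbit_sum (lin2 M) m x =
  lin2 (orbit_sum (lin2 M) m (1, 0), orbit_sum (lin2 M) m (0, 1)) x.
Proof.
elim: m x => [|m IH] x; first by apply: pair_eqP; rewrite /lin2 /=; ring.
rewrite /= IH [orbit_sum _ m (lin2 M (1, 0))]IH [orbit_sum _ m (lin2 M (0, 1))]IH.
by apply: pair_eqP; rewrite /lin2 /=; ring.
Qed.

(** A nontrivial rotation has no nonzero fixed vector, so 1 + M + ... + M^(m-1) = 0 when M has order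
    m. *)
Lemma orders_check : all (fun K => all (fun im : nat * nat =>
  [&& orbit_sum (lin2 (lin2_iter K im.1)) im.2 (1, 0) == 0,
      orbit_sum (lin2 (lin2_iter K im.1)) im.2 (0, 1) == 0 &
      all (fun j => iter j (lin2 (lin2_iter K im.1)) (1, 0) != (1, 0)) (iota 1 im.2.-1)])
  [:: (1, 6); (2, 3); (3, 2); (4, 3); (5, 6)]%N) G2_coxeter.
Proof. by vm_compute. Qed.

Lemma coxeter_orders K i m : K \in G2_coxeter ->
  (i, m) \in [:: (1, 6); (2, 3); (3, 2); (4, 3); (5, 6)]%N ->
  (forall x, orbit_sum (lin2 (lin2_iter K i)) m x = 0) /\
  (forall j, (0 < j < m)%N -> iter j (lin2 (lin2_iter K i)) (1, 0) <> (1, 0)).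
Proof.
move=> KC im; have /and3P[/eqP e1 /eqP e2 /allP nj] := allP (allP orders_check K KC) _ im.
split=> [x|j jm]; last by apply/eqP/nj; rewrite mem_iota /=; lia.
by rewrite orbit_sum_lin2 e1 e2; apply: pair_eqP; rewrite /lin2 /=; ring.
Qed.

(** Both matrices have trace 1 and determinant 1, so their characteristic polynomial is the sixth
    cyclotomic polynomial. *)
Lemma coxeter_square K x : K \in G2_coxeter -> lin2 K (lin2 K x) = lin2 K x - x.
Proof.
by rewrite !inE => /orP[/eqP->|/eqP->]; apply: pair_eqP; rewrite /lin2 /=; ring.
Qed.

(** * Coxeter elements of W *)

Section CoxeterElements.
Variables (k : closedFieldType) (k_char0 : [pchar k] =i pred0) (n : nat).
Variables (G T : 'M[k]_n -> Prop) (G_simple : simple_alg_group G) (T_max : maximal_torus G T).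
Variables (alpha beta : 'M[k]_n -> k).
Hypotheses (Ha : is_character T alpha) (Hb : is_character T beta).
Hypothesis indep : forall a b : int,
  (forall t, T t -> alpha t ^ a * beta t ^ b = 1) -> a = 0 /\ b = 0.
Hypothesis rootsE : forall chi, is_character T chi -> (is_root G T chi <->
  exists2 x, x \in G2_roots & forall t, T t -> chi t = alpha t ^ x.1 * beta t ^ x.2).

Let algT := max_torus_alg T_max.
Let rootP := rootP rootsE.
Let rchar_inj := rchar_inj T_max Ha Hb indep.

Let rcharD := rcharD Ha Hb.
Let rcharN := rcharN T_max Ha Hb.

Local Notation rc := (rchar alpha beta).
Local Notation acts := (acts T alpha beta).

Lemma weyl_mul_coset (A B : 'M[k]_n -> Prop) g h : normalizer G T h ->
  same_set A (coset T g) -> same_set B (coset T h) ->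
  same_set (weyl_mul A B) (coset T (g *m h)).
Proof.
move=> Nh EA EB x; split=> [[a [b [/EA[t Tt ->] /EB[s Ts ->] ->]]]|[t Tt ->]].
  have uh := normalizer_unit G_simple Nh.
  exists (invmx h *m t *m h *m s); last by rewrite !mulmxA mulmxK.
  by apply: (alg_groupM algT) => //; apply: (normalizer_conjg G_simple Nh).
exists g, (h *m t); split; last by rewrite !mulmxA.
  by apply/EA; exists 1%:M; [apply: alg_group1 algT|rewrite mulmx1].
by apply/EB; exists t.
Qed.

Lemma coset1 : same_set T (coset T 1%:M).
Proof.
by move=> t; split=> [Tt|[s Ts ->]]; [exists t => //; rewrite mul1mx|rewrite mul1mx].
Qed.

Lemma weyl_pow_coset c g i : normalizer G T g -> same_set c (coset T g) ->
  same_set (weyl_pow T c i) (coset T (g ^+ i)).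
Proof.
move=> Ng Ec; elim: i => [|i IH]; first exact: coset1.
by rewrite exprS; apply: weyl_mul_coset => //; apply: (normalizerX G_simple T_max).
Qed.

Definition comb r (d : 'I_r -> int * int) (m : 'I_r -> int) : int * int :=
  (\sum_i (d i).1 * m i, \sum_i (d i).2 * m i).

Lemma prod_rchar r (D : 'I_r -> 'M[k]_n -> k) d m t : T t ->
  (forall i t, T t -> D i t = rc (d i) t) -> \prod_i D i t ^ m i = rc (comb d m) t.
Proof.
move=> Tt HD; rewrite /comb.
have [_ a0 _] := Ha; have [_ b0 _] := Hb.
have sumX a (F : 'I_r -> int) : a != 0 -> a ^ (\sum_i F i) = \prod_i a ^ F i :> k.
  move=> na; apply: (big_morph (fun z : int => a ^ z)) => [x y|]; last exact: expr0z.
  by rewrite expfzDr.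
rewrite /rchar /= !sumX ?a0 ?b0 // -big_split /=; apply: eq_bigr => i _.
by rewrite HD // rchar_exprz.
Qed.

(** The number r comes with the Coxeter element. Independence in a lattice of rank two bounds it
    above, and generation of (1, 0) and (0, 1) bounds it below. *)
Lemma simple_roots_pair r (D : 'I_r -> 'M[k]_n -> k) : simple_roots G T D ->
  r = 2 /\ exists d, [/\ forall i, d i \in G2_roots, forall i t, T t -> D i t = rc (d i) t
    & forall i j, i != j -> is_basis (d i) (d j)].
Proof.
case=> RD indD genD.
have [d Hd] : exists d, forall i, d i \in G2_roots /\ forall t, T t -> D i t = rc (d i) t.
  have H i : exists x, x \in G2_roots /\ forall t, T t -> D i t = rc x t.
    by have [x xR Ex] := rootP (RD i); exists x.
  by exists (fun i => proj1_sig (constructive_indefinite_description _ (H i))) => i;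
    exact: proj2_sig (constructive_indefinite_description _ (H i)).
have dR i : d i \in G2_roots := proj1 (Hd i).
have Dd i t : T t -> D i t = rc (d i) t := proj2 (Hd i) t.
have free m : comb d m = 0 -> forall i, m i = 0.
  by move=> e; apply: indD => t Tt; rewrite (prod_rchar _ Tt Dd) e rchar0.
have gen x : x \in G2_roots -> exists2 m, (forall i, 0 <= m i) \/ (forall i, m i <= 0) &
    x = comb d m.
  move=> xR; have [m [Hm Em]] := genD _ (rchar_root T_max Ha Hb rootsE xR).
  by exists m => //; apply: rchar_inj => t Tt; rewrite Em // (prod_rchar _ Tt Dd).
have sum_delta (F : 'I_r -> int) i z : \sum_a F a * ((a == i)%:Z * z) = F i * z.
  rewrite (bigD1 i) //= eqxx mul1r big1 ?addr0 // => a na.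
  by rewrite (negPf na) mul0r mulr0.
(* If the determinant vanishes, the coordinates of [d i] and [d j] are the coefficients of linear
   relations between them. *)
have det0 i j : i != j -> det2 (d i) (d j) != 0.
  move=> nij; apply/eqP => e.
  have key (y z : int) : (d i).1 * y + (d j).1 * z = 0 -> (d i).2 * y + (d j).2 * z = 0 ->
      y = 0.
    move=> e1 e2; have := free (fun a => (a == i)%:Z * y + (a == j)%:Z * z) _ i.
    rewrite eqxx (negPf nij) mul1r mul0r addr0; apply; apply: pair_eqP; rewrite /comb /=.
      by under eq_bigr => a _ do rewrite mulrDr; rewrite big_split /= !sum_delta.
    by under eq_bigr => a _ do rewrite mulrDr; rewrite big_split /= !sum_delta.
  have y1 : (d j).1 = 0.
    apply: (key _ (- (d i).1)); first by ring.
    by rewrite -[RHS]oppr0 -e /det2; ring.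
  have y2 : (d j).2 = 0.
    apply: (key _ (- (d i).2)); last by ring.
    by rewrite -[RHS]e /det2; ring.
  by have := dR j; rewrite (_ : d j = 0) //; apply: pair_eqP.
have r2 : r = 2.
  case: r D RD indD genD d Hd dR Dd free gen sum_delta det0 => [|[|[|r]]] //.
  - move=> D _ _ _ d _ _ _ _ gen _ _; have [m _] := gen (1, 0) isT.
    by rewrite /comb !big_ord0.
  - move=> D _ _ _ d _ _ _ _ gen _ _.
    have [m _] := gen (1, 0) isT; have [m' _] := gen (0, 1) isT.
    by rewrite /comb !big_ord1 => -[e1 e2] [e3 e4]; nia.
  move=> D _ _ _ d _ _ _ free _ sum_delta det0.
  pose i0 : 'I_r.+3 := @Ordinal r.+3 0 isT; pose i1 : 'I_r.+3 := @Ordinal r.+3 1 isT.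
  pose i2 : 'I_r.+3 := @Ordinal r.+3 2 isT.
  have n12 : i1 != i2 by []; case/eqP: (det0 _ _ n12).
  (* In rank two, det(d1, d2) d0 + det(d2, d0) d1 + det(d0, d1) d2 = 0 relates any three vectors. *)
  have := free (fun a => (a == i0)%:Z * det2 (d i1) (d i2) +
    (a == i1)%:Z * det2 (d i2) (d i0) + (a == i2)%:Z * det2 (d i0) (d i1)) _ i0.
  rewrite eqxx mul1r !mul0r !addr0; apply; apply: pair_eqP; rewrite /comb /=.
    under eq_bigr => a _ do rewrite !mulrDr.
    by rewrite !big_split /= !sum_delta /det2; ring.
  under eq_bigr => a _ do rewrite !mulrDr.
  by rewrite !big_split /= !sum_delta /det2; ring.
split=> //; exists d; split=> // i j nij.
apply/andP; split; first exact: det0.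
apply/allP => x xR; have [m Hm ->] := gen x xR.
have sum2 (F : 'I_r -> int) : \sum_a F a = F i + F j.
  rewrite (bigD1 i) //= (bigD1 j) 1?eq_sym //= big1 ?addr0 // => a /andP[ai aj].
  have c3 : #|[:: a; i; j]| = 3.
    by apply/card_uniqP; rewrite /= !inE negb_or ai aj nij.
  by have := max_card (mem [:: a; i; j]); rewrite c3 card_ord r2.
rewrite /comb !sum2 /det2 /=.
have -> : ((d i).1 * m i + (d j).1 * m j) * (d j).2 - ((d i).2 * m i + (d j).2 * m j) * (d j).1 =
  m i * det2 (d i) (d j) by rewrite /det2; ring.
have -> : (d i).1 * ((d i).2 * m i + (d j).2 * m j) - (d i).2 * ((d i).1 * m i + (d j).1 * m j) =
  m j * det2 (d i) (d j) by rewrite /det2; ring.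
rewrite mulrACA; apply: mulr_ge0; last by rewrite -expr2 sqr_ge0.
by case: Hm => H; [rewrite mulr_ge0|rewrite mulr_le0].
Qed.

(** The formula for arbitrary characters is kept along with the action on the root lattice: it
    controls the weights of T on k^n, which are not yet known to lie in that lattice. *)
Lemma reflection_acts (D : 'M[k]_n -> k) v s : (forall t, T t -> D t = rc v t) ->
  is_reflection G T D s -> exists g M,
  [/\ normalizer G T g, same_set s (coset T g), acts g (lin2 M), M \in G2_autos & reflects M v]
  /\ forall chi, is_character T chi -> exists z : int,
       forall t, T t -> chi (invmx g *m t *m g) = chi t * rc v t ^ z.
Proof.
move=> Dv [[g Ng Es] Hs].
have sg : s g by apply/Es; exists 1%:M; [apply: alg_group1 algT|rewrite mulmx1].
have [Dg chig] := Hs g sg.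
have gT t : T t -> T (invmx g *m t *m g) by apply: (normalizer_conjg G_simple Ng).
have [M aM MR] := acts_exists k_char0 G_simple T_max Ha Hb indep rootsE Ng.
have chi_v chi : is_character T chi -> exists z : int,
    forall t, T t -> chi (invmx g *m t *m g) = chi t * rc v t ^ z.
  by move=> /chig[m Hm]; exists (- m) => t Tt; rewrite Hm // Dv.
exists g, M; split=> //; split=> //; first exact: G2_autosP.
have par x : det2 (lin2 M x - x) v = 0.
  have [z Hz] := chi_v _ (rchar_character T_max Ha Hb x).
  have -> : lin2 M x - x = (v.1 * z, v.2 * z).
    apply/eqP; rewrite subr_eq addrC; apply/eqP; apply: rchar_inj => t Tt.
    by rewrite -aM // Hz // rcharD // rchar_exprz.
  by rewrite /det2 /=; ring.
apply/and3P; split; [|have := par (1, 0)|have := par (0, 1)].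
- apply/eqP; apply: rchar_inj => t Tt.
  by rewrite -aM // -Dv ?Dg ?Dv ?rcharN //; apply: gT.
- by rewrite /lin2 /= !mul1r !mul0r !addr0 -surjective_pairing => ->.
- by rewrite /lin2 /= !mul1r !mul0r !add0r -surjective_pairing => ->.
Qed.

Lemma coxeter_elt_acts c : coxeter_elt G T c -> exists g K,
  [/\ normalizer G T g, same_set c (coset T g), acts g (lin2 K) & K \in G2_coxeter]
  /\ forall chi, is_character T chi -> exists u,
       forall t, T t -> chi (invmx g *m t *m g) = chi t * rc u t.
Proof.
case=> r [D [s [/simple_roots_pair[r2 [d [dR Dd bas]]] refl Ec]]].
case: _ / (esym r2) D s d dR Dd bas refl Ec => D s d dR Dd bas refl Ec.
pose i0 : 'I_2 := ord0; pose i1 : 'I_2 := lift ord0 ord0.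
have [g [M [[Ng Eg ag MA rM] chi_g]]] := reflection_acts (Dd i0) (refl i0).
have [h [N [[Nh Eh ah NA rN] chi_h]]] := reflection_acts (Dd i1) (refl i1).
have [K KC EK] := coxeter_product (dR i0) (dR i1) (bas i0 i1 isT) MA NA rM rN.
exists (g *m h), K; split; first split=> //.
- exact: (normalizerM G_simple).
- move=> x; apply: (iff_trans (Ec x)).
  rewrite /weyl_prod enum_ordSl enum_ordSl enum_ord0 /=.
  apply: weyl_mul_coset => //.
  have : same_set (weyl_mul (s i1) T) (coset T (h *m 1%:M)).
    apply: weyl_mul_coset => //; last exact: coset1.
    exact: (normalizer_torus T_max (alg_group1 algT)).
  by rewrite mulmx1.
- move=> x t Tt; rewrite -EK.
  exact: (actsM G_simple Ng Nh ag ah x Tt).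
move=> chi Hc; have [z Hz] := chi_g _ Hc; have [y Hy] := chi_h _ Hc.
(* The root of the second reflection is evaluated at g^-1 t g, which replaces it by its image under
   M. *)
pose w := lin2 M (d i1).
exists (((d i0).1 * z, (d i0).2 * z) + (w.1 * y, w.2 * y)) => t Tt.
have ug := normalizer_unit G_simple Ng; have uh := normalizer_unit G_simple Nh.
have Tc := normalizer_conjg G_simple Ng Tt.
by rewrite conjg_comp // Hy // Hz // ag // !rchar_exprz rcharD // mulrA.
Qed.

End CoxeterElements.

(** * Orders of the elements and the periodic components *)

Theorem mainTheorem12 (k : closedFieldType) (k_char0 : [pchar k] =i pred0)
    (n : nat) (G T : 'M[k]_n -> Prop)
    (G_simple : simple_alg_group G)
    (T_max : maximal_torus G T)
    (GT_G2 : type_G2 G T)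
    (c : 'M[k]_n -> Prop) (c_cox : coxeter_elt G T c) :
  [/\ weyl_order T c 6,
      forall C : 'M[k]_n -> Prop, weyl_elt G T C ->
        (periodic C <->
         exists2 i : nat, (1 <= i <= 5)%N & same_set C (weyl_pow T c i))
    & [/\ forall g, weyl_pow T c 1 g -> elt_order g 6,
          forall g, weyl_pow T c 2 g -> elt_order g 3,
          forall g, weyl_pow T c 3 g -> elt_order g 2,
          forall g, weyl_pow T c 4 g -> elt_order g 3
        & forall g, weyl_pow T c 5 g -> elt_order g 6]].
Proof.
case: GT_G2 => alpha [beta [Ha Hb indep rootsE]].
have [g [K [[Ng Ec aK KC] chi_g]]] :=
  coxeter_elt_acts k_char0 G_simple T_max Ha Hb indep rootsE c_cox.
have algT := max_torus_alg T_max; have T1 := alg_group1 algT.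
have ff x := coxeter_square x KC.
have g6 := coxeter_power6 k_char0 G_simple T_max Ha Hb indep rootsE Ng aK ff chi_g.
have Ep i := weyl_pow_coset G_simple T_max i Ng Ec.
have ai i : acts T alpha beta (g ^+ i) (lin2 (lin2_iter K i)).
  by move=> x t Tt; rewrite (actsX G_simple T_max i Ng aK x Tt) iter_lin2.
have ord i m : (i, m) \in [:: (1, 6); (2, 3); (3, 2); (4, 3); (5, 6)]%N ->
    forall h, weyl_pow T c i h -> elt_order h m.
  move=> im h /Ep[t Tt ->]; have [sum0 fixj] := coxeter_orders KC im.
  have Ni := normalizerX G_simple T_max i Ng.
  apply: (coset_order k_char0 G_simple T_max Ha Hb indep rootsE Ni (ai i) _ _ sum0 _ Tt).
  - by move: im; rewrite !inE => /or4P[|||/orP[]] /eqP[_ ->].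
  - rewrite -exprM; have /dvdnP[q ->] : (6 %| i * m)%N.
      by move: im; rewrite !inE => /or4P[|||/orP[]] /eqP[-> ->].
    by rewrite mulnC exprM g6 expr1n.
  - by move=> j jm; exists (1, 0); apply: fixj.
split; last by split; apply: ord.
- split=> // [|j j6 Ej].
    by move=> h; apply: (iff_trans (Ep 6%N h)); rewrite g6; apply: iff_sym; apply: coset1.
  have [_ /(_ j j6)] := coxeter_orders (i := 1%N) (m := 6%N) KC isT; apply.
  (* A power of g in T acts trivially on the root lattice, whereas the j-th power of the rotation
     moves (1, 0). *)
  have Tj : T (g ^+ j) by apply/Ej/Ep; exists 1%:M; rewrite ?mulmx1.
  have a1 := ai 1%N; rewrite expr1 in a1.
  exact: (acts_inj T_max Ha Hb indep (actsX G_simple T_max j Ng a1) (acts_torus T_max _ _ Tj)).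
- move=> C [h Nh EC]; split=> [perC|[i i15 EC'] x /EC' xi]; last first.
    have [m im] : exists m, (i, m) \in [:: (1, 6); (2, 3); (3, 2); (4, 3); (5, 6)]%N.
      by case: i i15 {EC' xi} => [|[|[|[|[|[|i]]]]]] // _; [exists 6|exists 3|exists 2|exists 3|exists 6].
    by exists m; apply: (ord i m im).
  have [M aM MR] := acts_exists k_char0 G_simple T_max Ha Hb indep rootsE Nh.
  case: (autos_dichotomy KC (G2_autosP MR)) => [[i i15 Ei]|[v vR vM]]; last first.
    have v0 : v <> 0 by move=> e; move: vR; rewrite e.
    have := fixed_vector_not_periodic k_char0 G_simple T_max Ha Hb indep rootsE Nh aM v0 vM.
    by case=> x /EC /perC.
  exists i => //.
  have i6 : (6 - i + i = 6)%N by lia.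
  have Ni j := normalizerX G_simple T_max j Ng.
  (* h and g^i act on the root lattice by the same matrix. Since g^6 = 1, the element g^(6-i) h is
     their quotient, and it acts trivially. *)
  have Tt : T (g ^+ (6 - i) *m h).
    apply: (trivial_action_torus k_char0 G_simple T_max Ha Hb indep rootsE Ng aK ff chi_g).
      exact: (normalizerM G_simple).
    move=> x t Tt; rewrite (actsM G_simple (Ni _) Nh (actsX G_simple T_max _ Ng aK) aM) //=.
    rewrite -Ei -iterD i6 -(actsX G_simple T_max 6 Ng aK) // g6.
    by rewrite (acts_torus T_max _ _ T1).
  set t := g ^+ (6 - i) *m h in Tt.
  have ht : h = g ^+ i *m t.
    by rewrite /t mulmxA -[_ ^+ i *m _]exprD addnC i6 g6 mul1mx.
  have Et : same_set (coset T h) (coset T (g ^+ i)).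
    move=> x; split=> -[s Ts ->].
      by exists (t *m s); [apply: alg_groupM|rewrite ht !mulmxA].
    exists (invmx t *m s); first by apply: (alg_groupM algT) => //; apply: alg_groupV.
    by rewrite ht -mulmxA mulKVmx // (alg_group_unit algT).
  by move=> x; apply: (iff_trans (EC x)); apply: (iff_trans (Et x)); apply: iff_sym; apply: Ep.
Qed.
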